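(* Let $x'=\varphi(x)=(ax+b)(cx+d)^{-1}$ be a Möbius transformation, $x\in\mathbb{R}^m$, let $y'=\varphi(y)$, and put $u'=\frac{(cy+d)u\widetilde{(cy+d)}}{\|cy+d\|^2}$ and $v'=\frac{(cx+d)v\widetilde{(cx+d)}}{\|cx+d\|^2}$. Then for each positive integer order $t$, $$E_t(x'-y',u',v')\ast f(x',u')=J_t^{-1}(\varphi,y)\,E_t(x-y,u,v)\,J_{-t}(\varphi,x)\ast f\Big(\varphi(x),\frac{(cy+d)u\widetilde{(cy+d)}}{\|cy+d\|^2}\Big).$$ Written out, $$\int_{\mathbb{R}^m}\int_{\mathbb{S}^{m-1}}E_t(x'-y',u',v')f(x',u')\,dS(u')\,dx'^m=\int_{\mathbb{R}^m}\int_{\mathbb{S}^{m-1}}J_t^{-1}(\varphi,y)E_t(x-y,u,v)J_{-t}(\varphi,x)f\Big(\varphi(x),\tfrac{(cy+d)u\widetilde{(cy+d)}}{\|cy+d\|^2}\Big)dS(u)\,dx^m .$$ Here $f\in C^\infty(\mathbb{R}^m,\mathcal{H}_k)$ if $t$ is even and $f\in C^\infty(\mathbb{R}^m,\mathcal{M}_k)$ if $t$ is odd, with compact support in the first variable.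
   Context: $\mathbb{R}^m$ is embedded in the complex Clifford algebra $\mathcal{C}l_m(\mathbb{C})$ with $e_ie_j+e_je_i=-2\delta_{ij}$, so $x^2=-\|x\|^2$; products such as $xux$ are Clifford products; tilde denotes reversion. Möbius transformations are $\varphi(x)=(ax+b)(cx+d)^{-1}$ with $a,b,c,d$ products of vectors in $\mathbb{R}^m$, $a\tilde b,c\tilde d,\tilde bc,\tilde da\in\mathbb{R}^m$, $a\tilde d-b\tilde c=\pm1$. $\mathcal{H}_k$: complex-valued harmonic polynomials in $u\in\mathbb{R}^m$ homogeneous of degree $k$. $\mathcal{M}_k$: polynomials in $u$ homogeneous of degree $k$ with values in the Dirac spinor space $\mathcal{S}\subset\mathcal{C}l_m(\mathbb{C})$ and annihilated by $D_u=\sum_ie_i\partial_{u_i}$. The reproducing kernel $Z_k(u,v)$ of either space satisfies $f(v)=\int_{\mathbb{S}^{m-1}}\overline{Z_k(u,v)}f(u)\,dS(u)$ for all $f$ in the space. For a positive integer $j$, $$E_{2j}(x,u,v)=\|x\|^{2j-m}Z_k\Big(\frac{xux}{\|x\|^2},v\Big)\ (Z_k\text{ the kernel of }\mathcal{H}_k),\qquad E_{2j-1}(x,u,v)=\frac{x}{\|x\|^{m-2j+2}}Z_k\Big(\frac{xux}{\|x\|^2},v\Big)\ (Z_k\text{ the kernel of }\mathcal{M}_k).$$ The convolution type operation is $E_t(x-y,u,v)\ast f(x,u)=\int_{\mathbb{R}^m}\int_{\mathbb{S}^{m-1}}E_t(x-y,u,v)f(x,u)\,dS(u)\,dx^m$;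 in the claim $v$ and $y$ are fixed and $u',v',x'$ are the indicated functions of $u,v,x,y$. The weights are: $J_t(\varphi,x)=\|cx+d\|^{2j-m}$, $J_{-t}(\varphi,x)=\|cx+d\|^{-m-2j}$ if $t=2j$; $J_t(\varphi,x)=\frac{\widetilde{cx+d}}{\|cx+d\|^{m-2j+2}}$, $J_{-t}(\varphi,x)=\frac{\widetilde{cx+d}}{\|cx+d\|^{m+2j}}$ if $t=2j-1$. $J_t^{-1}$ denotes the multiplicative inverse.
   Formalization: The Möbius conditions b~c, d~a in R^m (inconsistent with ad~-bc~=±1) are replaced by c~a, d~b in R^m; for odd t the right side carries the sign (ad~-bc~)(cy+d)(cy+d)~/||cy+d||^2 = ±1, since e.g. φ(x)=-x violates the printed identity; cy+d is assumed invertible. *)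

(* Defs.v *)
From HB Require Import structures.
From mathcomp Require Import all_boot all_order all_algebra falgebra.
From mathcomp Require Import ring.
Set Implicit Arguments.
Unset Strict Implicit.
Unset Printing Implicit Defensive.
Import Order.TTheory GRing.Theory Num.Theory.
Local Open Scope ring_scope.

Definition setSD (T : finType) (A B : {set T}) : {set T} := A :\: B :|: B :\: A.

(* Clifford algebra of the negative definite form over K, as the K-space with
   basis (e_A), A : {set 'I_m}; z A is the coefficient of e_A. *)
Definition cliff (K : fieldType) (m : nat) : Type := {ffun {set 'I_m} -> K}.

Section CliffordAlgebra.
Context {K : fieldType} {m : nat}.
Implicit Types (A B C D : {set 'I_m}) (x y z : cliff K m).

HB.instance Definition _ := Vector.copy (cliff K m) {ffun {set 'I_m} -> K^o}.

(* e_A * e_B = csign A B *: e_(setSD A B), where e_A is the product of the e_i,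
   i \in A, in increasing order: one factor -1 for each transposition of
   e_i and e_j with j < i, and one for each square e_i ^+ 2 = -1. *)
Definition csign A B : K := \prod_(i in A) \prod_(j in B | (j <= i)%N) -1.

Definition cone : cliff K m := [ffun C => (C == set0)%:R].

Definition cmul x y : cliff K m :=
  [ffun C => \sum_A csign A (setSD A C) * x A * y (setSD A C)].

Lemma in_setSD A B i : (i \in setSD A B) = (i \in A) (+) (i \in B).
Proof. by rewrite !inE; case: (i \in A); case: (i \in B). Qed.

Lemma setSDA A B C : setSD A (setSD B C) = setSD (setSD A B) C.
Proof. by apply/setP => i; rewrite !in_setSD addbA. Qed.
Lemma setSDC A B : setSD A B = setSD B A.
Proof. by apply/setP => i; rewrite !in_setSD addbC. Qed.
Lemma set0SD A : setSD set0 A = A.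
Proof. by apply/setP => i; rewrite !in_setSD inE. Qed.
Lemma setSDK A B : setSD A (setSD A B) = B.
Proof. by rewrite setSDA; apply/setP => i; rewrite !in_setSD addbb. Qed.
Lemma setSD_eq0 A B : (setSD A B == set0) = (A == B).
Proof.
apply/eqP/eqP => [|->]; last by apply/setP => i; rewrite !in_setSD addbb inE.
by move=> AB; rewrite -[B](setSDK A) AB setSDC set0SD.
Qed.

Lemma prodr_setSD (f : 'I_m -> K) A B : (forall i, f i * f i = 1) ->
  \prod_(i in setSD A B) f i = (\prod_(i in A) f i) * \prod_(i in B) f i.
Proof.
move=> ff; rewrite ![\prod_(i in _) f i]big_mkcond -big_split /=.
apply: eq_bigr => i _; rewrite in_setSD.
by case: (i \in A); case: (i \in B); rewrite ?mulr1 ?mul1r ?ff.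
Qed.

Lemma csignDl A B C : csign (setSD A B) C = csign A C * csign B C.
Proof.
apply: prodr_setSD => i; rewrite -big_split /= big1 // => j _.
by rewrite mulrNN mulr1.
Qed.

Lemma csignDr A B C : csign A (setSD B C) = csign A B * csign A C.
Proof.
rewrite /csign -big_split; apply: eq_bigr => i _ /=.
rewrite !big_mkcondr; apply: prodr_setSD => j.
by case: ifP; rewrite ?mulrNN mulr1.
Qed.

Lemma csign0l A : csign set0 A = 1.
Proof. by rewrite /csign big_set0. Qed.

Lemma csign0r A : csign A set0 = 1.
Proof.
by rewrite /csign big1 // => i _; rewrite big_pred0 // => j; rewrite inE.
Qed.

Lemma cmulA : associative cmul.
Proof.
move=> x y z; apply/ffunP => D; rewrite !ffunE.
pose F A B W := csign A B * csign A W * csign B W * (x A * y B * z W).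
transitivity (\sum_A \sum_B F A B (setSD (setSD A B) D)).
  apply: eq_bigr => A _; rewrite ffunE mulr_sumr; apply: eq_bigr => B _.
  have -> : setSD B (setSD A D) = setSD (setSD A B) D.
    by rewrite setSDA (setSDC B).
  have -> : setSD A D = setSD B (setSD (setSD A B) D).
    by apply/setP => i; rewrite !in_setSD; do !case: (_ \in _).
  by rewrite csignDr /F; ring.
transitivity (\sum_A \sum_E F A (setSD A E) (setSD E D)).
  apply: eq_bigr => A _; rewrite (reindex_inj (can_inj (setSDK A))) /=.
  by apply: eq_bigr => E _; rewrite setSDK.
rewrite exchange_big /=; apply: eq_bigr => E _.
rewrite ffunE mulr_sumr mulr_suml; apply: eq_bigr => A _.
have -> : csign E (setSD E D) =
    csign A (setSD E D) * csign (setSD A E) (setSD E D).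
  by rewrite -csignDl setSDK.
by rewrite /F; ring.
Qed.

Lemma cmul1l : left_id cone cmul.
Proof.
move=> x; apply/ffunP => C; rewrite !ffunE (bigD1 set0) //= big1 => [|A A0].
  by rewrite ffunE eqxx set0SD csign0l !mul1r addr0.
by rewrite ffunE (negbTE A0) mulr0 mul0r.
Qed.

Lemma cmul1r : right_id cone cmul.
Proof.
move=> x; apply/ffunP => C; rewrite !ffunE (bigD1 C) //= big1 => [|A A0].
  have /eqP -> : setSD C C == set0 by rewrite setSD_eq0.
  by rewrite ffunE eqxx csign0r mul1r mulr1 addr0.
by rewrite ffunE setSD_eq0 (negbTE A0) mulr0.
Qed.

Lemma cmulDl : left_distributive cmul +%R.
Proof.
move=> x y z; apply/ffunP => C; rewrite !ffunE -big_split.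
by apply: eq_bigr => A _; rewrite !ffunE mulrDr mulrDl.
Qed.

Lemma cmulDr : right_distributive cmul +%R.
Proof.
move=> x y z; apply/ffunP => C; rewrite !ffunE -big_split.
by apply: eq_bigr => A _; rewrite !ffunE mulrDr.
Qed.

Lemma cone_neq0 : cone != 0 :> cliff K m.
Proof.
by apply/eqP => /ffunP/(_ set0); rewrite !ffunE eqxx; apply/eqP/oner_neq0.
Qed.

HB.instance Definition _ := GRing.Zmodule_isNzRing.Build (cliff K m)
  cmulA cmul1l cmul1r cmulDl cmulDr cone_neq0.

Lemma cscalerAl (k : K) x y : k *: (x * y) = (k *: x) * y.
Proof.
apply/ffunP => C; rewrite !ffunE scaler_sumr; apply: eq_bigr => A _.
by rewrite !ffunE /= /GRing.scale /= !mulrA (mulrC k).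
Qed.

HB.instance Definition _ :=
  GRing.LSemiModule_isLSemiAlgebra.Build K (cliff K m) cscalerAl.

Lemma cscalerAr (k : K) x y : k *: (x * y) = x * (k *: y).
Proof.
apply/ffunP => C; rewrite !ffunE scaler_sumr; apply: eq_bigr => A _.
by rewrite !ffunE /= /GRing.scale /= mulrCA.
Qed.

HB.instance Definition _ :=
  GRing.LSemiAlgebra_isSemiAlgebra.Build K (cliff K m) cscalerAr.

HB.instance Definition _ := Algebra_isFalgebra.Build K (cliff K m).

Definition ce (i : 'I_m) : cliff K m := [ffun A => (A == [set i])%:R].

Lemma ceM i j : ce i * ce j + ce j * ce i = - (2%:R * (i == j)%:R)%:A.
Proof.
have E i' j' : ce i' * ce j' = (csign [set i'] [set j']) *:
    ([ffun C => (C == setSD [set i'] [set j'])%:R] : cliff K m).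
  apply/ffunP => C; rewrite !ffunE (bigD1 [set i']) //= big1 => [|A /negbTE A0]; last first.
    by rewrite !ffunE A0 mulr0 mul0r.
  rewrite addr0 !ffunE eqxx mulr1 /GRing.scale /=.
  have -> : (C == setSD [set i'] [set j']) = (setSD [set i'] C == [set j']).
    by apply/eqP/eqP => [->|<-]; rewrite setSDK.
  have [->|_] := eqVneq (setSD [set i'] C) [set j']; first by [].
  by rewrite !mulr0.
have S i' j' : csign [set i'] [set j'] = if (j' <= i')%N then -1 else 1.
  by rewrite /csign big_set1 big_mkcondr big_set1.
rewrite !E !S (setSDC [set j]); have [<-|ij] := eqVneq i j.
  rewrite leqnn mulr1 -scalerDl; have -> : setSD [set i] [set i] = set0.
    by apply/eqP; rewrite setSD_eq0.
  by rewrite -opprD -scaleNr.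
rewrite mulr0 scale0r oppr0 -scalerDl.
have := ij; rewrite -val_eqE neq_ltn => /orP[] lt; rewrite (ltnW lt) leqNgt lt /=.
  by rewrite subrr scale0r.
by rewrite addNr scale0r.
Qed.
End CliffordAlgebra.

From mathcomp Require Import -(notations) mpoly.
From mathcomp Require Import all_classical all_reals all_analysis.
From mathcomp Require Import measurable_realfun.
From mathcomp.real_closed Require Import complex.
Import numFieldNormedType.Exports.
Local Open Scope classical_set_scope.
Local Open Scope ring_scope.

Section Measures.
Context {R : realType}.
Notation mR := (measurableTypeR R).

Definition enorm m (x : 'rV[R]_m) : R := Num.sqrt (\sum_i x 0 i ^+ 2).

(* The points of R^m are row vectors (the normed module), whereas the measures
   live on m.-tuple, which carries the product sigma-algebra. *)
Definition row_of_tuple m (t : m.-tuple mR) : 'rV[R]_m := \row_i tnth t i.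

Definition tuple_cons m (p : mR * m.-tuple mR) : m.+1.-tuple mR :=
  [tuple of p.1 :: p.2].

Lemma measurable_tuple_cons m : measurable_fun setT (@tuple_cons m).
Proof. exact: measurable_cons. Qed.

Definition lebesgue_cons m
    (mu : {sigma_finite_measure set (m.-tuple mR) -> \bar R}) :=
  pushforward (lebesgue_measure \x mu)%E (@tuple_cons m).

Section lebesgue_cons.
Context m (mu : {sigma_finite_measure set (m.-tuple mR) -> \bar R}).

HB.instance Definition _ := Measure.copy (lebesgue_cons mu)
  (measure_function_pushforward__canonical__measure_function_Measure
     (lebesgue_measure \x mu)%E (@measurable_tuple_cons m)).

Lemma lebesgue_cons_sigma_finite : sigma_finite setT (lebesgue_cons mu).
Proof.
have /sigma_finiteP[F [TF ndF Foo]] := sigma_finiteT (@lebesgue_measure R).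
have /sigma_finiteP[G [TG ndG Goo]] := sigma_finiteT mu.
pose g (t : m.+1.-tuple mR) : mR * m.-tuple mR := (thead t, [tuple of behead t]).
have mg : measurable_fun setT g.
  apply: measurable_fun_pair; first exact: measurable_tnth.
  exact: measurable_behead.
exists (fun n => g @^-1` (F n `*` G n)).
  rewrite -preimage_bigcup -[LHS](preimage_setT g); congr (_ @^-1` _).
  rewrite -setXTT TF TG predeqE => -[x y]; split.
    move=> [/= [n _ Fnx] [k _ Gky]]; exists (maxn n k) => //; split.
    - by move: x Fnx; exact/subsetPset/ndF/leq_maxl.
    - by move: y Gky; exact/subsetPset/ndG/leq_maxr.
  by move=> [n _ []/= ? ?]; split; exists n.
move=> k; have [? ?] := Foo k; have [? ?] := Goo k; split.
  by rewrite -[X in measurable X]setTI; apply: mg => //; exact: measurableX.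
rewrite /lebesgue_cons /pushforward -comp_preimage.
rewrite (_ : g \o _ = id) ?preimage_id; last first.
  apply/funext => -[x t]; rewrite /g /tuple_cons /= theadE; congr (_, _).
  exact: val_inj.
by rewrite product_measure1E// lte_mul_pinfty// ge0_fin_numE.
Qed.

HB.instance Definition _ := Measure_isSigmaFinite.Build _ _ _
  (lebesgue_cons mu) lebesgue_cons_sigma_finite.
End lebesgue_cons.

Fixpoint lebesgue m : {sigma_finite_measure set (m.-tuple mR) -> \bar R} :=
  if m is m'.+1 then lebesgue_cons (lebesgue m') else \d_[tuple].

Lemma measurable_enorm m :
  measurable_fun setT (fun t : m.-tuple mR => enorm (row_of_tuple t)).
Proof.
apply: (@measurableT_comp _ _ _ _ _ _ (@Num.sqrt R)) => //.
  by apply: continuous_measurable_fun; exact: sqrt_continuous.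
apply: measurable_sum => i; apply: measurable_funX.
rewrite (_ : (fun _ => _) = (fun t : m.-tuple mR => tnth t i)).
  exact: measurable_tnth.
by apply/funext => t; rewrite mxE.
Qed.

Definition punctured_ball m : set (m.-tuple mR) :=
  [set t | 0 < enorm (row_of_tuple t) <= 1].

Definition radial m (t : m.-tuple mR) : m.-tuple mR :=
  [tuple (enorm (row_of_tuple t))^-1 * tnth t i | i < m].

Lemma measurable_punctured_ball m : measurable (@punctured_ball m).
Proof.
rewrite (_ : @punctured_ball m =
  (fun t : m.-tuple mR => enorm (row_of_tuple t)) @^-1` `]0, 1]%classic).
  rewrite -[X in measurable X]setTI; apply: measurable_enorm => //.
by apply/seteqP; split => t /=; rewrite in_itv.
Qed.

Lemma measurable_radial m : measurable_fun setT (@radial m).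
Proof.
apply/measurable_fun_tnthP => i.
rewrite (_ : _ \o _ = (fun t : m.-tuple mR =>
   enorm (row_of_tuple t) `^ (-1) * tnth t i)); last first.
  apply/funext => t /=; rewrite tnth_mktuple powR_inv1 //.
  exact: sqrtr_ge0.
apply: measurable_funM; last exact: measurable_tnth.
apply: (@measurableT_comp _ _ _ _ _ _ (fun x : R => x `^ (-1))).
  exact: measurable_powR.
exact: measurable_enorm.
Qed.

Definition radial_pushforward m : set (m.-tuple mR) -> \bar R :=
  pushforward (mrestr (lebesgue m) (@measurable_punctured_ball m)) (@radial m).

HB.instance Definition _ m := Measure.copy (@radial_pushforward m)
  (measure_function_pushforward__canonical__measure_function_Measure
     (mrestr (lebesgue m) (@measurable_punctured_ball m)) (@measurable_radial m)).

(* Surface measure of the unit sphere, in polar coordinates: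
   sigma A = m * vol {x | 0 < |x| <= 1 and x / |x| \in A}. It is carried by the
   unit sphere of R^m. *)
Definition sphere_measure m : {measure set (m.-tuple mR) -> \bar R} :=
  mscale (m%:R)%:nng (@radial_pushforward m).

End Measures.

Section Integrals.
Context {R : realType} {m : nat}.
Notation Rm := 'rV[R]_m.
Notation Cl := (cliff R[i] m).

Definition cplx_integral (mu : {measure set (m.-tuple (measurableTypeR R)) -> \bar R})
    (g : Rm -> R[i]) : R[i] :=
  Complex (\int[mu]_t complex.Re (g (row_of_tuple t)))
          (\int[mu]_t complex.Im (g (row_of_tuple t))).

Definition cliff_integral (mu : {measure set (m.-tuple (measurableTypeR R)) -> \bar R})
    (g : Rm -> Cl) : Cl :=
  [ffun A => cplx_integral mu (fun x => g x A)].

Definition cplx_conv (E f : Rm -> Rm -> R[i]) : R[i] :=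
  cplx_integral (lebesgue m) (fun x =>
    cplx_integral (sphere_measure m) (fun u => E x u * f x u)).

Definition cliff_conv (E f : Rm -> Rm -> Cl) : Cl :=
  cliff_integral (lebesgue m) (fun x =>
    cliff_integral (sphere_measure m) (fun u => E x u * f x u)).

End Integrals.

Section CliffordNotions.
Context {R : realType} {m : nat}.
Notation Rm := 'rV[R]_m.
Notation Cl := (cliff R[i] m).
Implicit Types (x y u v : Rm) (z a b c d : Cl).

Definition cvec x : Cl := \sum_i (x 0 i)%:C%C *: ce i.

Definition vec_part z : Rm := \row_i complex.Re (z [set i]%SET).

(* The reversion multiplies e_A by (-1)^(n(n-1)/2), where n = #|A|. *)
Definition rev z : Cl := [ffun A : {set 'I_m} => (-1) ^+ 'C(#|A|, 2) * z A].

(* Hermitian conjugation, the conjugate-linear anti-automorphism with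
   e_i |-> - e_i: the sign on e_A is (-1)^(n(n+1)/2). *)
Definition cconj z : Cl := [ffun A : {set 'I_m} => (-1) ^+ 'C(#|A|.+1, 2) * (z A)^*%C].

Definition cnorm z : R :=
  Num.sqrt (\sum_A (complex.Re (z A) ^+ 2 + complex.Im (z A) ^+ 2)).

Definition is_vec z : Prop := exists x, z = cvec x.

Definition vec_product z : Prop := exists s : seq Rm, z = \prod_(x <- s) cvec x.

(* Vahlen matrices. The mixed conditions are those on c~ a and d~ b: asking
   instead for vectors b~ c and d~ a would be contradictory, as a d~ - b c~
   would then be odd for the Z/2-grading. *)
Definition vahlen a b c d : Prop :=
  [/\ [/\ vec_product a, vec_product b, vec_product c & vec_product d],
      [/\ is_vec (a * rev b), is_vec (c * rev d),
          is_vec (rev c * a) & is_vec (rev d * b)] &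
      a * rev d - b * rev c = 1 \/ a * rev d - b * rev c = -1].

Definition den c d x : Cl := c * cvec x + d.

(* For a Vahlen matrix the Clifford number under vec_part is a vector as soon
   as c x + d is invertible. *)
Definition mobius a b c d x : Rm :=
  vec_part ((a * cvec x + b) * (den c d x)^-1).

(* Unspecified (0) outside the image of the map, which misses at most one
   point. *)
Definition mobius_inv a b c d x' : Rm :=
  xget 0 [set x | den c d x \is a GRing.unit /\ mobius a b c d x = x'].

(* p u p~ / |p|^2, a vector when p is a product of vectors. *)
Definition twist p u : Rm :=
  vec_part ((cnorm p ^- 2)%:C%C *: (p * cvec u * rev p)).

(* x u x / |x|^2 *)
Definition reflect_dir x u : Rm :=
  vec_part ((enorm x ^- 2)%:C%C *: (cvec x * cvec u * cvec x)).

(* The scalar +1 or -1 equal to (a d~ - b c~) * sgn (p p~), p = c x + d. It does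
   not depend on x, and is 1 for translations, dilations, rotations and
   x |-> x^-1. It is -1 for instance for x |-> - x given by a = -1, d = 1,
   b = c = 0, under which an odd kernel E changes sign while all weights are 1. *)
Definition mob_sign a b c d x : Cl :=
  (cnorm (den c d x) ^- 2)%:C%C *:
    ((a * rev d - b * rev c) * (den c d x * rev (den c d x))).

End CliffordNotions.

Section Spaces.
Context {R : realType} {m : nat}.
Notation Rm := 'rV[R]_m.
Notation Cl := (cliff R[i] m).
Notation cpoly := (mpoly m R[i]).
Notation clpoly := (mpoly m Cl).

Definition eval_cplx (p : cpoly) (u : Rm) : R[i] :=
  meval (fun i => (u 0 i)%:C%C) p.

Definition eval_cliff (p : clpoly) (u : Rm) : Cl :=
  meval (fun i => ((u 0 i)%:C%C)%:A) p.

Definition harmonic_poly (k : nat) : set cpoly :=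
  [set p | p \is ishomog1 k (@mdeg m) /\ \sum_i mderiv i (mderiv i p) = 0].

Definition left_ideal (S : {vspace Cl}) : Prop :=
  forall z s, s \in S -> z * s \in S.

(* The Dirac spinor space is realised as a minimal left ideal of the algebra,
   which is unique up to isomorphism if m is even and one of two inequivalent
   modules if m is odd. *)
Definition spinor_space (S : {vspace Cl}) : Prop :=
  [/\ S != 0%VS, left_ideal S &
      forall T : {vspace Cl}, T != 0%VS -> left_ideal T -> (T <= S)%VS -> T = S].

Definition monogenic_poly (S : {vspace Cl}) (k : nat) : set clpoly :=
  [set p | [/\ p \is ishomog1 k (@mdeg m), forall al, mcoeff al p \in S &
               \sum_i mpolyC m (ce i) * mderiv i p = 0]].

(* Kernels are presented as v |-> Z_k(., v). *)
Definition harmonic_kernel (k : nat) (Z : Rm -> cpoly) : Prop :=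
  (forall v, harmonic_poly k (Z v)) /\
  forall f v, harmonic_poly k f ->
    eval_cplx f v = cplx_integral (sphere_measure m)
      (fun u => (eval_cplx (Z v) u)^*%C * eval_cplx f u).

(* Z_k(u, v) acts on spinors by left multiplication; as a function of u it
   belongs to M_k in the sense that Z_k(., v) s does for each spinor s. *)
Definition monogenic_kernel (S : {vspace Cl}) (k : nat) (Z : Rm -> clpoly) : Prop :=
  (forall v s, s \in S -> monogenic_poly S k (Z v * mpolyC m s)) /\
  forall f v, monogenic_poly S k f ->
    eval_cliff f v = cliff_integral (sphere_measure m)
      (fun u => cconj (eval_cliff (Z v) u) * eval_cliff f u).

Fixpoint Cn (n : nat) (g : Rm -> R) : Prop :=
  if n is n'.+1 then
    forall i : 'I_m, (forall x, derivable g x (delta_mx 0 i)) /\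
      Cn n' (fun x => 'D_(delta_mx 0 i) g x)
  else continuous g.

Definition smooth (g : Rm -> R) : Prop := forall n, Cn n g.

Definition smooth_cplx (g : Rm -> R[i]) : Prop :=
  smooth (fun x => complex.Re (g x)) /\ smooth (fun x => complex.Im (g x)).

Definition compactly_supported (V : nmodType) (g : Rm -> V) : Prop :=
  compact (closure [set x | g x != 0]).

Definition Ccinf_harmonic (k : nat) (f : Rm -> cpoly) : Prop :=
  [/\ forall x, harmonic_poly k (f x),
      forall al, smooth_cplx (fun x => mcoeff al (f x)) &
      compactly_supported f].

Definition Ccinf_monogenic (S : {vspace Cl}) (k : nat) (f : Rm -> clpoly) : Prop :=
  [/\ forall x, monogenic_poly S k (f x),
      forall al A, smooth_cplx (fun x => mcoeff al (f x) A) &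
      compactly_supported f].

End Spaces.

Section KernelsWeights.
Context {R : realType} {m : nat}.
Notation Rm := 'rV[R]_m.
Notation Cl := (cliff R[i] m).
Variable j : nat.

Definition E_even (Z : Rm -> mpoly m R[i]) (x u v : Rm) : R[i] :=
  (enorm x ^ ((2 * j)%:Z - m%:Z))%:C%C * eval_cplx (Z v) (reflect_dir x u).

Definition E_odd (Z : Rm -> mpoly m Cl) (x u v : Rm) : Cl :=
  ((enorm x ^ (m%:Z - (2 * j)%:Z + 2))^-1)%:C%C *: cvec x *
    eval_cliff (Z v) (reflect_dir x u).

(* Weights at p = c x + d, for t = 2j and t = 2j - 1. *)
Definition J_even (p : Cl) : R[i] := (cnorm p ^ ((2 * j)%:Z - m%:Z))%:C%C.
Definition Jneg_even (p : Cl) : R[i] := (cnorm p ^ (- m%:Z - (2 * j)%:Z))%:C%C.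
Definition J_odd (p : Cl) : Cl :=
  ((cnorm p ^ (m%:Z - (2 * j)%:Z + 2))^-1)%:C%C *: rev p.
Definition Jneg_odd (p : Cl) : Cl := (cnorm p ^- (m + 2 * j))%:C%C *: rev p.

End KernelsWeights.

(* Main.v *)
(* Every Vahlen matrix with c x + d invertible somewhere is, as a map, either a
   similarity or a similarity composed with an inversion x |-> x / |x|^2; both
   satisfy phi x - phi y = +- (q~)^-1 (x - y) p^-1 with p = c x + d, q = c y + d.
   Hence the reflection in the direction phi x - phi y intertwines the rotations
   u |-> q u q~ / |q|^2 and v |-> p v p~ / |p|^2. A reproducing kernel is unique,
   so the kernels of H_k and M_k are invariant under rotations (M_k with the
   spin action f |-> p f(p^-1 . p)), and the two integrands differ by the factor
   |p|^(2m), up to sign for odd t. This factor is the Jacobian of phi^-1; for the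
   inversion the Jacobian is found by comparing the two measures on thin
   spherical shells over sectors. *)
Require Import Defs.
From HB Require Import structures.
From mathcomp Require Import all_boot all_order all_algebra falgebra.
From mathcomp Require Import ring lra zify.
From mathcomp Require Import -(notations) mpoly.
From mathcomp Require Import all_classical all_reals all_analysis.
From mathcomp Require Import measurable_realfun.
From mathcomp.real_closed Require Import complex.
Set Implicit Arguments.
Unset Strict Implicit.
Unset Printing Implicit Defensive.
Import Order.TTheory GRing.Theory Num.Theory numFieldNormedType.Exports.
Local Open Scope ring_scope.

(** * Clifford numbers *)

(** The outer integrals are never shown to converge. They carry whatever value [fine] gives to the
    difference of the integrals of the positive and negative parts. For a merely measurable
    integrand this value is known to respect only two operations, a substitution with a nonnegative
    density and multiplication by a real constant, so the pointwise comparison has to end in a real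
    factor. Integrability enters only for the kernels, whose integrands are polynomials on the
    sphere.

    No Jacobian determinant occurs: a change of variables is an integral identity for nonnegative
    functions, a notion closed under composition.

    The sign for odd t has two sources. One is the value e of a d~ - b c~ in the formula for phi x -
    phi y. The other is the step from p^-1 in that formula to p~ in the weights, where p^-1 = sg
    |p|^-2 p~ with sg = 1 or -1 the same for all x.

    The kernel of M_k is determined only through its action on the spinor space, so each pointwise
    identity of odd order is applied to a spinor s. *)

Section CliffordSigns.
Context {K : fieldType} {m : nat}.
Implicit Types (A B C : {set 'I_m}).

(** For i different from j exactly one of the two products contributes -1, for i = j both do.
    Relative to (-1)^(|A||B|) each common index therefore costs one more sign. This is the
    commutation sign of e_A and e_B. *)
Lemma csignM_sym A B :
  csign A B * csign B A = (-1) ^+ (#|A| * #|B| + #|A :&: B|) :> K.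
Proof.
have -> : csign B A = \prod_(i in A) \prod_(j in B) (if (i <= j)%N then -1 else 1) :> K.
  rewrite /csign [RHS]exchange_big; apply: eq_bigr => i _.
  by rewrite big_mkcondr.
have -> : csign A B = \prod_(i in A) \prod_(j in B) (if (j <= i)%N then -1 else 1) :> K.
  by apply: eq_bigr => i _; rewrite big_mkcondr.
rewrite -big_split exprD; transitivity
  ((\prod_(i in A) \prod_(j in B) (-1)) *
   (\prod_(i in A) \prod_(j in B) (if i == j then -1 else 1)) : K).
  rewrite -big_split; apply: eq_bigr => i _ /=.
  rewrite -!big_split; apply: eq_bigr => j _ /=.
  have [->|ij] := eqVneq i j; first by rewrite leqnn.
  by case: (ltngtP i j) => [||/val_inj/eqP]; rewrite ?mulr1 ?mul1r// (negbTE ij).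
congr (_ * _).
  by under eq_bigr do rewrite prodr_const; rewrite prodr_const -exprM mulnC.
under eq_bigr => i _.
  rewrite -big_mkcondr (_ : \prod_(_ in _ | _) _ = if i \in B then -1 else 1); last first.
    case: ifP => iB; last first.
      by rewrite big1 // => j /andP[jB /eqP ij]; rewrite ij jB in iB.
    by rewrite (big_pred1 i) // => j /=; rewrite eq_sym; case: eqP => [->|]; rewrite ?iB ?andbF.
  over.
rewrite -big_mkcondr prodr_const; congr (_ ^+ _); apply: eq_card => i.
by rewrite !inE.
Qed.

(** The exponent counts pairs j <= i in A; adding the mirror image counts every pair once and the
    diagonal twice, hence n(n+1) for twice the exponent. *)
Lemma csign_self A : csign A A = (-1) ^+ 'C(#|A|.+1, 2) :> K.
Proof.
pose N := (\sum_(i in A) \sum_(j in A) (j <= i : nat))%N.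
have csN : csign A A = (-1) ^+ N :> K.
  rewrite /csign /N -prodrXr; apply: eq_bigr => i _.
  by rewrite -prodrXr big_mkcondr; apply: eq_bigr => j _; case: ifP.
have NN : (N + N = #|A|.+1 * #|A|)%N.
  rewrite {2}/N exchange_big -big_split /=.
  under eq_bigr => i iA.
    rewrite -big_split /= (_ : \sum_(_ in _) _ = #|A| + 1)%N; last first.
      rewrite -sum1_card [in RHS](bigD1 i) //= (bigD1 i) //= leqnn.
      rewrite [RHS]addnAC; congr (_ + _)%N; apply: eq_bigr => j /andP[_ ji].
      by case: (ltngtP j i) => // /val_inj/eqP; rewrite (negbTE ji).
    over.
  by rewrite sum_nat_const addn1 mulnC.
rewrite csN; congr (_ ^+ _); apply/double_inj.
by rewrite -addnn NN bin2 /= -[LHS]odd_double_half oddM /= andNb.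
Qed.

Lemma setSDKr (B : {set 'I_m}) : involutive (fun A => Defs.setSD A B).
Proof. by move=> A; rewrite -setSDA setSDC -setSDA setSDK. Qed.

Lemma card_setSD A B : (#|Defs.setSD A B| + #|A :&: B|.*2 = #|A| + #|B|)%N.
Proof.
have := cardsID B A; have := cardsID A B; rewrite (finset.setIC B A) /Defs.setSD.
have -> : #|A :\: B :|: B :\: A| = (#|A :\: B| + #|B :\: A|)%N.
  rewrite cardsU [_ :&: (_ :\: _)](_ : _ = finset.set0) ?cards0 ?subn0//.
  by apply/setP => i; rewrite !inE; do !case: (_ \in _).
by lia.
Qed.

(** Coefficient form of rev (e_A e_B) = rev e_B * rev e_A. It combines the parity of 'C(a + b, 2),
    namely 'C(a, 2) + 'C(b, 2) + ab, with the fact that removing two elements flips the reversion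
    sign. *)
Lemma csign_setSD A B :
  (-1) ^+ 'C(#|Defs.setSD A B|, 2) * csign A B =
  (-1) ^+ 'C(#|A|, 2) * (-1) ^+ 'C(#|B|, 2) * csign B A :> K.
Proof.
have s2 n k : (-1) ^+ 'C(n + k.*2, 2) = (-1) ^+ 'C(n, 2) * (-1) ^+ k :> K.
  elim: k => [|k IH]; first by rewrite addn0 mulr1.
  rewrite doubleS !addnS !binS !bin1 !bin0 !exprD IH.
  rewrite -(signr_odd _ k.*2) odd_double expr0 expr1 !mulr1 mulrA -[_ * _ * _ ^+ n]mulrA.
  by rewrite -expr2 sqrr_sign mulr1 -mulrA -exprSr.
have sD a b : (-1) ^+ 'C(a + b, 2) =
    (-1) ^+ 'C(a, 2) * (-1) ^+ 'C(b, 2) * (-1) ^+ (a * b) :> K.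
  elim: b => [|b IH]; first by rewrite addn0 muln0 !mulr1.
  by rewrite addnS !binS !bin1 mulnS !exprD IH; ring.
have sq n : (-1) ^+ n * (-1) ^+ n = 1 :> K by rewrite -expr2 sqrr_sign.
have csq C D : csign C D * csign C D = 1 :> K.
  rewrite /csign -big_split big1 // => i _; rewrite -big_split big1 // => j _.
  by rewrite /= mulrNN mulr1.
have -> : (-1) ^+ 'C(#|Defs.setSD A B|, 2) = (-1) ^+ 'C(#|A|, 2) * (-1) ^+ 'C(#|B|, 2)
    * (-1) ^+ (#|A| * #|B| + #|A :&: B|) :> K.
  by rewrite exprD [RHS]mulrA -sD -card_setSD s2 -mulrA sq mulr1.
by rewrite -csignM_sym -!mulrA (mulrC (csign B A)) [csign A B * _]mulrA csq mul1r.
Qed.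
End CliffordSigns.

Section CliffordInvolutions.
Context {R : realType} {m : nat}.
Notation Rm := 'rV[R]_m.
Notation Cl := (cliff R[i] m).
Implicit Types (x y u v : Rm) (p q z w : Cl) (A B C : {set 'I_m}).

(* Sealed: on a failed match, conversion would otherwise unfold these operations
   down to sums over the subsets of 'I_m. *)
Definition vec : Rm -> Cl := locked (@cvec R m).
Definition crev : Cl -> Cl := locked (@Defs.rev (R) m).
Definition cbar : Cl -> Cl := locked (@cconj R m).
Definition cabs : Cl -> R := locked (@cnorm R m).
Definition tw : Cl -> Rm -> Rm := locked (@twist R m).

Lemma vecE x : vec x = cvec x. Proof. by rewrite /vec -lock. Qed.
Lemma crevE z : crev z = Defs.rev z. Proof. by rewrite /crev -lock. Qed.
Lemma cbarE z : cbar z = cconj z. Proof. by rewrite /cbar -lock. Qed.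
Lemma cabsE z : cabs z = cnorm z. Proof. by rewrite /cabs -lock. Qed.
Lemma twE p u : tw p u = twist p u. Proof. by rewrite /tw -lock. Qed.

Lemma cliffME z w C : (z * w) C =
  \sum_A csign A (Defs.setSD A C) * z A * w (Defs.setSD A C).
Proof. by rewrite ffunE. Qed.

Lemma revD z w : crev (z + w) = crev z + crev w.
Proof. by rewrite !crevE; apply/ffunP => A; rewrite !ffunE mulrDr. Qed.

Lemma revZ k z : crev (k *: z) = k *: crev z.
Proof. by rewrite !crevE; apply/ffunP => A; rewrite !ffunE /= /GRing.scale /= mulrCA. Qed.

Lemma cconjD z w : cbar (z + w) = cbar z + cbar w.
Proof. by rewrite !cbarE; apply/ffunP => A; rewrite !ffunE rmorphD mulrDr. Qed.

Lemma cconjZ k z : cbar (k *: z) = k^*%C *: cbar z.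
Proof. by rewrite !cbarE; apply/ffunP => A; rewrite !ffunE /= /GRing.scale /= rmorphM mulrCA. Qed.

Lemma cconjN z : cbar (- z) = - cbar z.
Proof. by rewrite !cbarE; apply/ffunP => A; rewrite !ffunE rmorphN mulrN. Qed.

Lemma revK : involutive crev.
Proof. by move=> z; rewrite !crevE; apply/ffunP => A; rewrite !ffunE mulrA -expr2 sqrr_sign mul1r. Qed.

Lemma cconjK : involutive cbar.
Proof.
move=> z; rewrite !cbarE; apply/ffunP => A; rewrite !ffunE rmorphM rmorph_sign /= conjcK.
by rewrite mulrA -expr2 sqrr_sign mul1r.
Qed.

Lemma rev1 : crev (1 : Cl) = 1.
Proof.
rewrite !crevE.
apply/ffunP => A; rewrite !ffunE; have [->|_] := eqVneq A finset.set0; last by rewrite mulr0.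
by rewrite cards0 mul1r.
Qed.

Lemma cconj1 : cbar (1 : Cl) = 1.
Proof.
rewrite !cbarE.
apply/ffunP => A; rewrite !ffunE; have [->|_] := eqVneq A finset.set0.
  by rewrite cards0 bin_small// mul1r rmorph1.
by rewrite rmorph0 mulr0.
Qed.

Lemma conj_csign A B : (csign A B : R[i])^*%C = csign A B.
Proof.
rewrite rmorph_prod; apply: eq_bigr => i _; rewrite rmorph_prod.
by apply: eq_bigr => j _; rewrite rmorphN1.
Qed.

Lemma signr_setSD A B :
  (-1) ^+ #|Defs.setSD A B| = (-1) ^+ #|A| * (-1) ^+ #|B| :> R[i].
Proof.
rewrite -exprD -card_setSD exprD -(signr_odd _ _.*2) odd_double.
by rewrite mulr1.
Qed.

Lemma revM z w : crev (z * w) = crev w * crev z.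
Proof.
rewrite !crevE.
apply/ffunP => C; rewrite ffunE !cliffME mulr_sumr.
(* Replacing A by its symmetric difference with C exchanges the two index sets of each term, which
   matches the exchanged factors. *)
rewrite [RHS](reindex_inj (inv_inj (setSDKr C))) /=.
apply: eq_bigr => A _; rewrite setSDKr !ffunE.
have /(congr1 ( *%R^~ (z A * w (Defs.setSD A C)))) :=
  csign_setSD A (Defs.setSD A C) (K := R[i]).
by rewrite setSDK !mulrA => ->; ring.
Qed.

(** Since 'C(n + 1, 2) = 'C(n, 2) + n, the sign is that of the reversion times the grading sign
    (-1)^n, and the latter is multiplicative by [signr_setSD]. *)
Lemma cconjM z w : cbar (z * w) = cbar w * cbar z.
Proof.
rewrite !cbarE.
apply/ffunP => C; rewrite ffunE !cliffME rmorph_sum mulr_sumr.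
rewrite [RHS](reindex_inj (inv_inj (setSDKr C))) /=.
apply: eq_bigr => A _; rewrite setSDKr !ffunE !rmorphM /= conj_csign !binS !bin1 !exprD.
have := csign_setSD A (Defs.setSD A C) (K := R[i]).
have := signr_setSD A (Defs.setSD A C).
rewrite setSDK => ->; move: (_ ^+ 'C(#|C|, _)) => s E.
transitivity (s * csign A (Defs.setSD A C) *
  ((-1) ^+ #|A| * (-1) ^+ #|Defs.setSD A C| * (z A)^*%C * (w (Defs.setSD A C))^*%C)).
  by ring.
by rewrite E; ring.
Qed.

Lemma rev_ce i : crev (ce i : Cl) = ce i.
Proof.
rewrite !crevE.
apply/ffunP => A; rewrite !ffunE; have [->|_] := eqVneq A [set i]%SET; last by rewrite mulr0.
by rewrite cards1 mul1r.
Qed.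

Lemma cconj_ce i : cbar (ce i : Cl) = - ce i.
Proof.
rewrite !cbarE.
apply/ffunP => A; rewrite !ffunE; have [->|_] := eqVneq A [set i]%SET.
  by rewrite cards1 rmorph1 mulr1.
by rewrite rmorph0 mulr0 oppr0.
Qed.

Lemma rev_cvec x : crev (vec x : Cl) = vec x.
Proof.
rewrite vecE /cvec (big_morph crev revD (id1 := 0)); last first.
  by rewrite crevE; apply/ffunP => A; rewrite !ffunE mulr0.
by apply: eq_bigr => i _; rewrite revZ rev_ce.
Qed.

Lemma cconj_cvec x : cbar (vec x : Cl) = - vec x.
Proof.
rewrite vecE /cvec (big_morph cbar cconjD (id1 := 0)); last first.
  by rewrite cbarE; apply/ffunP => A; rewrite !ffunE rmorph0 mulr0.
rewrite -sumrN; apply: eq_bigr => i _; rewrite cconjZ cconj_ce scalerN.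
by rewrite conjc_real.
Qed.

(** The sign in the conjugation is exactly the one that makes the conjugate of e_A times e_A equal
    to 1. This links the coefficientwise norm to the product and supplies definiteness. *)
Lemma cconj_mul_scalar z : (cbar z * z) finset.set0 = (cabs z ^+ 2)%:C%C.
Proof.
rewrite cabsE.
rewrite sqr_sqrtr; last by apply: sumr_ge0 => A _; rewrite addr_ge0 ?sqr_ge0.
rewrite cliffME rmorph_sum; apply: eq_bigr => A _.
rewrite setSDC set0SD cbarE ffunE csign_self mulrA -expr2 sqrr_sign mul1r mulrC.
by rewrite -sqr_normc -add_Re2_Im2.
Qed.

Lemma cvecD x y : vec (x + y) = vec x + vec y :> Cl.
Proof.
rewrite !vecE /cvec -big_split; apply: eq_bigr => i _.
by rewrite mxE rmorphD scalerDl.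
Qed.

Lemma cvecZ (k : R) x : vec (k *: x) = k%:C%C *: vec x :> Cl.
Proof.
rewrite !vecE /cvec scaler_sumr; apply: eq_bigr => i _.
by rewrite mxE rmorphM scalerA.
Qed.

Lemma cvecN x : vec (- x) = - vec x :> Cl.
Proof. by rewrite -scaleN1r cvecZ rmorphN1 scaleN1r. Qed.

Lemma cvecB x y : vec (x - y) = vec x - vec y :> Cl.
Proof. by rewrite cvecD cvecN. Qed.

Lemma cvec0 : vec 0 = 0 :> Cl.
Proof. by rewrite -(scale0r 0) cvecZ rmorph0 scale0r. Qed.

Lemma cvecK : cancel vec vec_part.
Proof.
move=> x; apply/rowP => i; rewrite mxE vecE /cvec sum_ffunE raddf_sum /= (bigD1 i)//= big1 ?addr0.
  by rewrite !ffunE eqxx /= /GRing.scale /= !mulr1 mulr0 subr0.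
move=> j ji; rewrite !ffunE (inj_eq finset.set1_inj) eq_sym (negbTE ji).
by rewrite /GRing.scale /= !mulr0 subr0.
Qed.

Definition dot x y : R := \sum_i x 0 i * y 0 i.

Lemma cvec_anticomm x y :
  vec x * vec y + vec y * vec x = (- (2 * dot x y))%:C%C *: 1 :> Cl.
Proof.
rewrite !vecE.
have E u v : cvec u * cvec v = \sum_i \sum_j (u 0 i * v 0 j)%:C%C *: (ce i * ce j) :> Cl.
  rewrite /cvec mulr_suml; apply: eq_bigr => i _; rewrite mulr_sumr.
  by apply: eq_bigr => j _; rewrite -scalerAl -scalerAr scalerA -rmorphM.
rewrite !E [X in _ + X]exchange_big -big_split /= /dot mulr_sumr -sumrN rmorph_sum scaler_suml.
apply: eq_bigr => i _; rewrite -big_split (bigD1 i)//= big1 ?addr0.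
  rewrite (mulrC (y 0 i)) -scalerDr ceM eqxx -scaleNr scalerA; congr (_ *: _).
  by rewrite mulr1 mulrN rmorphN mulrC [in RHS]rmorphM rmorph_nat.
by move=> j ji; rewrite (mulrC (y 0 j)) -scalerDr ceM eq_sym (negbTE ji) mulr0 scale0r oppr0 scaler0.
Qed.

Lemma enorm_sqr x : enorm x ^+ 2 = dot x x.
Proof. by rewrite sqr_sqrtr ?sumr_ge0// => i _; rewrite sqr_ge0. Qed.

Lemma cvec_sqr x : vec x * vec x = (- enorm x ^+ 2)%:C%C *: 1 :> Cl.
Proof.
have := cvec_anticomm x x; rewrite -mulr2n enorm_sqr => E.
have : 2%:R *: (vec x * vec x) = 2%:R *: ((- dot x x)%:C%C *: 1) :> Cl.
  rewrite scaler_nat E scalerA -(rmorph_nat (real_complex R)) -rmorphM; congr (_%:C%C *: _).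
  by rewrite mulrN.
by apply: scalerI; rewrite pnatr_eq0.
Qed.

(** Divided by |x|^2, the right side is the reflection of u in the hyperplane orthogonal to x. *)
Lemma cvec_sandwich x u : vec x * vec u * vec x =
  vec (enorm x ^+ 2 *: u - (2 * dot x u) *: x) :> Cl.
Proof.
have -> : vec x * vec u = (- (2 * dot x u))%:C%C *: 1 - vec u * vec x :> Cl.
  by rewrite -cvec_anticomm addrK.
rewrite mulrBl -mulrA cvec_sqr -scalerAl mul1r -scalerAr mulr1 cvecD cvecN !cvecZ.
by rewrite !rmorphN !scaleNr opprK addrC.
Qed.

Lemma cnorm_ge0 z : 0 <= cabs z.
Proof.
rewrite cabsE.
exact: sqrtr_ge0. Qed.

Lemma cnorm_eq0 z : cabs z = 0 -> z = 0.
Proof.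
rewrite cabsE => /eqP; rewrite sqrtr_eq0 => z0; apply/ffunP => A; rewrite ffunE.
have /eqP : \sum_A (complex.Re (z A) ^+ 2 + complex.Im (z A) ^+ 2) = 0.
  by apply/le_anti; rewrite z0 sumr_ge0// => B _; rewrite addr_ge0 ?sqr_ge0.
rewrite psumr_eq0 => [/allP/(_ A (mem_index_enum A))|B _]; last by rewrite addr_ge0 ?sqr_ge0.
rewrite paddr_eq0 ?sqr_ge0// !sqrf_eq0 => /andP[/eqP a0 /eqP b0].
by apply/eqP; rewrite eq_complex a0 b0 !eqxx.
Qed.

Lemma cnorm0 : cabs (0 : Cl) = 0.
Proof. by rewrite cabsE; rewrite /cnorm big1 ?sqrtr0// => A _; rewrite ffunE /= expr0n addr0. Qed.

Lemma cliff1E : (1 : Cl) finset.set0 = 1.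
Proof. by rewrite ffunE eqxx. Qed.

Lemma cnorm_cvec x : cabs (vec x : Cl) = enorm x.
Proof.
apply/eqP; rewrite -(@eqrXn2 _ 2) ?cnorm_ge0 ?sqrtr_ge0//; apply/eqP/complexI.
rewrite -cconj_mul_scalar cconj_cvec mulNr cvec_sqr -scaleNr -rmorphN opprK.
by rewrite ffunE cliff1E /GRing.scale /= mulr1.
Qed.

Lemma cnormZ (k : R) z : cabs (k%:C%C *: z) = `|k| * cabs z.
Proof.
rewrite !cabsE.
rewrite -sqrtr_sqr /cnorm -sqrtrM ?sqr_ge0// mulr_sumr; congr Num.sqrt.
apply: eq_bigr => A _; rewrite ffunE /GRing.scale /=; case: (z A) => a b /=.
by rewrite !mul0r subr0 addr0 !exprMn mulrDr.
Qed.

Lemma cnorm_rev p : cabs (crev p) = cabs p.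
Proof.
rewrite crevE !cabsE.
congr Num.sqrt; apply: eq_bigr => A _; rewrite ffunE -signr_odd.
by case: odd; case: (p A) => a b; rewrite ?(mulN1r, mul1r) /= ?sqrrN.
Qed.

Lemma real_scalar_mull (k : R) z : (k%:C%C%:A : Cl) * z = k%:C%C *: z.
Proof. by rewrite -scalerAl mul1r. Qed.

Lemma real_scalar_mulr (k : R) z : z * (k%:C%C%:A : Cl) = k%:C%C *: z.
Proof. by rewrite -scalerAr mulr1. Qed.

End CliffordInvolutions.

(** * Products of vectors and Moebius maps *)

Section VectorProducts.
Context {R : realType} {m : nat}.
Notation Rm := 'rV[R]_m.
Notation Cl := (cliff R[i] m).
Implicit Types (x y u v : Rm) (p q z w : Cl).

Lemma vec_product_ind (P : Cl -> Prop) : P 1 ->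
  (forall x p, vec_product p -> P p -> P (vec x * p)) ->
  forall p, vec_product p -> P p.
Proof.
move=> P1 Px p [s ->]; elim: s => [|x s IH]; first by rewrite big_nil.
by rewrite big_cons -vecE; apply: Px => //; exists s.
Qed.

Lemma vec_product1 : vec_product (1 : Cl).
Proof. by exists [::]; rewrite big_nil. Qed.

Lemma vec_product_cvec x : vec_product (vec x : Cl).
Proof. by exists [:: x]; rewrite big_seq1 vecE. Qed.

Lemma vec_productM p q : vec_product p -> vec_product q -> vec_product (p * q).
Proof. by move=> [s ->] [t ->]; exists (s ++ t); rewrite big_cat. Qed.

Lemma vec_product_rev p : vec_product p -> vec_product (crev p).
Proof.
move: p; apply: vec_product_ind => [|x p _ IH].
  by rewrite rev1; exact: vec_product1.
by rewrite revM rev_cvec; apply: vec_productM => //; exact: vec_product_cvec.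
Qed.

(** Both maps are anti-automorphisms, and on a vector they differ by -1; on a product of n vectors
    they differ by (-1)^n. *)
Lemma rev_vec_product p : vec_product p ->
  crev p = cbar p \/ crev p = - cbar p.
Proof.
move: p; apply: vec_product_ind => [|x p _ IH].
  by rewrite rev1 cconj1; left.
rewrite revM cconjM rev_cvec cconj_cvec.
by case: IH => ->; [right|left]; rewrite !(mulrN, mulNr) ?opprK.
Qed.

(** The innermost factors form -x x = |x|^2, a scalar that moves out, and so on outwards. Once the
    product is known to be a real scalar, its value is read off the coefficient of the empty set. *)
Lemma cconj_mul_vec_product p : vec_product p ->
  cbar p * p = (cabs p ^+ 2)%:C%C%:A.
Proof.
move=> vp; suff [r Er] : exists r : R, cbar p * p = r%:C%C%:A.
  have /complexI -> : (cabs p ^+ 2)%:C%C = r%:C%C; last by [].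
  by rewrite -cconj_mul_scalar Er ffunE cliff1E /GRing.scale /= mulr1.
move: p vp; apply: vec_product_ind => [|x p _ [r IH]].
  by exists 1; rewrite cconj1 mul1r scale1r.
exists (enorm x ^+ 2 * r); rewrite cconjM mulrA -[cbar p * _ * _]mulrA.
rewrite cconj_cvec mulNr cvec_sqr -scaleNr -rmorphN opprK.
by rewrite -scalerAr mulr1 -scalerAl IH scalerA -rmorphM.
Qed.

(** The norm is not multiplicative in general; for a product of vectors on the left, the scalar
    [cbar p * p] can be pulled out of conj(z) conj(p) p z. *)
Lemma cnormM p z : vec_product p -> cabs (p * z) = cabs p * cabs z.
Proof.
move=> vp; apply/eqP; rewrite -(@eqrXn2 _ 2) ?mulr_ge0 ?cnorm_ge0//; apply/eqP/complexI.
rewrite -cconj_mul_scalar cconjM mulrA -[_ * cbar p * p]mulrA cconj_mul_vec_product//.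
rewrite -scalerAr mulr1 -scalerAl ffunE cconj_mul_scalar.
by rewrite exprMn [in RHS]rmorphM.
Qed.

(** The preceding identity for p~, which is plus or minus the conjugate of p; the sign occurs twice
    and cancels. *)
Lemma mul_cconj_vec_product p : vec_product p ->
  p * cbar p = (cabs p ^+ 2)%:C%C%:A.
Proof.
move=> vp; have vr := vec_product_rev vp.
have := cconj_mul_vec_product vr; rewrite cnorm_rev.
have [E|E] := rev_vec_product vp; rewrite E ?cconjN cconjK ?mulrNN => <- //.
Qed.

Lemma vec_product_unitE p : vec_product p -> (p \is a GRing.unit) = (cabs p != 0).
Proof.
move=> vp; apply/idP/idP => [|p0].
  by apply: contraTneq => /cnorm_eq0 ->; rewrite unitr0.
have k1 : (cabs p ^- 2)%:C%C * (cabs p ^+ 2)%:C%C = 1 :> R[i].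
  by rewrite -rmorphM mulVf ?expf_neq0.
apply/unitrP; exists ((cabs p ^- 2)%:C%C *: cbar p); split.
  by rewrite -scalerAl cconj_mul_vec_product// scalerA k1 scale1r.
by rewrite -scalerAr mul_cconj_vec_product// scalerA k1 scale1r.
Qed.

Lemma vec_product_inv p : vec_product p -> p \is a GRing.unit ->
  p^-1 = (cabs p ^- 2)%:C%C *: cbar p.
Proof.
move=> vp up; apply: (mulIr up); rewrite mulVr//.
rewrite -scalerAl cconj_mul_vec_product// scalerA -rmorphM mulVf ?scale1r//.
by rewrite expf_neq0// -vec_product_unitE.
Qed.

Lemma cnormV p : vec_product p -> p \is a GRing.unit -> cabs p^-1 = (cabs p)^-1.
Proof.
move=> vp up; have := cnormM p^-1 vp; rewrite mulrV//.
have -> : cabs (1 : Cl) = 1.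
  have /= := cconj_mul_scalar (1 : Cl); rewrite cconj1 mul1r cliff1E => /complexI /esym/eqP.
  by rewrite sqrf_eq1 => /orP[/eqP//|/eqP E]; have := cnorm_ge0 (1 : Cl); rewrite E oppr_ge0 ler10.
move=> E; rewrite -[RHS]mulr1 E mulrA mulVf ?mul1r//.
by rewrite -vec_product_unitE.
Qed.

Lemma unitr_rev p : (crev p \is a GRing.unit) = (p \is a GRing.unit).
Proof.
suff H q : q \is a GRing.unit -> crev q \is a GRing.unit.
  by apply/idP/idP => [/H|/H//]; rewrite revK.
move=> uq; apply/unitrP; exists (crev q^-1).
by rewrite -!revM mulrV// mulVr// rev1.
Qed.

Lemma revV p : p \is a GRing.unit -> crev p^-1 = (crev p)^-1.
Proof.
move=> up; apply: (mulIr (x := crev p)); rewrite ?unitr_rev//.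
by rewrite mulVr ?unitr_rev// -revM mulrV// rev1.
Qed.

Lemma is_vec_cvec x : is_vec (vec x : Cl). Proof. by exists x; rewrite vecE. Qed.

Lemma is_vecP z : is_vec z -> exists x, z = vec x.
Proof. by move=> [x ->]; exists x; rewrite vecE. Qed.

Lemma is_vecK z : is_vec z -> vec (vec_part z) = z.
Proof. by move=> /is_vecP[x ->]; rewrite cvecK. Qed.

Lemma is_vecZ (k : R) z : is_vec z -> is_vec (k%:C%C *: z).
Proof. by move=> /is_vecP[x ->]; rewrite -cvecZ; exact: is_vec_cvec. Qed.

(** Each vector factor of p contributes one multiple of a reflection, so the result stays in R^m.
    This is what makes [twist] meaningful. *)
Lemma is_vec_sandwich p z : vec_product p -> is_vec z -> is_vec (p * z * crev p).
Proof.
move=> vp; move: p vp z; apply: vec_product_ind => [z|x p _ IH z vz].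
  by rewrite rev1 mul1r mulr1.
rewrite revM rev_cvec mulrA -[_ * p * z]mulrA -[_ * (p * z) * _]mulrA.
have /is_vecP[w ->] := IH _ vz.
by rewrite cvec_sandwich; exact: is_vec_cvec.
Qed.

Lemma rev_is_vec z : is_vec z -> crev z = z.
Proof. by move=> /is_vecP[x ->]; rewrite rev_cvec. Qed.

Lemma cvec_twist p u : vec_product p ->
  vec (tw p u) = (cabs p ^- 2)%:C%C *: (p * vec u * crev p).
Proof.
move=> vp; rewrite twE is_vecK; rewrite -?cabsE -?vecE -?crevE //; apply: is_vecZ; apply: is_vec_sandwich => //.
exact: is_vec_cvec.
Qed.

Lemma cvec_inj : injective (@vec R m).
Proof. exact: can_inj cvecK. Qed.

Lemma enorm_twist p u : vec_product p -> p \is a GRing.unit ->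
  enorm (tw p u) = enorm u.
Proof.
move=> vp up; rewrite -cnorm_cvec cvec_twist// cnormZ cnormM; last first.
  by apply: vec_productM => //; exact: vec_product_cvec.
rewrite cnormM// cnorm_cvec cnorm_rev ger0_norm ?invr_ge0 ?exprn_ge0 ?cnorm_ge0//.
have : cabs p != 0 by rewrite -vec_product_unitE.
by move=> p0; field.
Qed.

Lemma twistD p u v : vec_product p -> tw p (u + v) = tw p u + tw p v.
Proof.
move=> vp; apply: cvec_inj; rewrite cvecD !(cvec_twist _ vp) cvecD.
by rewrite mulrDr mulrDl scalerDr.
Qed.

Lemma twistZ p k u : vec_product p -> tw p (k *: u) = k *: tw p u.
Proof.
move=> vp; apply: cvec_inj; rewrite cvecZ !(cvec_twist _ vp) cvecZ.
by rewrite -scalerAr -scalerAl !scalerA mulrC.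
Qed.

Lemma twistB p u v : vec_product p -> tw p (u - v) = tw p u - tw p v.
Proof. by move=> vp; rewrite -scaleN1r (twistD _ _ vp) (twistZ _ _ vp) scaleN1r. Qed.

(** The sign e is 1 or -1 according to whether p~ is the conjugate of p or its negative, that is,
    the parity of the number of vectors in p. It is the source of the sign in the odd case. *)
Lemma rev_mul_self p : vec_product p ->
  exists2 e : R, e ^+ 2 = 1 & crev p * p = (e * cabs p ^+ 2)%:C%C%:A /\
    p * crev p = (e * cabs p ^+ 2)%:C%C%:A.
Proof.
move=> vp; have [E|E] := rev_vec_product vp; [exists 1|exists (-1)];
  rewrite ?expr1n ?sqrrN ?expr1n// E ?(mulrN, mulNr) mul_cconj_vec_product//.
  by rewrite cconj_mul_vec_product// mul1r.
by rewrite cconj_mul_vec_product// mul1r rmorphN scaleNr.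
Qed.

(** Both p~ p and its repetition on the other side equal e |p|^2, and e appears squared. *)
Lemma twistK p u : vec_product p -> p \is a GRing.unit ->
  tw (crev p) (tw p u) = u.
Proof.
move=> vp up; have vr := vec_product_rev vp.
apply: cvec_inj; rewrite (cvec_twist _ vr) (cvec_twist _ vp) revK cnorm_rev.
rewrite -scalerAr -scalerAl scalerA.
have [e e2 [E1 E2]] := rev_mul_self vp.
have -> : crev p * (p * vec u * crev p) * p = (e * cabs p ^+ 2)%:C%C *: ((e * cabs p ^+ 2)%:C%C *: vec u).
  rewrite [crev p * (_ * _)]mulrA [crev p * (_ * _)]mulrA E1 real_scalar_mull -mulrA E1.
  exact: real_scalar_mulr.
have p0 : cabs p != 0 by rewrite -vec_product_unitE.
have k1 : cabs p ^- 2 * cabs p ^- 2 * (e * cabs p ^+ 2) * (e * cabs p ^+ 2) = 1.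
  by rewrite -e2; field.
rewrite !scalerA -!rmorphM k1; exact: scale1r.
Qed.

Lemma twistKV p u : vec_product p -> p \is a GRing.unit ->
  tw p (tw (crev p) u) = u.
Proof.
move=> vp up; rewrite -{1}[p]revK twistK ?unitr_rev//.
exact: vec_product_rev.
Qed.

End VectorProducts.

(** The resolvent identity; it turns the difference of two inverted vectors into a product around
    their difference. *)
Lemma invrB (A : unitRingType) (x y : A) : x \is a GRing.unit ->
  y \is a GRing.unit -> x^-1 - y^-1 = x^-1 * (y - x) * y^-1.
Proof. by move=> ux uy; rewrite mulrBr mulrBl mulVr// mul1r mulrK. Qed.

Section MobiusMaps.
Context {R : realType} {m : nat}.
Notation Rm := 'rV[R]_m.
Notation Cl := (cliff R[i] m).
Implicit Types (x y u v : Rm) (p q z w : Cl).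

Lemma denE (c d : Cl) x : den c d x = c * vec x + d.
Proof. by rewrite /den vecE. Qed.

Lemma cabs_neq0 p : vec_product p -> p \is a GRing.unit -> cabs p != 0.
Proof. by move=> vp; rewrite vec_product_unitE. Qed.

Lemma unit_rev p : p \is a GRing.unit -> crev p \is a GRing.unit.
Proof. by rewrite unitr_rev. Qed.

Lemma cabs_eq0_vec_product p : vec_product p -> p = 0 \/ p \is a GRing.unit.
Proof.
move=> vp; have [/cnorm_eq0|p0] := eqVneq (cabs p) 0; first by left.
by right; rewrite vec_product_unitE.
Qed.

Lemma vec_inv u : u != 0 -> (vec u)^-1 = - vec (enorm u ^- 2 *: u) :> Cl.
Proof.
move=> u0; have n0 : enorm u != 0.
  apply: contraNneq u0 => n0; apply/eqP/cvec_inj; rewrite cvec0.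
  by apply: cnorm_eq0; rewrite cnorm_cvec.
have vu := vec_product_cvec u; have uu : vec u \is a GRing.unit.
  by rewrite vec_product_unitE// cnorm_cvec.
by rewrite (vec_product_inv vu uu) cnorm_cvec cconj_cvec scalerN cvecZ.
Qed.

(** Up to one common sign, p^-1 and (p~)^-1 are p~ / |p|^2 and p / |p|^2, and that sign occurs
    twice. This is how a rotation and a dilation emerge from a Vahlen matrix. *)
Lemma sandwich_inv p u : vec_product p -> p \is a GRing.unit ->
  (crev p)^-1 * vec u * p^-1 = vec (cabs p ^- 2 *: tw p u).
Proof.
move=> vp up; have vr := vec_product_rev vp.
rewrite (vec_product_inv vp up) (vec_product_inv vr (unit_rev up)) cvecZ (cvec_twist _ vp).
rewrite cnorm_rev -!scalerAl -!scalerAr; congr (_ *: (_ *: _)).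
have [E|E] := rev_vec_product vp; rewrite E ?cconjN cconjK; first reflexivity.
by rewrite !mulNr mulrN.
Qed.

Lemma is_vec_sandwich_inv p z : vec_product p -> p \is a GRing.unit -> is_vec z ->
  is_vec ((crev p)^-1 * z * p^-1).
Proof.
by move=> vp up /is_vecP[x ->]; rewrite sandwich_inv//; exact: is_vec_cvec.
Qed.

Lemma is_vec_sandwich_inv' p z : vec_product p -> p \is a GRing.unit -> is_vec z ->
  is_vec (p^-1 * z * (crev p)^-1).
Proof.
move=> vp up vz; have := is_vec_sandwich_inv (vec_product_rev vp) (unit_rev up) vz.
by rewrite revK.
Qed.

Lemma vahlen_det (a b c d : Cl) : vahlen a b c d ->
  exists2 e : R, e ^+ 2 = 1 & a * crev d - b * crev c = e%:C%C%:A.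
Proof.
case=> _ _; rewrite -!crevE => -[->|->]; [exists 1|exists (-1)].
- by rewrite expr1n.
- by rewrite scale1r.
- by rewrite sqrrN expr1n.
- by rewrite rmorphN scaleN1r.
Qed.

Lemma scalar_central (e : R) z w : z * e%:C%C%:A * w = e%:C%C *: (z * w).
Proof. by rewrite real_scalar_mulr scalerAl. Qed.

(** This predicate and the next keep only [c], [d], the map and the sign [e]: all later arguments
    see the matrix entries [a] and [b] only through the map [phi]. *)
Definition mobius_affine (c d : Cl) (phi : Rm -> Rm) (e : R) := exists q : Cl,
  [/\ vec_product q, q \is a GRing.unit, forall x, den c d x = q &
  exists b : Rm, forall x, phi x = (e * cabs q ^- 2) *: tw q (x + b)].

Definition mobius_inversive (c d : Cl) (phi : Rm -> Rm) (e : R) :=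
  [/\ vec_product c, c \is a GRing.unit & exists a b : Rm,
    (forall x, den c d x = c * vec (x + b)) /\
    forall x, x + b != 0 -> phi x = a + (e * cabs c ^- 2) *: tw c (enorm (x + b) ^- 2 *: (x + b))].

(** If c = 0, the determinant gives a = e (d~)^-1, and d~ b is a vector, so b is (d~)^-1 times a
    translation part. If c is not 0, it is invertible, and c^-1 d and a c^-1 are vectors because c
    d~ and c~ a are. Then (a x + b)(c x + d)^-1 is the vector a c^-1 minus e (c~)^-1 (x + c^-1 d)^-1
    c^-1. *)
Lemma mobius_normal_form (a b c d : Cl) (e : R) : vahlen a b c d -> e ^+ 2 = 1 ->
  a * crev d - b * crev c = e%:C%C%:A ->
  mobius_affine c d (mobius a b c d) e \/ mobius_inversive c d (mobius a b c d) e.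
Proof.
move=> [[va vb vc vd]]; rewrite -!crevE => -[ab cd ca db] _ ee dete.
have e0 : e != 0 by apply/eqP => e0; move: ee; rewrite e0 expr0n => /eqP; rewrite eq_sym oner_eq0.
have [c0|uc] := cabs_eq0_vec_product vc; [left|right].
  have cr0 : crev c = 0 by apply: cnorm_eq0; rewrite cnorm_rev c0 cnorm0.
  rewrite cr0 mulr0 subr0 in dete.
  have [d0|ud] := cabs_eq0_vec_product vd.
    have dr0 : crev d = 0 by apply: cnorm_eq0; rewrite cnorm_rev d0 cnorm0.
    move: dete; rewrite dr0 mulr0 => /(congr1 (fun z : Cl => z finset.set0)).
    rewrite !ffunE eqxx /GRing.scale /= mulr1 => /esym/eqP; rewrite fmorph_eq0.
    by rewrite (negbTE e0).
  have denq x : den c d x = d by rewrite denE c0 mul0r add0r.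
  have ur : crev d \is a GRing.unit by rewrite unitr_rev.
  have aE : a = (crev d)^-1 * e%:C%C%:A.
    by rewrite real_scalar_mulr -real_scalar_mull -dete mulrK.
  have [g Eg] := is_vecP db.
  exists d; split; [exact: vd | exact: ud | exact: denq | exists (e *: g) => x].
  apply: cvec_inj; rewrite /mobius -vecE denq.
  have -> : a * vec x + b = (crev d)^-1 * vec (e *: (x + e *: g)).
    rewrite scalerDr scalerA -expr2 ee scale1r cvecD mulrDr -Eg (mulKr ur).
    by rewrite cvecZ -scalerAr aE scalar_central.
  by rewrite (sandwich_inv _ vd ud) cvecK (twistZ _ _ vd) scalerA (mulrC e).
have ur := unit_rev uc.
have [be Ebe] : exists x, c^-1 * d = vec x.
  apply: is_vecP; rewrite -(mulrK ur d) mulrA.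
  apply: (is_vec_sandwich_inv' vc uc); rewrite -[d]revK -revM.
  by rewrite (rev_is_vec cd).
have dE : d = c * vec be by rewrite -Ebe (mulVKr uc).
have drE : crev d = vec be * crev c by rewrite dE revM rev_cvec.
have [al Eal] : exists x, a * c^-1 = vec x.
  apply: is_vecP; rewrite -(mulKr ur a) mulrA.
  by rewrite -[_ * crev c * a]mulrA; exact: (is_vec_sandwich_inv vc uc ca).
(* The equation a d~ - b c~ = e is solved for b, with d~ replaced by [vec be * crev c]. *)
have bE : b = a * vec be - e%:C%C *: (crev c)^-1.
  rewrite -[LHS](mulrK ur) -[b * crev c](subKr (a * crev d)) dete drE.
  by rewrite mulrBl mulrA (mulrK ur) real_scalar_mull.
have denx x : den c d x = c * vec (x + be).
  by rewrite denE cvecD mulrDr -dE.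
split; [exact: vc | exact: uc | exists al, be; split; first exact: denx].
move=> x x0; apply: cvec_inj; rewrite /mobius -vecE denx.
have uX : vec (x + be) \is a GRing.unit.
  rewrite vec_product_unitE ?cnorm_cvec; last exact: vec_product_cvec.
  by apply: contra_neq x0 => n0; apply: cvec_inj; rewrite cvec0; apply: cnorm_eq0; rewrite cnorm_cvec.
have -> : (a * vec x + b) * (c * vec (x + be))^-1 =
    vec (al + (e * cabs c ^- 2) *: tw c (enorm (x + be) ^- 2 *: (x + be))).
  have -> : a * vec x + b = a * vec (x + be) - e%:C%C *: (crev c)^-1.
    by rewrite bE cvecD mulrDr addrA.
  rewrite (invrM uc uX) mulrBl mulrA (mulrK uX) Eal (cvecD al) -[(e * _) *: _]scalerA [vec (e *: _)]cvecZ.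
  rewrite -(sandwich_inv _ vc uc) (vec_inv x0) -scalerAl mulrA mulrN mulNr scalerN opprK.
  by [].
by rewrite cvecK.
Qed.

(** In the affine case the rotation is applied to x - y directly. In the inversive case the constant
    cancels and the resolvent identity splits the difference of the two inverted vectors; the outer
    factors combine with c into c x + d and the reversal of c y + d. *)
Lemma mobius_sub (c d : Cl) (phi : Rm -> Rm) (e : R) x y :
  mobius_affine c d phi e \/ mobius_inversive c d phi e ->
  den c d x \is a GRing.unit -> den c d y \is a GRing.unit ->
  vec (phi x - phi y) =
    e%:C%C *: ((crev (den c d y))^-1 * vec (x - y) * (den c d x)^-1).
Proof.
have xyE (b : Rm) : x + b - (y + b) = x - y by rewrite opprD addrACA subrr addr0.
case=> [[q [vq uq denq [b phiE]]] _ _|[vc uc [a [b [denx phiE]]]]].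
  rewrite !denq !phiE -scalerBr -!scalerA cvecZ.
  by rewrite -(twistB _ _ vq) xyE (sandwich_inv _ vq uq).
have nz (z : Rm) : den c d z \is a GRing.unit -> z + b != 0.
  by rewrite denx; apply: contraTneq => ->; rewrite cvec0 mulr0 unitr0.
move=> /[dup] ux /nz x0 /[dup] uy /nz y0; rewrite !phiE //.
(* The inversion of a vector is minus its Clifford inverse, since vectors have negative squares. *)
have E (z : Rm) : z + b != 0 -> vec ((e * cabs c ^- 2) *: tw c (enorm (z + b) ^- 2 *: (z + b))) =
    - (e%:C%C *: ((crev c)^-1 * (vec (z + b))^-1 * c^-1)).
  move=> z0; rewrite -[(e * _) *: _]scalerA cvecZ -(sandwich_inv _ vc uc) (vec_inv z0).
  by rewrite mulrN mulNr scalerN opprK.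
have uv (z : Rm) : z + b != 0 -> vec (z + b) \is a GRing.unit.
  move=> z0; rewrite vec_product_unitE ?cnorm_cvec; last exact: vec_product_cvec.
  by apply: contra_neq z0 => n0; apply: cvec_inj; rewrite cvec0; apply: cnorm_eq0; rewrite cnorm_cvec.
rewrite opprD addrACA subrr add0r [LHS]cvecB (E _ x0) (E _ y0) opprK addrC -scalerBr; congr (_ *: _).
rewrite -mulrBl -mulrBr !denx revM rev_cvec (invrM uc (uv _ x0)) (invrM (uv _ y0) (unit_rev uc)).
rewrite (invrB (uv _ y0) (uv _ x0)) -cvecB xyE.
by rewrite !mulrA.
Qed.

End MobiusMaps.

(** * Twists as a multiplicative action, and differences of Moebius images *)

Section MobiusIdentities.
Context {R : realType} {m : nat}.
Notation Rm := 'rV[R]_m.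
Notation Cl := (cliff R[i] m).
Implicit Types (x y u v : Rm) (p q z w : Cl).

Lemma twM p q u : vec_product p -> vec_product q -> tw (p * q) u = tw p (tw q u).
Proof.
move=> vp vq; apply: cvec_inj; have vpq := vec_productM vp vq.
rewrite (cvec_twist _ vpq) (cvec_twist _ vp) (cvec_twist _ vq) revM (cnormM _ vp).
rewrite -scalerAr -scalerAl scalerA exprMn invfM rmorphM; congr (_ *: _).
by rewrite !mulrA.
Qed.

Lemma twE_gen p u (w : Rm) : vec w = (cabs p ^- 2)%:C%C *: (p * vec u * crev p) -> tw p u = w.
Proof.
by move=> E; rewrite twE /twist -cabsE -vecE -crevE -E cvecK.
Qed.

(** The normalisation by |p|^2 removes real factors, so that identities between Clifford numbers are
    needed only up to a real multiple. *)
Lemma tw_scale (k : R) p u : vec_product p -> k != 0 -> tw (k%:C%C *: p) u = tw p u.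
Proof.
move=> vp k0; apply: twE_gen; rewrite (cvec_twist _ vp) revZ cnormZ -!scalerAl -scalerAr.
rewrite !scalerA -!rmorphM; congr ((_%:C%C) *: _).
have kk : `|k| ^+ 2 = k ^+ 2 by rewrite real_normK ?num_real.
move: (cabs p) => r; transitivity (k ^- 2 * k ^+ 2 * r ^- 2); last first.
  by rewrite exprMn kk [(_ * r ^+ 2)^-1]invfM -[RHS]mulrA -expr2 [RHS]mulrAC.
rewrite mulVf ?mul1r//.
by rewrite expf_neq0.
Qed.

(** A vector is its own reversal, so the reflection is the twist by that vector; compositions with
    rotations become products by [twM]. *)
Lemma reflect_dirE x u : reflect_dir x u = tw (vec x) u.
Proof.
rewrite twE /twist /reflect_dir -cabsE -crevE -!vecE rev_cvec.
by rewrite cnorm_cvec.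
Qed.

Section Structure.
Context (c d : Cl) (phi : Rm -> Rm) (e : R) (ee : e ^+ 2 = 1).
Hypothesis H : mobius_affine c d phi e \/ mobius_inversive c d phi e.

Lemma den_vec_product x : vec_product (den c d x).
Proof.
case: H => [[q [vq uq denq _]]|[vc uc [a [b [denx _]]]]].
  by rewrite denq.
by rewrite denx; apply: vec_productM => //; exact: vec_product_cvec.
Qed.

(** In the affine case c x + d is constant. In the inversive case it is c times exactly one further
    vector, for every x, so the sign is always the opposite of that of c. *)
Lemma den_sign : exists2 s : R, s ^+ 2 = 1 &
  forall x, den c d x * crev (den c d x) = (s * cabs (den c d x) ^+ 2)%:C%C%:A.
Proof.
case: H => [[q [vq uq denq _]]|[vc uc [a [b [denx _]]]]].
  have [s s1 [_ E]] := rev_mul_self vq; exists s => // x.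
  by rewrite denq E.
have [s s1 [_ E]] := rev_mul_self vc; exists (- s); first by rewrite sqrrN.
move=> x; rewrite denx revM rev_cvec mulrA -[c * _ * _]mulrA.
have -> : vec (x + b) * vec (x + b) = (- enorm (x + b) ^+ 2)%:C%C%:A := cvec_sqr (x + b).
rewrite real_scalar_mulr -scalerAl E scalerA -rmorphM (cnormM _ vc) cnorm_cvec.
by congr (_%:C%C%:A); ring.
Qed.

(** A vector equals its reversal, and reversing [mobius_sub] exchanges the roles of x and y. The
    inverse of c y + d then stands on the right, where it meets the twist by c y + d. *)
Lemma mobius_sub_rev x y : den c d x \is a GRing.unit -> den c d y \is a GRing.unit ->
  vec (phi x - phi y) =
    e%:C%C *: ((crev (den c d x))^-1 * vec (x - y) * (den c d y)^-1).
Proof.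
move=> ux uy; rewrite -[LHS]rev_cvec (mobius_sub H ux uy) revZ !revM rev_cvec.
by rewrite (revV ux) (revV (unit_rev uy)) revK mulrA.
Qed.

Lemma crev_inv p : vec_product p -> p \is a GRing.unit ->
  exists2 k : R, k != 0 & (crev p)^-1 = k%:C%C *: p.
Proof.
move=> vp up; have [s s1 [_ E]] := rev_mul_self vp.
have p0 := cabs_neq0 vp up.
exists (s * cabs p ^- 2).
  rewrite mulf_neq0 ?invr_eq0 ?expf_neq0//; apply/eqP => s0.
  by move/eqP: s1; rewrite s0 expr0n eq_sym oner_eq0.
apply: (mulIr (unit_rev up)); rewrite (mulVr (unit_rev up)) -scalerAl E scalerA -rmorphM.
have -> : s / cabs p ^+ 2 * (s * cabs p ^+ 2) = 1 by rewrite -s1; field.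
by rewrite scale1r.
Qed.

(** By [mobius_sub_rev] and [crev_inv], (phi x - phi y) q is a real multiple of p (x - y). Both
    sides are the twists by these two products. *)
Lemma reflect_mobius x y u : den c d x \is a GRing.unit -> den c d y \is a GRing.unit ->
  reflect_dir (phi x - phi y) (tw (den c d y) u) =
  tw (den c d x) (reflect_dir (x - y) u).
Proof.
move=> ux uy; have vx := den_vec_product x; have vy := den_vec_product y.
rewrite !reflect_dirE -(twM _ (vec_product_cvec _) vy) -(twM _ vx (vec_product_cvec _)).
rewrite (mobius_sub_rev ux uy) -scalerAl (mulrVK uy).
have [k k0 ->] := crev_inv vx ux; rewrite -scalerAl scalerA -rmorphM.
apply: tw_scale; first by apply: vec_productM => //; exact: vec_product_cvec.
rewrite mulf_neq0//; apply/eqP => e0.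
by move/eqP: ee; rewrite e0 expr0n eq_sym oner_eq0.
Qed.

Lemma enorm_mobius_sub x y : den c d x \is a GRing.unit -> den c d y \is a GRing.unit ->
  enorm (phi x - phi y) = enorm (x - y) / (cabs (den c d x) * cabs (den c d y)).
Proof.
move=> ux uy; have vx := den_vec_product x; have vy := den_vec_product y.
rewrite -cnorm_cvec (mobius_sub_rev ux uy).
have [k k0 E] := crev_inv vx ux.
have e1 : `|e| = 1 by apply/eqP; rewrite -sqrp_eq1// -normrX ee normr1.
rewrite cnormZ e1 mul1r E -!scalerAl cnormZ.
(* Comparison of the norms in (p~)^-1 = k p. *)
have Ek : `|k| = cabs (den c d x) ^- 2.
  have := congr1 cabs E; rewrite cnormZ (cnormV (vec_product_rev vx) (unit_rev ux)) cnorm_rev.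
  have p0 := cabs_neq0 vx ux.
  move=> /(congr1 ( *%R^~ (cabs (den c d x))^-1)); rewrite (mulfK p0) => <-.
  by rewrite -invfM.
rewrite Ek (cnormM _ (vec_productM vx (vec_product_cvec _))) (cnormM _ vx) cnorm_cvec.
rewrite (cnormV vy uy); have := cabs_neq0 vx ux; have := cabs_neq0 vy uy.
by move=> q0 p0; field; rewrite p0 q0.
Qed.

End Structure.
End MobiusIdentities.

(** * Changes of variables for Lebesgue measure *)

Local Open Scope classical_set_scope.
Local Open Scope ring_scope.

Local Notation pushm mu mf :=
  (measure_function_pushforward__canonical__measure_function_Measure mu mf).

Section AffineLebesgue.
Local Open Scope ereal_scope.
Context {R : realType}.
Notation mR := (measurableTypeR R).

(** The left side is a measure in A, so by uniqueness of Lebesgue measure the half-open intervals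
    suffice. *)
Lemma lebesgue_affine_preimage (s a : R) (A : set R) : s != 0%R -> measurable A ->
  (`|s|%:E * lebesgue_measure ((fun r : R => s * r + a)%R @^-1` A) =
   lebesgue_measure (A : set mR)).
Proof.
move=> s0 mA; have mf : measurable_fun [set: mR] ((fun r => s * r + a)%R : mR -> mR).
  by apply: measurable_funD => //; apply: measurable_funM.
pose mu := mscale (NngNum (normr_ge0 s)) (pushm (@lebesgue_measure R) mf).
apply/esym; apply: (@lebesgue_measure_unique R mu) => //= _ [[u v]] _ <-.
rewrite /mu /mscale /= /pushforward.
have [s_gt0|s_lt0|s00] := ltgtP 0%R s; last by rewrite -s00 eqxx in s0.
  have -> : (fun r => s * r + a)%R @^-1` `]u, v]%classic = `]((u - a) / s)%R, ((v - a) / s)%R]%classic.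
    apply/seteqP; split => r /=; rewrite !in_itv /= ltr_pdivrMr// ler_pdivlMr//;
      by rewrite ltrBlDr lerBrDr (mulrC r).
  rewrite !lebesgue_measure_itv /= !lte_fin ltr_pM2r ?invr_gt0// ltrD2r.
  case: ifPn => _; last by rewrite mule0.
  rewrite -!EFinD -EFinM gtr0_norm//; congr EFin.
  by field; rewrite gt_eqF.
(* For negative s the preimage is closed on the other side, with the end points exchanged; its
   length is the same. *)
have -> : (fun r => s * r + a)%R @^-1` `]u, v]%classic = `[((v - a) / s)%R, ((u - a) / s)%R[%classic.
  apply/seteqP; split => r /=; rewrite !in_itv /= ltr_ndivlMr// ler_ndivrMr//;
    by rewrite ltrBlDr lerBrDr (mulrC r) andbC.
rewrite !lebesgue_measure_itv /= !lte_fin ltr_nM2r ?invr_lt0// ltrD2r.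
case: ifPn => _; last by rewrite mule0.
rewrite -!EFinD -EFinM ltr0_norm//; congr EFin.
by field; rewrite lt_eqF.
Qed.

Lemma lebesgue1_affine (s a : R) (g : mR -> \bar R) : s != 0%R ->
  measurable_fun setT g -> (forall r, 0 <= g r) ->
  \int[@lebesgue_measure R]_r g (s * r + a)%R = (`|s|^-1)%:E * \int[@lebesgue_measure R]_r g r.
Proof.
move=> s0 mg g0.
have mf : measurable_fun [set: mR] ((fun r => s * r + a)%R : mR -> mR).
  by apply: measurable_funD => //; apply: measurable_funM.
pose mu := mscale (NngNum (normr_ge0 s)) (pushm (@lebesgue_measure R) mf).
rewrite [in RHS](eq_measure_integral mu) /=; last first.
  by move=> A mA _; rewrite -(lebesgue_affine_preimage a s0 mA).
rewrite ge0_integral_mscale// ge0_integral_pushforward//= muleA -EFinM mulVf ?normr_eq0// mul1e.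
by [].
Qed.

End AffineLebesgue.

Section AffineLebesgueTuple.
Context {R : realType}.
Notation mR := (measurableTypeR R).

Definition tuple_affine m (s : R) (a t : m.-tuple mR) : m.-tuple mR :=
  [tuple s * tnth t i + tnth a i | i < m].

Lemma measurable_tuple_affine m (s : R) (a : m.-tuple mR) :
  measurable_fun setT (tuple_affine s a).
Proof.
apply/measurable_fun_tnthP => i.
rewrite (_ : _ \o _ = (fun t : m.-tuple mR => s * tnth t i + tnth a i)); last first.
  by apply/funext => t /=; rewrite tnth_mktuple.
apply: measurable_funD => //; apply: measurable_funM => //.
exact: measurable_tnth.
Qed.

Local Open Scope ereal_scope.

Lemma ge0_lebesgueS m (h : m.+1.-tuple mR -> \bar R) : measurable_fun setT h ->
  (forall t, 0 <= h t) ->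
  \int[lebesgue m.+1]_t h t =
  \int[@lebesgue_measure R]_r \int[lebesgue m]_t h (tuple_cons (r, t)).
Proof.
move=> mh h0.
rewrite [LHS](ge0_integral_pushforward (@measurable_tuple_cons R m)
  (lebesgue_measure \x lebesgue m)%E)//=.
rewrite preimage_setT; apply: (fubini_tonelli1 (h \o @tuple_cons R m)).
  exact: (measurableT_comp mh (@measurable_tuple_cons R m)).
by move=> ?; exact: h0.
Qed.

(** Induction on the dimension: Tonelli separates the first coordinate, which the one-dimensional
    rule handles with one factor |s|^-1. *)
Lemma lebesgue_affine m (s : R) (a : m.-tuple mR) (h : m.-tuple mR -> \bar R) :
  s != 0%R -> measurable_fun setT h -> (forall t, 0 <= h t) ->
  \int[lebesgue m]_t h (tuple_affine s a t) = (`|s| ^- m)%:E * \int[lebesgue m]_t h t.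
Proof.
move=> s0; elim: m => [|m IH] in a h * => mh h0.
  rewrite invr1 mul1e; apply: eq_integral => t _; congr h.
  by rewrite (tuple0 t) [LHS]tuple0.
have mc r : measurable_fun setT (fun t : m.-tuple mR => tuple_cons (r, t)).
  apply: (measurableT_comp (@measurable_tuple_cons R m)).
  exact: measurable_pair1.
pose a' : m.-tuple mR := [tuple of behead a].
have E r t : tuple_affine s a (tuple_cons (r, t)) =
    tuple_cons ((s * r + thead a)%R, tuple_affine s a' t).
  apply: eq_from_tnth => i; rewrite tnth_mktuple.
  case: (unliftP ord0 i) => [j ->|->].
    rewrite /tuple_cons !tnthS tnth_mktuple; congr (_ + _)%R.
    by rewrite (tuple_eta a) tnthS; congr tnth; apply: val_inj.
  by rewrite /tuple_cons !tnth0 (tuple_eta a) !theadE.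
rewrite ge0_lebesgueS//; last exact: (measurableT_comp mh (measurable_tuple_affine _ _)).
rewrite ge0_lebesgueS//.
under eq_integral => r _.
  under eq_integral do rewrite E.
  rewrite (IH a' (fun t => h (tuple_cons ((s * r + thead a)%R, t))))//; last first.
    exact: (measurableT_comp mh (mc _)).
  over.
pose H r := \int[lebesgue m]_t h (tuple_cons (r, t)).
have mH : measurable_fun setT H.
  apply: (measurable_fun_fubini_tonelli_F (h \o @tuple_cons R m)) => //.
    exact: (measurableT_comp mh (@measurable_tuple_cons R m)).
  by move=> [r t]; exact: h0.
have H0 r : 0 <= H r by apply: integral_ge0.
rewrite /= ge0_integralZl//; last 2 first.
- by apply: (measurableT_comp mH); apply: measurable_funD => //; apply: measurable_funM.
- by move=> r _; exact: integral_ge0.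
rewrite (lebesgue1_affine (thead a) s0 mH H0) muleA -EFinM; congr (_%:E * _).
by rewrite exprS invfM mulrC.
Qed.

End AffineLebesgueTuple.

(** * Measurability of maps into and out of the space of row vectors *)

Section RowMeasurability.
Context {R : realType} {m : nat}.
Notation mR := (measurableTypeR R).
Notation Rm := 'rV[R]_m.

Definition tuple_of_row (x : Rm) : m.-tuple mR := [tuple x 0 i | i < m].

Lemma row_of_tupleK : cancel (@row_of_tuple R m) tuple_of_row.
Proof. by move=> t; apply: eq_from_tnth => i; rewrite tnth_mktuple mxE. Qed.

Lemma tuple_of_rowK : cancel tuple_of_row (@row_of_tuple R m).
Proof. by move=> x; apply/rowP => i; rewrite mxE tnth_mktuple. Qed.

(** Row vectors carry the norm and tuples the sigma-algebra. A map into rows is therefore tested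
    coordinate by coordinate, and a map out of rows is tested after [row_of_tuple]. *)
Definition measurable_row d (S : measurableType d) (f : S -> Rm) :=
  forall i, measurable_fun setT (fun s => f s 0 i : mR).

Definition measurable_on_row d (S : measurableType d) (h : Rm -> S) :=
  measurable_fun setT (fun t : m.-tuple mR => h (row_of_tuple t)).

Lemma measurable_rowP d (S : measurableType d) (f : S -> Rm) :
  measurable_row f -> measurable_fun setT (fun s => tuple_of_row (f s)).
Proof.
move=> mf; apply/measurable_fun_tnthP => i.
rewrite (_ : _ \o _ = fun s => f s 0 i) //.
by apply/funext => s /=; rewrite tnth_mktuple.
Qed.

Lemma measurable_on_row_comp d d' (S : measurableType d) (S' : measurableType d')
    (f : S -> Rm) (h : Rm -> S') :
  measurable_on_row h -> measurable_row f -> measurable_fun setT (fun s => h (f s)).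
Proof.
move=> mh mf.
rewrite (_ : (fun s => _) = (fun t => h (row_of_tuple t)) \o (fun s => tuple_of_row (f s))).
  exact: measurableT_comp mh (measurable_rowP mf).
by apply/funext => s /=; rewrite tuple_of_rowK.
Qed.

Lemma measurable_row_of_tuple : measurable_row (@row_of_tuple R m).
Proof.
move=> i; rewrite (_ : (fun s => _) = (fun t : m.-tuple mR => tnth t i)).
  exact: measurable_tnth.
by apply/funext => s; rewrite mxE.
Qed.

Lemma measurable_row_comp d d' (S : measurableType d) (S' : measurableType d')
    (f : S -> Rm) (g : S' -> S) :
  measurable_row f -> measurable_fun setT g -> measurable_row (f \o g).
Proof. by move=> mf mg i; apply: (measurableT_comp (mf i) mg). Qed.

Lemma measurable_row_cst d (S : measurableType d) (x : Rm) :
  measurable_row (fun _ : S => x).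
Proof. by move=> i; exact: measurable_cst. Qed.

Lemma measurable_rowD d (S : measurableType d) (f g : S -> Rm) :
  measurable_row f -> measurable_row g -> measurable_row (fun s => f s + g s).
Proof.
move=> mf mg i; under eq_fun do rewrite mxE.
exact: (measurable_funD (mf i) (mg i)).
Qed.

Lemma measurable_rowZ d (S : measurableType d) (k : S -> R) (g : S -> Rm) :
  measurable_fun setT (k : S -> mR) -> measurable_row g -> measurable_row (fun s => k s *: g s).
Proof.
move=> mf mg i; under eq_fun do rewrite mxE.
exact: (measurable_funM mf (mg i)).
Qed.

Lemma measurable_rowN d (S : measurableType d) (g : S -> Rm) :
  measurable_row g -> measurable_row (fun s => - g s).
Proof.
move=> mg; rewrite (_ : (fun s => _) = (fun s => -1 *: g s)).
  exact: measurable_rowZ.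
by apply/funext => s; rewrite scaleN1r.
Qed.

Lemma measurable_row_linear d (S : measurableType d) (L : Rm -> Rm) (f : S -> Rm) :
  (forall x y, L (x + y) = L x + L y) -> (forall k x, L (k *: x) = k *: L x) ->
  measurable_row f -> measurable_row (fun s => L (f s)).
Proof.
move=> LD LZ mf.
have L0 : L 0 = 0 by have := LZ 0 0; rewrite !scale0r.
have -> : (fun s => L (f s)) = fun s => \sum_i f s 0 i *: L (delta_mx 0 i).
  apply/funext => s; rewrite [in LHS](row_sum_delta (f s)) (big_morph L LD L0).
  by apply: eq_bigr => i _; rewrite LZ.
move=> i; under eq_fun do rewrite summxE.
apply: measurable_sum => j; under eq_fun do rewrite mxE.
by apply: measurable_funM => //; exact: mf.
Qed.

Lemma measurable_on_row_enorm : measurable_on_row (@enorm R m : Rm -> mR).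
Proof. exact: measurable_enorm. Qed.

End RowMeasurability.

(** * Volume bounds for the unit ball, and null points *)

Section Cubes.
Context {R : realType}.
Notation mR := (measurableTypeR R).
Local Open Scope ereal_scope.

Definition cube m (u v : R) : set (m.-tuple mR) :=
  [set t | forall i, (u <= tnth t i <= v)%R].

Lemma measurable_cube m u v : measurable (@cube m u v).
Proof.
rewrite (_ : @cube m u v = \bigcap_(i in [set: 'I_m]) ((fun t : m.-tuple mR => tnth t i) @^-1` `[u, v])).
  apply: fin_bigcap_measurable => // i _.
  rewrite -[X in measurable X]setTI; apply: measurable_tnth => //.
by apply/seteqP; split => t H i => [_|] /=; [rewrite in_itv /=; exact: H|have := H i I; rewrite /= in_itv].
Qed.

Lemma lebesgue_cube m (u v : R) : (u <= v)%R ->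
  lebesgue m (@cube m u v) = ((v - u) ^+ m)%:E.
Proof.
move=> uv; elim: m => [|m IH].
  rewrite [LHS]diracE mem_set// => -[]//.
transitivity ((lebesgue_measure \x lebesgue m) (`[u, v]%classic `*` @cube m u v)).
  rewrite /= /lebesgue_cons /pushforward; congr (_ _).
  apply/seteqP; split => -[r t] /=.
    move=> H; split; first by have := H ord0; rewrite in_itv.
    by move=> i; have := H (lift ord0 i); rewrite tnthS.
  by move=> [ruv H] i; case: (unliftP ord0 i) => [j ->|->]; rewrite ?tnthS.
rewrite product_measure1E//; last exact: measurable_cube.
rewrite IH exprS EFinM; congr (_ * _).
transitivity (lebesgue_measure (`[u, v]%classic : set R)); first by [].
rewrite lebesgue_measure_itv /= lte_fin.
case: ifPn => [_|]; first by rewrite -EFinB.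
by rewrite -leNgt => vu; rewrite (le_anti (introT andP (conj uv vu))) subrr.
Qed.

Definition uball m : set (m.-tuple mR) := [set t | (enorm (row_of_tuple t) <= 1)%R].

Lemma measurable_uball m : measurable (@uball m).
Proof.
rewrite (_ : @uball m = (fun t : m.-tuple mR => enorm (row_of_tuple t)) @^-1` `]-oo, 1%R]).
  rewrite -[X in measurable X]setTI; apply: measurable_enorm => //.
by apply/seteqP; split => t /=; rewrite in_itv.
Qed.

Lemma abs_coord_le_enorm m (x : 'rV[R]_m) i : (`|x 0 i| <= enorm x)%R.
Proof.
rewrite -sqrtr_sqr ler_sqrt ?sumr_ge0//; last by move=> j _; exact: sqr_ge0.
by rewrite (bigD1 i)//= lerDl sumr_ge0// => j _; exact: sqr_ge0.
Qed.

Lemma lebesgue_uball_lty m : lebesgue m (@uball m) < +oo.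
Proof.
apply: (@le_lt_trans _ _ (lebesgue m (@cube m (-1) 1))).
  apply: le_measure; rewrite ?inE; [exact: measurable_uball|exact: measurable_cube|].
  move=> t /= t1 i; rewrite -ler_norml; apply: le_trans t1.
  by have := abs_coord_le_enorm (row_of_tuple t) i; rewrite mxE.
by rewrite lebesgue_cube ?ltry// ler_wpDl // ?lerN10.
Qed.

Lemma lebesgue_uball_gt0 m : 0 < lebesgue m (@uball m).
Proof.
(* A cube of side 1 / (m + 1) lies in the ball because m / (m + 1)^2 <= 1; m + 1 instead of m keeps
   the side positive in dimension 0. *)
have m0 : (0 < m.+1%:R^-1 :> R)%R by rewrite invr_gt0.
apply: (@lt_le_trans _ _ (lebesgue m (@cube m 0 m.+1%:R^-1))).
  by rewrite lebesgue_cube ?ltW// subr0 lte_fin exprn_gt0.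
apply: le_measure; rewrite ?inE; [exact: measurable_cube|exact: measurable_uball|].
move=> t H; rewrite /uball /= -(sqrtr1 R) ler_sqrt//.
apply: (@le_trans _ _ (\sum_(i < m) m.+1%:R^-1 ^+ 2)%R).
  apply: ler_sum => i _; rewrite mxE; have /andP[? ?] := H i.
  by rewrite lerXn2r ?nnegrE// ltW.
rewrite sumr_const card_ord -(mulr_natl (m.+1%:R^-1 ^+ 2)) expr2 mulrA ler_pdivrMr// mul1r.
rewrite ler_pdivrMr// -natrM ler_nat.
by rewrite (leq_trans (leqnSn m))// leq_pmulr.
Qed.

Lemma measurable_point m (t : m.-tuple mR) : measurable [set t].
Proof.
rewrite (_ : [set t] = \bigcap_(i in [set: 'I_m]) ((fun s : m.-tuple mR => tnth s i) @^-1` [set tnth t i])).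
  apply: fin_bigcap_measurable => // i _.
  by rewrite -[X in measurable X]setTI; apply: measurable_tnth.
by apply/seteqP; split => [_ ->//|s H]; apply: eq_from_tnth => i; exact: H.
Qed.

(** The point lies in a hyperplane, a product with a null first factor. In dimension 0 the measure
    is a Dirac mass, hence [0 < m]. *)
Lemma lebesgue_set1 m (t : m.-tuple mR) : (0 < m)%N -> lebesgue m [set t] = 0.
Proof.
case: m t => // m t _.
have S0 : (lebesgue_measure \x lebesgue m) ([set thead t] `*` setT) = 0.
  rewrite product_measure1E// [X in X * _](_ : _ = 0) ?mul0e//.
  exact: (lebesgue_measure_set1 (thead t : R)).
apply/eqP; rewrite eq_le measure_ge0 andbT -S0.
rewrite /= /lebesgue_cons /pushforward; apply: le_measure; rewrite ?inE.
- rewrite -[X in measurable X]setTI; apply: measurable_tuple_cons => //.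
  exact: measurable_point.
- exact: measurableX.
- by move=> [r s] /= <-; split.
Qed.

End Cubes.

(** * Substitutions with a density: affine maps and linear isometries *)

Section ChangeOfVariables.
Context {R : realType} {m : nat}.
Notation mR := (measurableTypeR R).
Notation Rm := 'rV[R]_m.
Local Open Scope ereal_scope.

(* The substitution x = T z has Jacobian factor rho. *)
Definition cov (mu : {measure set (m.-tuple mR) -> \bar R}) (T : Rm -> Rm) (rho : Rm -> R) :=
  [/\ measurable_row (fun t : m.-tuple mR => T (row_of_tuple t)),
      measurable_on_row (rho : Rm -> mR), (forall x, 0 <= rho x)%R &
      forall h : Rm -> \bar R, measurable_on_row h -> (forall x, 0 <= h x) ->
        \int[mu]_t (h (T (row_of_tuple t)) * (rho (row_of_tuple t))%:E) =
        \int[mu]_t h (row_of_tuple t)].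

Lemma cov_comp mu T T' rho rho' : cov mu T rho -> cov mu T' rho' ->
  cov mu (T \o T') (fun x => rho (T' x) * rho' x)%R.
Proof.
move=> [mT mr r0 E] [mT' mr' r0' E'].
have mTT : measurable_row (fun t : m.-tuple mR => T (T' (row_of_tuple t))).
  move=> i.
  exact: (@measurable_on_row_comp R m _ _ _ mR _ (fun x => T x 0%R i) (mT i) mT').
split.
- exact: mTT.
- apply: measurable_funM => //; exact: (measurable_on_row_comp mr mT').
- by move=> x; rewrite mulr_ge0.
- move=> h mh h0; rewrite -(E h mh h0).
  rewrite -(E' (fun x => h (T x) * (rho x)%:E)); last 2 first.
  + apply: emeasurable_funM; first exact: (measurable_on_row_comp mh mT).
    exact/measurable_EFinP.
  + by move=> x; rewrite mule_ge0 ?lee_fin.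
  by apply: eq_integral => t _; rewrite /= EFinM muleA.
Qed.

Lemma cov_affine (s : R) (a : Rm) : s != 0%R ->
  cov (lebesgue m) (fun x => s *: x + a)%R (fun _ => `|s| ^+ m)%R.
Proof.
move=> s0; split.
- apply: measurable_rowD; last exact: measurable_row_cst.
  by apply: measurable_rowZ; [exact: measurable_cst|exact: measurable_row_of_tuple].
- exact: measurable_cst.
- by move=> _; rewrite exprn_ge0.
- move=> h mh h0; rewrite ge0_integralZr//; last first.
    apply: (measurable_on_row_comp mh).
    apply: measurable_rowD; last exact: measurable_row_cst.
    by apply: measurable_rowZ; [exact: measurable_cst|exact: measurable_row_of_tuple].
  have -> : \int[lebesgue m]_t h (s *: row_of_tuple t + a)%R =
      (`|s| ^- m)%:E * \int[lebesgue m]_t h (row_of_tuple t).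
    rewrite -(@lebesgue_affine R m s (tuple_of_row a) (h \o @row_of_tuple R m))//.
      by apply: eq_integral => t _ /=; congr h; apply/rowP => i; rewrite !mxE !tnth_mktuple.
    by move=> t; exact: h0.
  rewrite muleC muleA -EFinM mulfV ?mul1e//.
  by rewrite expf_neq0// normr_eq0.
Qed.

Let b (x : Rm) : R := (enorm x <= 1)%R%:R.

Let mb : measurable_on_row (b : Rm -> mR).
Proof.
rewrite /measurable_on_row (_ : (fun t => _) =
  fun t : m.-tuple mR => if (enorm (row_of_tuple t) <= 1)%R then 1%R else 0%R).
  by apply: measurable_fun_ifT => //; apply: measurable_fun_ler => //; exact: measurable_enorm.
by apply/funext => t; rewrite /b; case: ifP.
Qed.

(* Uniqueness of the translation invariant measure, in Weil's form: with b the
   indicator of the unit ball, b (T z) = b z, so that translating variables in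
   the double integral of F (x + T z) * b z gives both sides times vol(ball). *)
Lemma cov_isometry (T T' : Rm -> Rm) :
  (forall x y, T (x + y) = T x + T y)%R -> (forall k x, T (k *: x) = k *: T x)%R ->
  (forall x, enorm (T x) = enorm x) -> cancel T' T ->
  cov (lebesgue m) T (fun _ => 1%R).
Proof.
move=> TD TZ TN TK.
have TB x y : (T (x - y) = T x - T y)%R by rewrite -scaleN1r TD TZ scaleN1r.
have mT := measurable_row_linear TD TZ (@measurable_row_of_tuple R m).
split => //; first exact: measurable_cst.
move=> F mF F0; under eq_integral do rewrite mule1.
have bI : \int[lebesgue m]_t (b (row_of_tuple t))%:E = lebesgue m (@uball R m).
  rewrite -[in RHS](setIT (@uball R m)) -integral_indic//; last exact: measurable_uball.
  apply: eq_integral => t _; rewrite indicE /b; congr ((nat_of_bool _)%:R%:E).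
  by apply/idP/idP; rewrite inE.
have bfin : lebesgue m (@uball R m) \is a fin_num.
  by rewrite ge0_fin_numE//; exact: lebesgue_uball_lty.
have mfst : measurable_row (fun z : m.-tuple mR * m.-tuple mR => row_of_tuple z.1).
  exact: (measurable_row_comp (@measurable_row_of_tuple R m) (@measurable_fst _ _ _ _)).
have msnd : measurable_row (fun z : m.-tuple mR * m.-tuple mR => row_of_tuple z.2).
  exact: (measurable_row_comp (@measurable_row_of_tuple R m) (@measurable_snd _ _ _ _)).
have mTsnd := measurable_row_linear TD TZ msnd.
pose G (z : m.-tuple mR * m.-tuple mR) :=
  F (row_of_tuple z.1 + T (row_of_tuple z.2))%R * (b (row_of_tuple z.2))%:E.
have mG : measurable_fun setT G.
  apply: emeasurable_funM.
    apply: (measurable_on_row_comp mF).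
    by apply: measurable_rowD.
  by apply/measurable_EFinP; exact: (measurable_on_row_comp mb).
have G0 z : 0 <= G z by rewrite mule_ge0// lee_fin ler0n.
(* [G'] is [G] after the shift of the second variable by -T' x, rewritten with T T' x = x and the
   invariance of [b] under T. *)
pose G' (z : m.-tuple mR * m.-tuple mR) :=
  F (T (row_of_tuple z.2)) * (b (T (row_of_tuple z.2) - row_of_tuple z.1)%R)%:E.
have mG' : measurable_fun setT G'.
  apply: emeasurable_funM; first exact: (measurable_on_row_comp mF).
  apply/measurable_EFinP; apply: (measurable_on_row_comp mb).
  by apply: measurable_rowD => //; exact: measurable_rowN.
have G'0 z : 0 <= G' z by rewrite mule_ge0// lee_fin ler0n.
have b0 x : 0 <= (b x)%:E by rewrite lee_fin ler0n.
have mbE : measurable_fun setT (fun t : m.-tuple mR => (b (row_of_tuple t))%:E).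
  exact/measurable_EFinP.
have B0 := @lebesgue_uball_gt0 R m.
have trans (s : R) a h : measurable_on_row h -> (forall x, 0 <= h x) -> `|s|%R = 1%R ->
    \int[lebesgue m]_t h (s *: row_of_tuple t + a)%R = \int[lebesgue m]_t h (row_of_tuple t).
  move=> mh h0 s1; have s0 : s != 0%R by rewrite -normr_eq0 s1 oner_eq0.
  have [_ _ _ <-//] := cov_affine a s0.
  by apply: eq_integral => t _; rewrite s1 expr1n mule1.
have EF := fubini_tonelli (m1 := @lebesgue R m) (m2 := @lebesgue R m) G mG G0.
have EF' := fubini_tonelli (m1 := @lebesgue R m) (m2 := @lebesgue R m) G' mG' G'0.
have L : \int[lebesgue m]_z \int[lebesgue m]_x G (x, z) = \int[lebesgue m]_t F (row_of_tuple t) * lebesgue m (@uball R m).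
  rewrite -bI; pose K := \int[lebesgue m]_t F (row_of_tuple t).
  have K0 : 0 <= K by apply: integral_ge0.
  transitivity (\int[lebesgue m]_z (K * (b (row_of_tuple z))%:E)); last first.
    exact: (ge0_integralZl _ measurableT mbE (fun t _ => b0 _) K0).
  apply: eq_integral => z _.
  have mFz : measurable_fun setT (fun t : m.-tuple mR => F (row_of_tuple t + T (row_of_tuple z))%R).
    apply: (measurable_on_row_comp mF); apply: measurable_rowD; last exact: measurable_row_cst.
    exact: measurable_row_of_tuple.
  rewrite /G /= (ge0_integralZr _ measurableT mFz (fun t _ => F0 _) (b0 _)).
  congr (_ * _); rewrite /K -(trans 1%R (T (row_of_tuple z)) F mF F0 (normr1 _)).
  by apply: eq_integral => t _; rewrite scale1r.
have L' : \int[lebesgue m]_z \int[lebesgue m]_x G' (x, z) = \int[lebesgue m]_t F (T (row_of_tuple t)) * lebesgue m (@uball R m).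
  transitivity (\int[lebesgue m]_z (F (T (row_of_tuple z)) * lebesgue m (@uball R m))); last first.
    exact: (ge0_integralZr _ measurableT (measurable_on_row_comp mF mT) (fun t _ => F0 _) (ltW B0)).
  apply: eq_integral => z _.
  have mbz : measurable_fun setT
      (fun t : m.-tuple mR => (b (T (row_of_tuple z) - row_of_tuple t)%R)%:E).
    apply/measurable_EFinP; apply: (measurable_on_row_comp mb).
    apply: measurable_rowD; first exact: measurable_row_cst.
    by apply: measurable_rowN; exact: measurable_row_of_tuple.
  rewrite /G' /= (ge0_integralZl _ measurableT mbz (fun t _ => b0 _) (F0 _)).
  congr (_ * _); rewrite -bI.
  rewrite -(trans (-1)%R (T (row_of_tuple z)) (fun x => (b x)%:E) mbE b0 (normrN1 _)).
  by apply: eq_integral => t _; rewrite scaleN1r addrC.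
have M : \int[lebesgue m]_x \int[lebesgue m]_z G (x, z) =
    \int[lebesgue m]_x \int[lebesgue m]_z G' (x, z).
  apply: eq_integral => x _.
  pose h z := F (row_of_tuple x + T z)%R * (b z)%:E.
  have mh : measurable_on_row h.
    apply: emeasurable_funM; last exact: mbE.
    apply: (measurable_on_row_comp mF); apply: measurable_rowD; first exact: measurable_row_cst.
    exact: mT.
  have h0 z : 0 <= h z by rewrite mule_ge0.
  transitivity (\int[lebesgue m]_z h (row_of_tuple z)); first by apply: eq_integral.
  rewrite -(trans 1%R (- T' (row_of_tuple x))%R h mh h0 (normr1 _)).
  apply: eq_integral => z _; rewrite /h /G' /= scale1r TB TK addrC subrK; congr (_ * _).
  by rewrite /b -TN TB TK.
have : \int[lebesgue m]_t F (T (row_of_tuple t)) * lebesgue m (@uball R m) =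
    \int[lebesgue m]_t F (row_of_tuple t) * lebesgue m (@uball R m).
  exact: (etrans (esym L') (etrans (esym EF') (etrans (esym M) (etrans EF L)))).
(* The ball has positive finite volume, so the common factor can be cancelled even if the integrals
   are infinite. *)
move=> E; apply/le_anti/andP; split.
  by rewrite -(lee_pmul2r bfin B0) E.
by rewrite -(lee_pmul2r bfin B0) E.
Qed.

End ChangeOfVariables.

Section SetsToFunctions.
Local Open Scope ereal_scope.
Context d1 d2 (X : measurableType d1) (Y : measurableType d2) (R : realType).
Context (mu : {measure set X -> \bar R}) (nu : {measure set Y -> \bar R}).
Import HBNNSimple.

(** The passage from indicators to simple functions is linearity, and from there to nonnegative
    functions monotone convergence on both sides. *)
Lemma ge0_integral_density (phi : X -> Y) (rho : X -> R) :
  measurable_fun setT phi -> measurable_fun setT rho -> (forall x, 0 <= rho x)%R ->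
  (forall A, measurable A -> \int[mu]_x (\1_A (phi x) * rho x)%:E = nu A) ->
  forall F : Y -> \bar R, measurable_fun setT F -> (forall y, 0 <= F y) ->
  \int[mu]_x (F (phi x) * (rho x)%:E) = \int[nu]_y F y.
Proof.
move=> mphi mrho rho0 H F mF F0.
pose f_ := nnsfun_approx measurableT mF.
have mphir n : measurable_fun setT (fun x => (f_ n (phi x))%:E * (rho x)%:E).
  apply: emeasurable_funM; last exact/measurable_EFinP.
  by apply/measurable_EFinP; apply: measurableT_comp.
transitivity (limn (fun n => \int[mu]_x ((f_ n (phi x))%:E * (rho x)%:E))).
  rewrite -monotone_convergence//.
  - apply: eq_integral => x _; apply/esym/cvg_lim => //.
    apply: cvgeZr => //; apply: cvg_nnsfun_approx => // *; exact: F0.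
  - by move=> n x _; rewrite mule_ge0 ?lee_fin.
  - move=> x _ a b ab; rewrite lee_wpmul2r ?lee_fin//.
    exact/lefP/nd_nnsfun_approx.
transitivity (limn (fun n => \int[nu]_y (f_ n y)%:E)); last first.
  rewrite -monotone_convergence//.
  - by apply: eq_integral => y _; apply/cvg_lim => //; exact: cvg_nnsfun_approx.
  - by move=> n; exact/measurable_EFinP.
  - by move=> n y _; rewrite lee_fin.
  - by move=> y _ a b ab; rewrite lee_fin; exact/lefP/nd_nnsfun_approx.
congr (limn _); apply/funext => n.
have mf k : measurable (f_ n @^-1` [set k]) by exact: measurable_sfunP.
have mind k : measurable_fun setT (fun x => (\1_(f_ n @^-1` [set k]) (phi x) * rho x)%:E).
  apply/measurable_EFinP; apply: measurable_funM => //.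
  by apply: (measurableT_comp _ mphi); exact: measurable_indic.
transitivity (\sum_(k \in range (f_ n))
    \int[mu]_x (k%:E * (\1_(f_ n @^-1` [set k]) (phi x) * rho x)%:E)).
  rewrite -ge0_integral_fsum//.
  - apply: eq_integral => x _; rewrite {1}(fimfunE (f_ n) (phi x)) -fsumEFin//.
    rewrite ge0_mule_fsuml; last by move=> k; rewrite nnfun_muleindic_ge0.
    by apply: eq_fsbigr => k _; rewrite -!EFinM mulrA.
  - by move=> k; apply: emeasurable_funM.
  - move=> k x _; rewrite -EFinM lee_fin mulrA mulr_ge0//.
    by have := nnfun_muleindic_ge0 (f_ n) k (phi x); rewrite lee_fin.
transitivity (\sum_(k \in range (f_ n)) k%:E * nu (f_ n @^-1` [set k])).
  apply: eq_fsbigr => k /[!inE] -[y _ fyk].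
  rewrite ge0_integralZl//.
  - by rewrite H.
  - by move=> x _; rewrite lee_fin mulr_ge0.
  - by rewrite lee_fin -fyk.
by rewrite integralT_nnsfun sintegralE.
Qed.

End SetsToFunctions.

(** * Inversion in the unit sphere *)

Section PowerLimit.
Context {R : realType}.

(** The limit q -> 1 of the hypothesis, carried out with an explicit q = 1 + d. *)
Lemma le_of_le_expX (m : nat) (u v : R) : 0 <= v ->
  (forall q, 1 < q -> u <= q ^+ m * v) -> u <= v.
Proof.
move=> v0 H.
(* The chord of the convex function (1 + d)^m over [0, 1]. *)
have pow (d : R) : 0 <= d <= 1 -> (1 + d) ^+ m <= 1 + d * (2 ^+ m - 1).
  move=> /andP[d0 d1]; elim: m {H} => [|n IH]; first by rewrite !expr0 subrr mulr0 addr0.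
  rewrite exprS; apply: (le_trans (ler_wpM2l _ IH)); first by rewrite addr_ge0.
  have p1 : 1 <= 2 ^+ n :> R by rewrite exprn_ege1// ler1n.
  rewrite exprS; move: (2 ^+ n) p1 => P p1.
  have : 0 <= d * (1 - d) * (P - 1) by rewrite !mulr_ge0 ?subr_ge0.
  lra.
apply/ler_addgt0Pr => e e0.
(* Chosen so that the chord bound exceeds v by at most d 2^m v <= e; the + 1 keeps the denominator
   positive. *)
pose d := Num.min 1 (e / (2 ^+ m * v + 1)).
have w0 : 0 < 2 ^+ m * v + 1 by rewrite ltr_wpDl// mulr_ge0// exprn_ge0.
have d0 : 0 < d by rewrite lt_min ltr01 divr_gt0.
have d1 : d <= 1 by rewrite ge_min lexx.
apply: (le_trans (H (1 + d) _)); first by rewrite ltrDl.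
apply: (le_trans (ler_wpM2r v0 (pow d _))); first by rewrite ltW.
have : d * (2 ^+ m * v + 1) <= e.
  by rewrite -ler_pdivlMr// ge_min lexx orbT.
have : 0 <= d * v := mulr_ge0 (ltW d0) v0.
lra.
Qed.

(** Bernoulli's inequality together with n < 2^n. It provides the number of bisections of a shell
    after which the ratio of the radii is below q. *)
Lemma le_exp2_archi (q x : R) : 1 < q -> exists n, x <= q ^+ (2 ^ n).
Proof.
move=> q1; have q10 : 0 < q - 1 by rewrite subr_gt0.
have bern k : 1 + k%:R * (q - 1) <= q ^+ k.
  elim: k => [|k IH]; first by rewrite mul0r addr0.
  rewrite exprS -natr1; have : 0 <= k%:R :> R by rewrite ler0n.
  have q0 : 0 <= q by rewrite (le_trans ler01)// ltW.
  have := ler_wpM2l q0 IH; have : 0 <= k%:R * (q - 1) ^+ 2 by rewrite mulr_ge0// sqr_ge0.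
  lra.
exists (Num.bound `|x / (q - 1)|); set k := Num.bound _.
have kx : x <= k%:R * (q - 1).
  rewrite -ler_pdivrMr//; apply: (le_trans (ler_norm _)).
  by apply: ltW; exact: archi_boundP.
apply: (le_trans kx); apply: (le_trans _ (bern _)); rewrite -[leLHS]add0r lerD//.
by rewrite ler_wpM2r ?(ltW q10)// ler_nat ltnW// ltn_expl.
Qed.

End PowerLimit.

(** * Volumes of spherical shells over a set of directions *)

Section Shells.
Context {R : realType} {m : nat}.
Notation mR := (measurableTypeR R).
Notation Rm := 'rV[R]_m.
Notation T := (m.-tuple mR).
Local Open Scope ereal_scope.

Let nrm (t : T) : R := enorm (row_of_tuple t).

Lemma enormZ (k : R) (x : Rm) : enorm (k *: x)%R = (`|k| * enorm x)%R.
Proof.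
rewrite -sqrtr_sqr /enorm -sqrtrM ?sqr_ge0// mulr_sumr; congr Num.sqrt.
by apply: eq_bigr => i _; rewrite mxE exprMn.
Qed.

Lemma row_of_tuple_radial (t : T) : row_of_tuple (radial t) = (nrm t)^-1 *: row_of_tuple t.
Proof. by apply/rowP => i; rewrite !mxE tnth_mktuple. Qed.


Lemma measurable_nrm : measurable_fun setT (nrm : T -> mR).
Proof. exact: measurable_enorm. Qed.

(** A truncated cone in polar form. Since 0^-1 = 0, [radial] fixes the origin, which is therefore
    not a direction; the volume formulas below take intervals that exclude 0. *)
Definition ring_sector (i : interval R) (B : set T) : set T :=
  [set t | nrm t \in i /\ B (radial t)].

Lemma measurable_ring_sector i B : measurable B -> measurable (ring_sector i B).
Proof.
move=> mB; rewrite (_ : ring_sector i B = nrm @^-1` [set` i] `&` @radial R m @^-1` B).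
  apply: measurableI.
    by rewrite -[X in measurable X]setTI; apply: measurable_nrm => //.
  by rewrite -[X in measurable X]setTI; exact: measurable_radial.
by apply/seteqP; split => t [].
Qed.

Lemma integral_indic_row (A : set T) : measurable A ->
  \int[lebesgue m]_t (\1_A (tuple_of_row (row_of_tuple t)))%:E = lebesgue m A :> \bar R.
Proof.
move=> mA; rewrite -[in RHS](setIT A) -integral_indic//.
by apply: eq_integral => t _; rewrite row_of_tupleK.
Qed.

Lemma nrm_scale (k : R) (t : T) : nrm (tuple_of_row (k *: row_of_tuple t)%R) = (`|k| * nrm t)%R.
Proof. by rewrite /nrm tuple_of_rowK enormZ. Qed.

Lemma radial_scale (k : R) (t : T) : (0 < k)%R ->
  radial (tuple_of_row (k *: row_of_tuple t)%R) = radial t.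
Proof.
move=> k0; apply: (can_inj (@row_of_tupleK R m)).
rewrite !row_of_tuple_radial nrm_scale tuple_of_rowK scalerA gtr0_norm// invfM mulrAC.
by rewrite mulVf ?mul1r// gt_eqF.
Qed.

(** The dilation by v keeps directions and carries the radii in j to those in i; its Jacobian is
    v^m. *)
Lemma lebesgue_ring_sector_scale (v : R) i j B : measurable B -> (0 < v)%R ->
  (forall r, (v * r \in i) = (r \in j))%R ->
  lebesgue m (ring_sector i B) = (v ^+ m)%:E * lebesgue m (ring_sector j B).
Proof.
move=> mB v0 ij.
have mi := measurable_ring_sector i mB; have mj := measurable_ring_sector j mB.
have v0' : v != 0%R by rewrite gt_eqF.
have [_ _ _ H] := cov_affine (0 : Rm) v0'.
rewrite -(integral_indic_row mi) -(H (fun x => (\1_(ring_sector i B) (tuple_of_row x))%:E)).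
- rewrite -(integral_indic_row mj) -ge0_integralZl//.
  + apply: eq_integral => t _; rewrite addr0 muleC gtr0_norm// row_of_tupleK !indicE.
    congr (_ * (nat_of_bool _)%:R%:E); apply/idP/idP; rewrite !inE /ring_sector /=;
      by rewrite nrm_scale (gtr0_norm v0) (radial_scale _ v0) ij.
  + apply/measurable_EFinP; under eq_fun do rewrite row_of_tupleK.
    exact: measurable_indic.
  + by rewrite lee_fin exprn_ge0// ltW.
- rewrite /measurable_on_row; apply/measurable_EFinP; under eq_fun do rewrite row_of_tupleK.
  exact: measurable_indic.
- by move=> x; rewrite lee_fin.
Qed.

Section FixedDirections.
Context (B : set T) (mB : measurable B).

Lemma lebesgue_unit_sector_lty : lebesgue m (ring_sector `]0%R, 1%R] B) < +oo.
Proof.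
apply: le_lt_trans (@lebesgue_uball_lty R m); apply: le_measure; rewrite ?inE.
- exact: measurable_ring_sector.
- exact: measurable_uball.
- by move=> t []; rewrite in_itv /= => /andP[].
Qed.

(** Up to the factor m, the surface measure of [B]. *)
Definition sector_volume : R := fine (lebesgue m (ring_sector `]0%R, 1%R] B)).

Lemma sector_volumeE : lebesgue m (ring_sector `]0%R, 1%R] B) = sector_volume%:E.
Proof. by rewrite fineK// ge0_fin_numE//; exact: lebesgue_unit_sector_lty. Qed.

Lemma sector_volume_ge0 : (0 <= sector_volume)%R.
Proof. exact: fine_ge0. Qed.

Lemma lebesgue_closed_sector v : (0 < v)%R ->
  lebesgue m (ring_sector `]0%R, v] B) = (v ^+ m * sector_volume)%:E.
Proof.
move=> v0; rewrite EFinM -sector_volumeE; apply: lebesgue_ring_sector_scale => // r.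
by rewrite !in_itv /= pmulr_rgt0// -[X in (_ <= X)%R]mulr1 ler_pM2l.
Qed.

(** The bounding sphere is seen to be negligible by scaling: for q > 1 the closed unit sector lies
    in the open one of radius q, whose volume is q^m times that of the open unit sector, and q tends
    to 1. *)
Lemma lebesgue_open_sector v : (0 < v)%R ->
  lebesgue m (ring_sector `]0%R, v[ B) = (v ^+ m * sector_volume)%:E.
Proof.
move=> v0.
have W v' : (0 < v')%R -> lebesgue m (ring_sector `]0%R, v'[ B) =
    (v' ^+ m)%:E * lebesgue m (ring_sector `]0%R, 1%R[ B).
  move=> v'0; apply: lebesgue_ring_sector_scale => // r.
  rewrite !in_itv /= pmulr_rgt0//; congr (_ && _).
  by rewrite -[X in (_ < X)%R]mulr1 ltr_pM2l.
rewrite W// EFinM; congr (_ * _).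
have W1 : lebesgue m (ring_sector `]0%R, 1%R[ B) <= sector_volume%:E.
  rewrite -sector_volumeE; apply: le_measure; rewrite ?inE; [exact: measurable_ring_sector..|].
  by move=> t []; rewrite !in_itv /= => /andP[t0 t1] Bt; split => //; rewrite in_itv /= t0 ltW.
have Wfin : lebesgue m (ring_sector `]0%R, 1%R[ B) \is a fin_num.
  by rewrite ge0_fin_numE//; exact: le_lt_trans W1 (ltry _).
apply/le_anti; rewrite W1 -(fineK Wfin) lee_fin.
apply: (@le_of_le_expX _ m); first exact: fine_ge0.
move=> q q1; have q0 : (0 < q)%R by exact: lt_trans q1.
rewrite -lee_fin EFinM (fineK Wfin) -sector_volumeE.
apply: (@le_trans _ _ (lebesgue m (ring_sector `]0%R, q[ B))); last by rewrite (W q q0).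
apply: le_measure; rewrite ?inE; [exact: measurable_ring_sector..|].
by move=> t []; rewrite !in_itv /= => /andP[t0 t1] Bt; split => //; rewrite in_itv /= t0 (le_lt_trans t1).
Qed.

(** Both kinds of half-open shells are required, since the inversion exchanges the closed and the
    open end. *)
Lemma lebesgue_ring_ocitv u v : (0 < u)%R -> (u <= v)%R ->
  lebesgue m (ring_sector `]u, v] B) = ((v ^+ m - u ^+ m) * sector_volume)%:E.
Proof.
move=> u0 uv; have v0 := lt_le_trans u0 uv.
have : lebesgue m (ring_sector `]0%R, v] B) =
    lebesgue m (ring_sector `]0%R, u] B) + lebesgue m (ring_sector `]u, v] B).
  rewrite -measureU; [|exact: measurable_ring_sector..|].
    congr (lebesgue m _); apply/seteqP; split => t.
      move=> []; rewrite in_itv /= => /andP[t0 tv] Bt.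
      have [tu|ut] := leP (nrm t) u; [left|right]; split => //; rewrite in_itv /=.
        by rewrite t0.
      by rewrite ut.
    move=> [] []; rewrite in_itv /= => /andP[t1 t2] Bt; split => //; rewrite in_itv /=.
      by rewrite t1 (le_trans t2).
    by rewrite t2 (lt_trans u0).
  apply/seteqP; split => t // [[]]; rewrite in_itv /= => /andP[_ tu] _ [].
  by rewrite in_itv /= ltNge tu.
rewrite !lebesgue_closed_sector// addeC => E.
by rewrite -[LHS](@addeK _ (u ^+ m * sector_volume)%:E)// -E -EFinB -mulrBl.
Qed.

Lemma lebesgue_ring_cobnd u v : (0 < u)%R -> (u <= v)%R ->
  lebesgue m (ring_sector `[u, v[ B) = ((v ^+ m - u ^+ m) * sector_volume)%:E.
Proof.
move=> u0 uv; have v0 := lt_le_trans u0 uv.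
have : lebesgue m (ring_sector `]0%R, v[ B) =
    lebesgue m (ring_sector `]0%R, u[ B) + lebesgue m (ring_sector `[u, v[ B).
  rewrite -measureU; [|exact: measurable_ring_sector..|].
    congr (lebesgue m _); apply/seteqP; split => t.
      move=> []; rewrite in_itv /= => /andP[t0 tv] Bt.
      have [ut|tu] := leP u (nrm t); [right|left]; split => //; rewrite in_itv /=.
        by rewrite ut.
      by rewrite t0.
    move=> [] []; rewrite in_itv /= => /andP[t1 t2] Bt; split => //; rewrite in_itv /=.
      by rewrite t1 (lt_le_trans t2).
    by rewrite t2 (lt_le_trans u0).
  apply/seteqP; split => t // [[]]; rewrite in_itv /= => /andP[_ tu] _ [].
  by rewrite in_itv /= leNgt tu.
rewrite !lebesgue_open_sector// addeC => E.
by rewrite -[LHS](@addeK _ (u ^+ m * sector_volume)%:E)// -E -EFinB -mulrBl.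
Qed.

End FixedDirections.
End Shells.

(** * The inversion compared with Lebesgue measure on a single shell *)

Section SphereInversion.
Context {R : realType} {m : nat}.
Notation mR := (measurableTypeR R).
Notation Rm := 'rV[R]_m.
Notation T := (m.-tuple mR).
Local Open Scope ereal_scope.

Definition sphere_inv (x : Rm) : Rm := enorm x ^- 2 *: x.

Definition inv_jacobian (x : Rm) : R := enorm x ^- (2 * m).

Lemma measurable_enormVX d (S : measurableType d) (f : S -> Rm) n :
  measurable_row f -> measurable_fun setT (fun s => enorm (f s) ^- n : mR).
Proof.
move=> mf; apply: (@measurable_on_row_comp R m _ _ _ mR _ (fun x => enorm x ^- n)%R) => //.
rewrite /measurable_on_row (_ : (fun t => _) = (fun x : R => x `^ (- n%:R))%R \o
    (fun t : T => enorm (row_of_tuple t))).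
  by apply: measurableT_comp; [exact: measurable_powR|exact: measurable_enorm].
by apply/funext => t /=; rewrite powR_invn// sqrtr_ge0.
Qed.

Lemma measurable_row_sphere_inv d (S : measurableType d) (f : S -> Rm) :
  measurable_row f -> measurable_row (fun s => sphere_inv (f s)).
Proof. by move=> mf; apply: measurable_rowZ => //; exact: measurable_enormVX. Qed.

Lemma measurable_inv_jacobian : measurable_fun setT (fun t : T => inv_jacobian (row_of_tuple t) : mR).
Proof. by apply: measurable_enormVX; exact: measurable_row_of_tuple. Qed.

Lemma inv_jacobian_ge0 x : (0 <= inv_jacobian x)%R.
Proof. by rewrite invr_ge0 exprn_ge0// sqrtr_ge0. Qed.

(** The aim is that the image of this measure under the inversion is Lebesgue measure, which is the
    substitution rule for sets. *)
Definition inv_density (A : set T) : \bar R :=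
  \int[lebesgue m]_(t in A) (inv_jacobian (row_of_tuple t))%:E.

Let inv_density0 : inv_density set0 = 0.
Proof. exact: integral_set0. Qed.

Let inv_density_ge0 A : 0 <= inv_density A.
Proof. by apply: integral_ge0 => t _; rewrite lee_fin inv_jacobian_ge0. Qed.

Let inv_density_semi_sigma_additive : semi_sigma_additive inv_density.
Proof.
apply: semi_sigma_additive_nng_induced.
  by apply/measurable_EFinP; exact: measurable_inv_jacobian.
by move=> t; rewrite lee_fin inv_jacobian_ge0.
Qed.

HB.instance Definition _ := isMeasure.Build _ _ _ inv_density
  inv_density0 inv_density_ge0 inv_density_semi_sigma_additive.

Definition tuple_inv (t : T) : T := tuple_of_row (sphere_inv (row_of_tuple t)).

Lemma measurable_tuple_inv : measurable_fun setT tuple_inv.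
Proof.
by apply: measurable_rowP; apply: measurable_row_sphere_inv; exact: measurable_row_of_tuple.
Qed.

Local Notation pushm mu mf :=
  (measure_function_pushforward__canonical__measure_function_Measure mu mf).

Lemma inv_densityE A : measurable A ->
  inv_density A = \int[lebesgue m]_t (\1_A t * inv_jacobian (row_of_tuple t))%:E.
Proof.
move=> mA; rewrite /inv_density integral_mkcond; apply: eq_integral => t _.
by rewrite patchE indicE; case: (t \in A); rewrite ?mul1r ?mul0r.
Qed.

Section FixedDirections.
Context (B : set T) (mB : measurable B).
Let V := sector_volume B.

Let nu A := inv_density (tuple_inv @^-1` A).

Lemma enorm_sphere_inv (x : Rm) : enorm (sphere_inv x) = (enorm x)^-1%R.
Proof.
rewrite /sphere_inv enormZ ger0_norm ?invr_ge0 ?exprn_ge0 ?sqrtr_ge0//.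
have [->|x0] := eqVneq (enorm x) 0%R; first by rewrite invr0 mulr0.
by field.
Qed.

Lemma tuple_inv_preimage (a b : R) : (0 < a)%R -> (a <= b)%R ->
  tuple_inv @^-1` ring_sector `[a, b[ B = ring_sector `]b^-1%R, a^-1%R] B.
Proof.
move=> a0 ab; have b0 := lt_le_trans a0 ab.
apply/seteqP; split => t; rewrite /ring_sector /= /tuple_inv !in_itv /= tuple_of_rowK enorm_sphere_inv.
  move=> [/andP[at_ tb] Bt].
  have t0 : (0 < enorm (row_of_tuple t))%R by rewrite -invr_gt0 (lt_le_trans a0).
  split.
    by rewrite -[X in (_ < X)%R]invrK ltf_pV2 ?posrE ?invr_gt0// tb -[X in (X <= _)%R]invrK lef_pV2 ?posrE ?invr_gt0.
  by move: Bt; rewrite /sphere_inv radial_scale// invr_gt0 exprn_gt0.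
move=> [/andP[bt ta] Bt].
have t0 : (0 < enorm (row_of_tuple t))%R by rewrite (lt_trans _ bt)// invr_gt0.
split.
  by rewrite -[X in (X <= _)%R]invrK lef_pV2 ?posrE ?invr_gt0// ta -[X in (_ < X)%R]invrK ltf_pV2 ?posrE ?invr_gt0.
by rewrite /sphere_inv radial_scale// invr_gt0 exprn_gt0.
Qed.

(** On the inverted shell the density |x|^(-2m) lies between a^(2m) and b^(2m), and the volume there
    is (a^-m - b^-m) V = (b^m - a^m) V / (ab)^m. *)
Lemma nu_shell_bounds (a b : R) : (0 < a)%R -> (a <= b)%R ->
  ((a / b) ^+ m * ((b ^+ m - a ^+ m) * V))%:E <= nu (ring_sector `[a, b[ B) /\
  nu (ring_sector `[a, b[ B) <= ((b / a) ^+ m * ((b ^+ m - a ^+ m) * V))%:E.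
Proof.
move=> a0 ab; have b0 := lt_le_trans a0 ab.
have mS : measurable (ring_sector `]b^-1%R, a^-1%R] B) by exact: measurable_ring_sector.
rewrite /nu tuple_inv_preimage// /inv_density.
have mJ : measurable_fun (ring_sector `]b^-1%R, a^-1%R] B) (fun t => (inv_jacobian (row_of_tuple t))%:E).
  by apply/measurable_EFinP; apply: measurable_funTS; exact: measurable_inv_jacobian.
have ba : (b^-1 <= a^-1)%R by rewrite lef_pV2 ?posrE.
have bi : (0 < b^-1)%R by rewrite invr_gt0.
have L := lebesgue_ring_ocitv mB bi ba.
have cE c : \int[lebesgue m]_(t in ring_sector `]b^-1%R, a^-1%R] B) c%:E =
    (c * ((a^-1 ^+ m - b^-1 ^+ m) * V))%:E.
  rewrite integral_cst//; apply: etrans (congr1 (fun z => c%:E * z) L) _.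
  by rewrite -EFinM.
have J t : ring_sector `]b^-1%R, a^-1%R] B t ->
    (a ^+ (2 * m) <= inv_jacobian (row_of_tuple t) <= b ^+ (2 * m))%R.
  move=> [] /[!in_itv] /= /andP[bt ta] _.
  have t0 : (0 < enorm (row_of_tuple t))%R by rewrite (lt_trans _ bt).
  rewrite /inv_jacobian -exprVn; apply/andP; split; apply: lerXn2r; rewrite ?nnegrE ?invr_ge0 ?(ltW t0) ?(ltW a0) ?(ltW b0)//.
    by rewrite -[X in (X <= _)%R]invrK lef_pV2 ?posrE ?invr_gt0.
  by rewrite -[X in (_ <= X)%R]invrK lef_pV2 ?posrE ?invr_gt0// ltW.
have an : (a != 0)%R by rewrite gt_eqF.
have bn : (b != 0)%R by rewrite gt_eqF.
split.
  have -> : ((a / b) ^+ m * ((b ^+ m - a ^+ m) * V))%R =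
      (a ^+ (2 * m) * ((a^-1 ^+ m - b^-1 ^+ m) * V))%R.
    rewrite mul2n -addnn exprD expr_div_n !exprVn.
    by field; rewrite !expf_neq0.
  rewrite -cE; apply: ge0_le_integral => //.
  - by move=> t _; rewrite lee_fin exprn_ge0// ltW.
  - by move=> t St; rewrite lee_fin; have /andP[] := J t St.
have -> : ((b / a) ^+ m * ((b ^+ m - a ^+ m) * V))%R =
    (b ^+ (2 * m) * ((a^-1 ^+ m - b^-1 ^+ m) * V))%R.
  rewrite mul2n -addnn exprD expr_div_n !exprVn.
  by field; rewrite !expf_neq0.
rewrite -cE; apply: ge0_le_integral => //.
- by move=> t _; rewrite lee_fin inv_jacobian_ge0.
- by move=> t St; rewrite lee_fin; have /andP[] := J t St.
Qed.

Lemma nu_shellU (a b c : R) : (0 < a)%R -> (a <= b)%R -> (b <= c)%R ->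
  nu (ring_sector `[a, c[ B) = nu (ring_sector `[a, b[ B) + nu (ring_sector `[b, c[ B).
Proof.
move=> a0 ab bc; have b0 := lt_le_trans a0 ab.
rewrite /nu tuple_inv_preimage ?(le_trans ab)// !tuple_inv_preimage//.
rewrite addeC -measureU; [|exact: measurable_ring_sector..|].
  congr (inv_density _); apply/seteqP; split => t.
    move=> []; rewrite in_itv /= => /andP[t1 t2] Bt.
    have [tb|bt] := leP (enorm (row_of_tuple t)) (b^-1)%R; [left|right]; split => //; rewrite in_itv /=.
      by rewrite t1.
    by rewrite bt.
  move=> [] []; rewrite in_itv /= => /andP[t1 t2] Bt; split => //; rewrite in_itv /=.
    by rewrite t1 (le_trans t2)// lef_pV2 ?posrE.
  by rewrite t2 (le_lt_trans _ t1)// lef_pV2 ?posrE// (lt_le_trans b0).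
apply/seteqP; split => t // [[]]; rewrite in_itv /= => /andP[_ tu] _ [].
by rewrite in_itv /= ltNge tu.
Qed.

(* Bisecting the shell geometrically improves the distortion bound from
   [(b / a) ^+ m] to [(b / a) ^+ (m / 2 ^ n)] for every n. *)
Lemma nu_shell_bisect (q : R) n (a b : R) : (1 <= q)%R -> (0 < a)%R -> (a <= b)%R ->
  (b <= a * q ^+ (2 ^ n))%R ->
  (q ^- m * ((b ^+ m - a ^+ m) * V))%:E <= nu (ring_sector `[a, b[ B) /\
  nu (ring_sector `[a, b[ B) <= (q ^+ m * ((b ^+ m - a ^+ m) * V))%:E.
Proof.
move=> q1; have q0 : (0 < q)%R by rewrite (lt_le_trans ltr01).
have V0 : (0 <= V)%R by exact: sector_volume_ge0.
elim: n a b => [|n IH] a b a0 ab bq; have b0 := lt_le_trans a0 ab.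
  have [l u] := nu_shell_bounds a0 ab.
  have D0 : (0 <= (b ^+ m - a ^+ m) * V)%R.
    rewrite mulr_ge0// subr_ge0; apply: lerXn2r => //; rewrite nnegrE; exact: ltW.
  rewrite expn0 expr1 in bq; split.
    apply: le_trans l; rewrite lee_fin ler_wpM2r// -exprVn lerXn2r ?nnegrE ?invr_ge0 ?divr_ge0 ?(ltW a0) ?(ltW b0) ?(ltW q0)//.
    by rewrite ler_pdivlMr// mulrC ler_pdivrMr// mulrC.
  apply: (le_trans u); rewrite lee_fin ler_wpM2r// lerXn2r ?nnegrE ?divr_ge0 ?(ltW a0) ?(ltW b0) ?(ltW q0)//.
  by rewrite ler_pdivrMr// mulrC.
(* With the geometric mean both halves have the same ratio of radii, the square root of b / a, hence
   at most q^(2^n). *)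
pose c := Num.sqrt (a * b).
have c2 : (c ^+ 2 = a * b)%R by rewrite sqr_sqrtr// mulr_ge0// ltW.
have c0 : (0 < c)%R by rewrite sqrtr_gt0 mulr_gt0.
have ac : (a <= c)%R.
  by rewrite -(@ler_pXn2r _ 2) ?nnegrE ?(ltW a0) ?(ltW c0)// c2 expr2 ler_pM2l.
have cb : (c <= b)%R.
  by rewrite -(@ler_pXn2r _ 2) ?nnegrE ?(ltW b0) ?(ltW c0)// c2 expr2 ler_pM2r.
have Q0 : (0 <= q ^+ (2 ^ n))%R by rewrite exprn_ge0// ltW.
have Q2 : (q ^+ (2 ^ n.+1) = (q ^+ (2 ^ n)) ^+ 2)%R by rewrite -exprM expnSr.
have cq : (c <= a * q ^+ (2 ^ n))%R.
  rewrite -(@ler_pXn2r _ 2) ?nnegrE ?(ltW c0)// ?mulr_ge0 ?(ltW a0)//.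
  by rewrite c2 exprMn -Q2 expr2 -mulrA ler_pM2l.
have bcq : (b <= c * q ^+ (2 ^ n))%R.
  rewrite -(@ler_pXn2r _ 2) ?nnegrE ?(ltW b0)// ?mulr_ge0 ?(ltW c0)//.
  by rewrite exprMn c2 -Q2 expr2 mulrAC ler_pM2r// .
have [l1 u1] := IH _ _ a0 ac cq; have [l2 u2] := IH _ _ c0 cb bcq.
rewrite (nu_shellU a0 ac cb); split.
  apply: le_trans (leeD l1 l2); rewrite -EFinD lee_fin le_eqVlt; apply/orP; left; apply/eqP.
  by ring.
apply: le_trans (leeD u1 u2) _; rewrite -EFinD lee_fin le_eqVlt; apply/orP; left; apply/eqP.
by ring.
Qed.

(** For each q > 1 enough bisections bound the quotient of the two measures by q^m from both sides;
    then q tends to 1. *)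
Lemma nu_shell (a b : R) : (0 < a)%R -> (a <= b)%R ->
  nu (ring_sector `[a, b[ B) = lebesgue m (ring_sector `[a, b[ B).
Proof.
move=> a0 ab; rewrite (lebesgue_ring_cobnd mB a0 ab) -/V.
set L := ((b ^+ m - a ^+ m) * V)%R.
have V0 : (0 <= V)%R by exact: sector_volume_ge0.
have L0 : (0 <= L)%R.
  rewrite mulr_ge0// subr_ge0; apply: lerXn2r => //; rewrite nnegrE ltW//.
  exact: lt_le_trans ab.
have bnd q : (1 < q)%R -> (q ^- m * L)%:E <= nu (ring_sector `[a, b[ B) /\
    nu (ring_sector `[a, b[ B) <= (q ^+ m * L)%:E.
  move=> q1; have [n bn] := le_exp2_archi (b / a) q1.
  apply: (nu_shell_bisect (n := n)) => //; first exact: ltW.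
  by rewrite mulrC -ler_pdivrMr.
have fin : nu (ring_sector `[a, b[ B) \is a fin_num.
  have [l u] := bnd 2%R (ltr1n _ 2).
  by rewrite ge0_fin_numE ?inv_density_ge0//; exact: le_lt_trans u (ltry _).
rewrite -(fineK fin); congr EFin; apply/le_anti/andP; split.
  apply: (@le_of_le_expX _ m) => // q q1.
  by rewrite -lee_fin fineK//; have [] := bnd q q1.
apply: (@le_of_le_expX _ m); first exact: fine_ge0.
move=> q q1; rewrite -ler_pdivrMl ?exprn_gt0 ?(lt_trans ltr01)//.
by rewrite -lee_fin fineK//; have [] := bnd q q1.
Qed.

End FixedDirections.
End SphereInversion.

(** * From shells to all measurable sets *)

Section InversionChangeOfVariables.
Context {R : realType} {m : nat} (m_gt0 : (0 < m)%N).
Notation mR := (measurableTypeR R).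
Notation Rm := 'rV[R]_m.
Notation T := (m.-tuple mR).
Local Open Scope ereal_scope.

Let t0 : T := tuple_of_row 0%R.

Lemma enorm0 : enorm (0 : Rm) = 0%R.
Proof. by rewrite /enorm big1 ?sqrtr0// => i _; rewrite mxE expr0n. Qed.

Lemma enorm_eq0 (x : Rm) : (enorm x == 0%R) = (x == 0%R).
Proof.
apply/eqP/eqP => [x0|->]; last exact: enorm0.
apply/rowP => i; rewrite mxE; apply/eqP; rewrite -normr_le0 -x0.
exact: abs_coord_le_enorm.
Qed.

Definition origin_if (e : bool) : set T := if e then [set t0] else set0.

(** A generating class closed under intersection. Shells with positive inner radius miss the origin,
    so an optional origin is part of the class. *)
Definition shells : set (set T) := [set E | exists a b B e,
  [/\ (0 < a)%R, measurable B & E = ring_sector `[a, b[ B `|` origin_if e]].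

Lemma measurable_origin e : measurable (origin_if e).
Proof.
case: e => //=; rewrite (_ : [set t0] = (fun t : T => enorm (row_of_tuple t)) @^-1` [set 0%R]).
  by rewrite -[X in measurable X]setTI; apply: measurable_enorm.
apply/seteqP; split => t /=; first by move=> ->; rewrite tuple_of_rowK enorm0.
by move=> /eqP; rewrite enorm_eq0 => /eqP t00; rewrite -[t]row_of_tupleK t00.
Qed.

Lemma shells_setI : setI_closed shells.
Proof.
move=> _ _ [a [b [B [e [a0 mB ->]]]]] [a' [b' [B' [e' [a'0 mB' ->]]]]].
exists (Num.max a a'), (Num.min b b'), (B `&` B'), (e && e'); split.
- by rewrite lt_max a0.
- exact: measurableI.
have S0 (c d : R) C : (0 < c)%R -> ~ ring_sector `[c, d[ C t0.
  by move=> c0 []; rewrite in_itv /= tuple_of_rowK enorm0 leNgt c0.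
have Oe c t : origin_if c t -> t = t0 /\ c by case: c.
apply/seteqP; split => t.
  move=> [H1 H2]; case: H1 => [h1|/Oe[E he]]; case: H2 => [h2|/Oe[E' he']].
  - case: h1; case: h2; rewrite !in_itv /= => /andP[? ?] B't /andP[? ?] Bt; left; split => //.
    by rewrite in_itv /= ge_max lt_min; apply/andP; split; apply/andP.
  - by case: (S0 a b B a0); rewrite -E'.
  - by case: (S0 a' b' B' a'0); rewrite -E.
  - by right; rewrite E he he'.
move=> [[]|/Oe[-> /andP[he he']]]; last by rewrite he he'; split; right.
rewrite in_itv /= ge_max lt_min => /andP[/andP[? ?] /andP[? ?]] [? ?].
by split; left; split => //; rewrite in_itv /=; apply/andP.
Qed.

(** Relative to the sigma-algebra generated by the shells, the norm and the radial projection are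
    measurable. Hence so is the identity, because every t, the origin included, is its norm times
    its radial projection. *)
Lemma shells_generate : @measurable _ T = <<s shells >>.
Proof.
apply/seteqP; split => [A mA|]; last first.
  apply: smallest_sub; first exact: sigma_algebra_measurable.
  move=> _ [a [b [B [e [a0 mB ->]]]]]; apply: measurableU; last exact: measurable_origin.
  exact: measurable_ring_sector.
pose T' := g_sigma_algebraType shells.
have morig : @measurable _ T' [set t0].
  apply: sub_sigma_algebra; exists 1%R, 1%R, setT, true; split => //.
  by apply/seteqP; split => t /=; [right|move=> [[]|//]; rewrite in_itv /= => /andP[/le_lt_trans h /h]; rewrite ltxx].
have msec (a : R) (b : nat -> R) B : (0 < a)%R -> measurable B -> forall n,
    @measurable _ T' (ring_sector `[a, b n[ B).
  move=> a0 mB n; apply: sub_sigma_algebra; exists a, (b n), B, false; split => //.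
  by rewrite setU0.
have mn : measurable_fun setT ((fun t => enorm (row_of_tuple t)) : T' -> mR).
  apply: (measurability _ (RGenCInfty.measurableE R)) => //.
  move=> _ [_ [a ->] <-]; rewrite setTI.
  have [a0|a0] := leP a 0%R.
    rewrite (_ : _ @^-1` _ = setT)//; apply/seteqP; split => t //= _.
    by rewrite in_itv /= andbT (le_trans a0)// sqrtr_ge0.
  rewrite (_ : _ @^-1` _ = \bigcup_n ring_sector `[a, n%:R[ setT).
    by apply: bigcupT_measurable => n; exact: (msec a (fun n => n%:R)).
  apply/seteqP; split => t /=; rewrite in_itv /= andbT.
    move=> at_; exists (Num.bound (enorm (row_of_tuple t))) => //; split => //.
    by rewrite in_itv /= at_ archi_boundP// sqrtr_ge0.
  by move=> [n _ []]; rewrite in_itv /= => /andP[].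
have mr : measurable_fun setT (@radial R m : T' -> T).
  move=> _ B mB; rewrite setTI.
  (* Away from the origin the preimage of [B] is exhausted by shells; the origin belongs to it or
     not according to its own image. *)
  rewrite (_ : _ @^-1` _ = (\bigcup_n ring_sector `[(n.+1%:R^-1)%R, n%:R[ B) `|`
      (if radial t0 \in B then [set t0] else set0)).
    apply: measurableU; last by case: ifP.
    apply: bigcupT_measurable => n; apply: (msec _ (fun n => n%:R)) => //.
  apply/seteqP; split => t /=.
    move=> Bt; have [tt0|tn0] := eqVneq (enorm (row_of_tuple t)) 0%R.
      right; have -> : t = t0.
        by move/eqP: tt0; rewrite enorm_eq0 => /eqP E; rewrite -[t]row_of_tupleK E.
      rewrite ifT// inE; move: Bt; congr (B _); congr radial.
      by move/eqP: tt0; rewrite enorm_eq0 => /eqP E; rewrite -[t]row_of_tupleK E.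
    left; have tp : (0 < enorm (row_of_tuple t))%R by rewrite lt_neqAle eq_sym tn0 sqrtr_ge0.
    pose n1 := Num.bound (enorm (row_of_tuple t)).
    pose n2 := Num.bound (enorm (row_of_tuple t))^-1%R.
    have h1 : (enorm (row_of_tuple t) < n1%:R)%R by rewrite archi_boundP// ltW.
    have h2 : ((enorm (row_of_tuple t))^-1 < n2%:R)%R by rewrite archi_boundP// invr_ge0 ltW.
    exists (n1 + n2)%N => //; split => //; rewrite in_itv /=; apply/andP; split.
      rewrite invf_ple ?posrE//; apply: (le_trans (ltW h2)); rewrite ler_nat.
      by rewrite (leq_trans (leq_addl n1 n2)).
    by apply: (lt_le_trans h1); rewrite ler_nat leq_addr.
  move=> [[n _ []//]|]; case: ifPn => // /[!inE] ? ->//.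
have mid : measurable_fun setT (fun t : T' => tuple_of_row (enorm (row_of_tuple t) *: row_of_tuple (radial t))%R).
  apply: measurable_rowP; apply: measurable_rowZ => //.
  exact: (measurable_row_comp (@measurable_row_of_tuple R m) mr).
have idE : (fun t : T' => tuple_of_row (enorm (row_of_tuple t) *: row_of_tuple (radial t))%R) = id.
  apply/funext => t; apply: (can_inj (@row_of_tupleK R m)); rewrite tuple_of_rowK row_of_tuple_radial scalerA.
  have [tt0|tn0] := eqVneq (enorm (row_of_tuple t)) 0%R; last by rewrite mulfV// scale1r.
  rewrite tt0 mul0r scale0r; apply/esym/eqP; rewrite -enorm_eq0; exact/eqP.
have := mid measurableT _ mA; rewrite idE setTI preimage_id.
by [].
Qed.

Local Notation pushm mu mf :=
  (measure_function_pushforward__canonical__measure_function_Measure mu mf).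

Lemma tuple_inv_origin : tuple_inv @^-1` [set t0] = [set t0].
Proof.
apply/seteqP; split => t /=.
  move=> /(congr1 (fun t : T => enorm (row_of_tuple t))).
  rewrite !tuple_of_rowK enorm_sphere_inv enorm0 => /eqP; rewrite invr_eq0 enorm_eq0 => /eqP E.
  by rewrite -[t]row_of_tupleK E.
move=> ->; rewrite /tuple_inv tuple_of_rowK /sphere_inv scaler0.
by [].
Qed.

(** For m > 0 the density at the origin is the inverse of 0, which is 0 by convention. *)
Lemma inv_density_origin : inv_density [set t0] = 0.
Proof.
apply: integral0_eq => t /= ->; rewrite /inv_jacobian tuple_of_rowK enorm0 expr0n.
by rewrite muln_eq0 /= -leqn0 leqNgt m_gt0 /= invr0.
Qed.

Lemma pushforward_inv_density (A : set T) : measurable A ->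
  inv_density (tuple_inv @^-1` A) = lebesgue m A.
Proof.
move=> mA; apply/esym.
pose m2 := pushm (@inv_density R m) (@measurable_tuple_inv R m).
have Oe (a b : R) B e : (0 < a)%R -> ring_sector `[a, b[ B `&` origin_if e = set0.
  move=> a0; case: e => /=; last by rewrite setI0.
  apply/seteqP; split => t //= [[]]; rewrite in_itv /= => /andP[+ _] _ tt0.
  by rewrite tt0 tuple_of_rowK enorm0 leNgt a0.
have l0 e : lebesgue m (origin_if e) = 0.
  by case: e => /=; [exact: lebesgue_set1|exact: measure0].
have lE (a b : R) B e : (0 < a)%R -> measurable B ->
    lebesgue m (ring_sector `[a, b[ B `|` origin_if e) = lebesgue m (ring_sector `[a, b[ B).
  move=> a0 mB.
  transitivity (lebesgue m (ring_sector `[a, b[ B) + lebesgue m (origin_if e)).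
    by apply: measureU; [exact: measurable_ring_sector|exact: measurable_origin|exact: Oe].
  by rewrite l0 adde0.
have n0 e : m2 (origin_if e) = 0.
  case: e; last exact: measure0.
  by rewrite /m2 /= /pushforward tuple_inv_origin inv_density_origin.
have nE (a b : R) B e : (0 < a)%R -> measurable B ->
    m2 (ring_sector `[a, b[ B `|` origin_if e) = m2 (ring_sector `[a, b[ B).
  move=> a0 mB; transitivity (m2 (ring_sector `[a, b[ B) + m2 (origin_if e)).
    by apply: measureU; [exact: measurable_ring_sector|exact: measurable_origin|exact: Oe].
  by rewrite n0 adde0.
(* An exhaustion of the space by members of the class with finite volume, as the uniqueness theorem
   for measures demands. *)
pose g (n : nat) : set T := ring_sector `[(n.+1%:R^-1)%R, n.+1%:R[ setT `|` origin_if true.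
apply: (@measure_unique _ _ _ shells g shells_generate shells_setI _ _ (lebesgue m) m2) => //.
- by move=> n; exists (n.+1%:R^-1)%R, n.+1%:R, setT, true; split => //; rewrite invr_gt0.
- apply/seteqP; split => t // _.
  have [tt0|tn0] := eqVneq (enorm (row_of_tuple t)) 0%R.
    exists 0%N => //; right => /=.
    by move/eqP: tt0; rewrite enorm_eq0 => /eqP E; rewrite -[t]row_of_tupleK E.
  have tp : (0 < enorm (row_of_tuple t))%R by rewrite lt_neqAle eq_sym tn0 sqrtr_ge0.
  pose n1 := Num.bound (enorm (row_of_tuple t)).
  pose n2 := Num.bound (enorm (row_of_tuple t))^-1%R.
  have h1 : (enorm (row_of_tuple t) < n1%:R)%R by rewrite archi_boundP// ltW.
  have h2 : ((enorm (row_of_tuple t))^-1 < n2%:R)%R by rewrite archi_boundP// invr_ge0 ltW.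
  exists (n1 + n2)%N => //; left; split => //; rewrite in_itv /=; apply/andP; split.
    rewrite invf_ple ?posrE//; apply: (le_trans (ltW h2)); rewrite ler_nat.
    by rewrite (leq_trans (leq_addl n1 n2)).
  by apply: (lt_le_trans h1); rewrite ler_nat (leq_trans (leq_addr n2 n1)).
- move=> _ [a [b [B [e [a0 mB ->]]]]].
  apply: etrans (lE a b B e a0 mB) (etrans _ (esym (nE a b B e a0 mB))).
  have [ab|ba] := leP a b; first by rewrite /m2 /= /pushforward -(nu_shell mB a0 ab).
  have -> : ring_sector `[a, b[ B = set0 :> set T.
    apply/seteqP; split => t // []; rewrite in_itv /= => /andP[h1 h2].
    by have := lt_trans (le_lt_trans h1 h2) ba; rewrite ltxx.
  by rewrite !measure0.
- move=> n; have n10 : (0 < n.+1%:R^-1 :> R)%R by rewrite invr_gt0.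
  have H : lebesgue m (g n) < +oo.
    rewrite lE// lebesgue_ring_cobnd ?ltry//.
    by apply: (@le_trans _ _ 1%R); [rewrite invf_le1 ?ler1n|rewrite ler1n].
  exact: H.
Qed.

Lemma cov_sphere_inv : cov (@lebesgue R m) sphere_inv inv_jacobian.
Proof.
have mI : measurable_row (fun t : T => sphere_inv (row_of_tuple t)).
  by apply: measurable_row_sphere_inv; exact: measurable_row_of_tuple.
split => //; [exact: measurable_inv_jacobian|exact: inv_jacobian_ge0|].
move=> h mh h0.
rewrite -[RHS](@ge0_integral_density _ _ T T R (lebesgue m) (lebesgue m) (@tuple_inv R m)
  (fun t => inv_jacobian (row_of_tuple t)) _ _ _ _ (fun t => h (row_of_tuple t))) //.
- by apply: eq_integral => t _; rewrite /tuple_inv tuple_of_rowK.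
- exact: measurable_tuple_inv.
- exact: measurable_inv_jacobian.
- by move=> t; exact: inv_jacobian_ge0.
move=> A mA; transitivity (inv_density (tuple_inv @^-1` A)); last exact: pushforward_inv_density.
rewrite inv_densityE.
  by apply: eq_integral => t _; rewrite !indicE; congr ((nat_of_bool _)%:R * _)%R%:E; apply/idP/idP; rewrite !inE.
by rewrite -[X in measurable X]setTI; exact: measurable_tuple_inv.
Qed.

End InversionChangeOfVariables.

(** * Integrals of complex and Clifford valued functions *)

Section SignedChangeOfVariables.
Context d (S : measurableType d) {R : realType} (mu : {measure set S -> \bar R}).

(** Stated for all extended reals: [fine] sends both infinities to 0, so the rule survives an
    undetermined difference of two infinite parts. *)
Lemma fine_sube_mull (k : R) (a b : \bar R) : 0 <= k ->
  fine (k%:E * a - k%:E * b)%E = k * fine (a - b)%E.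
Proof.
rewrite le_eqVlt => /predU1P[<-|k0]; first by rewrite !mul0e sube0 mul0r.
by case: a => [a||]; case: b => [b||] //=; rewrite ?gt0_muley ?gt0_muleNy ?lte_fin//= ?mulr0// mulrBr.
Qed.

Lemma fine_sube_swap (a b : \bar R) : fine (b - a)%E = - fine (a - b)%E.
Proof. by case: a => [a||]; case: b => [b||] //=; rewrite ?oppr0// opprB. Qed.

(** A negative factor exchanges the positive and negative parts, which costs a sign even when both
    are infinite. Thus measurability is enough, and the rule applies to the outer integrals. *)
Lemma Rintegral_mull (k : R) (f : S -> R) : measurable_fun setT f ->
  (\int[mu]_x (k * f x) = k * \int[mu]_x f x)%R.
Proof.
move=> mf.
have mE : measurable_fun setT (fun x => (f x)%:E) by exact/measurable_EFinP.
rewrite /Rintegral; under eq_integral do rewrite EFinM.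
rewrite [X in fine X]integralE [in RHS]integralE.
have mp := measurable_funepos mE; have mn := measurable_funeneg mE.
have [k0|k0] := leP 0 k.
  rewrite (ge0_funeposM (fun x => (f x)%:E) k0) (ge0_funenegM (fun x => (f x)%:E) k0).
  by rewrite !ge0_integralZl_EFin//; exact: fine_sube_mull.
rewrite (le0_funeposM (fun x => (f x)%:E) (ltW k0)) (le0_funenegM (fun x => (f x)%:E) (ltW k0)).
have k0' : 0 <= - k by rewrite oppr_ge0 ltW.
by rewrite !ge0_integralZl_EFin// fine_sube_mull// fine_sube_swap mulrNN.
Qed.

End SignedChangeOfVariables.

Section RowIntegrals.
Context {R : realType} {m : nat}.
Notation mR := (measurableTypeR R).
Notation Rm := 'rV[R]_m.
Notation T := (m.-tuple mR).
Implicit Types mu : {measure set T -> \bar R}.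

(** The density is nonnegative, so it commutes with taking positive and negative parts, and each
    part obeys the rule for nonnegative functions. *)
Lemma cov_Rintegral mu (phi : Rm -> Rm) (rho g : Rm -> R) :
  cov mu phi rho -> measurable_on_row (g : Rm -> mR) ->
  (\int[mu]_t (g (phi (row_of_tuple t)) * rho (row_of_tuple t)) =
   \int[mu]_t g (row_of_tuple t))%R.
Proof.
move=> [mphi mrho rho0 H] mg; rewrite /Rintegral; congr fine.
rewrite [LHS]integralE [RHS]integralE.
pose G x := (g x)%:E.
have mG : measurable_fun setT (fun t : T => (g (row_of_tuple t))%:E) by exact/measurable_EFinP.
congr (_ - _)%E.
  have E := H (fun x => (Num.max (g x) 0)%:E).
  transitivity (\int[mu]_t ((Num.max (g (phi (row_of_tuple t))) 0)%:E * (rho (row_of_tuple t))%:E))%E.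
    apply: eq_integral => t _; rewrite funeposE -EFin_max -EFinM; congr EFin.
    by rewrite maxr_pMl// mul0r.
  rewrite E.
  - by apply: eq_integral => t _; rewrite funeposE -EFin_max.
  - by apply/measurable_EFinP; apply: measurable_maxr.
  - by move=> x; rewrite lee_fin le_max lexx orbT.
have E := H (fun x => (Num.max (- g x) 0)%:E).
transitivity (\int[mu]_t ((Num.max (- g (phi (row_of_tuple t))) 0)%:E * (rho (row_of_tuple t))%:E))%E.
  apply: eq_integral => t _; rewrite funenegE -EFinN -EFin_max -EFinM; congr EFin.
  by rewrite maxr_pMl// mul0r mulNr.
rewrite E.
- by apply: eq_integral => t _; rewrite funenegE -EFinN -EFin_max.
- by apply/measurable_EFinP; apply: measurable_maxr => //; exact: measurableT_comp.
- by move=> x; rewrite lee_fin le_max lexx orbT.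
Qed.

Lemma lebesgue_isometry_preimage (L L' : Rm -> Rm) A :
  (forall x y, L (x + y) = L x + L y) -> (forall k x, L (k *: x) = k *: L x) ->
  (forall x, enorm (L x) = enorm x) -> cancel L' L -> measurable A ->
  lebesgue m [set t : T | A (tuple_of_row (L (row_of_tuple t)))] = lebesgue m A.
Proof.
move=> LD LZ LN LK mA; have [mL _ _ H] := cov_isometry LD LZ LN LK.
have mpre : measurable [set t : T | A (tuple_of_row (L (row_of_tuple t)))].
  by rewrite -[X in measurable X]setTI; apply: (measurable_rowP mL).
rewrite -(integral_indic_row mA) -(integral_indic_row mpre).
rewrite -(H (fun x => (\1_A (tuple_of_row x))%:E)).
- by apply: eq_integral => t _; rewrite mule1 !indicE row_of_tupleK; congr ((nat_of_bool _)%:R%:E);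
    apply/idP/idP; rewrite !inE.
- by rewrite /measurable_on_row; apply/measurable_EFinP; under eq_fun do rewrite row_of_tupleK;
    exact: measurable_indic.
- by move=> x; rewrite lee_fin.
Qed.

(** A linear isometry commutes with [radial], preserves the punctured ball and preserves Lebesgue
    measure, from which the surface measure is made. *)
Lemma cov_sphere_isometry (L L' : Rm -> Rm) :
  (forall x y, L (x + y) = L x + L y) -> (forall k x, L (k *: x) = k *: L x) ->
  (forall x, enorm (L x) = enorm x) -> cancel L' L ->
  cov (@sphere_measure R m) L (fun _ => 1).
Proof.
move=> LD LZ LN LK; have [mL _ _ _] := cov_isometry LD LZ LN LK.
split => //; first exact: measurable_cst.
move=> h mh h0.
pose phi (t : T) := tuple_of_row (L (row_of_tuple t)).
have mphi : measurable_fun setT phi by exact: measurable_rowP.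
have H A : measurable A ->
    (\int[@sphere_measure R m]_t (\1_A (phi t) * 1%R)%:E = @sphere_measure R m A)%E.
  move=> mA; have mpA : measurable (phi @^-1` A) by rewrite -[X in measurable X]setTI; exact: mphi.
  transitivity (@sphere_measure R m (phi @^-1` A)).
    rewrite -[in RHS](setIT (phi @^-1` A)) -integral_indic//.
    by apply: eq_integral => t _; rewrite mulr1 !indicE; congr ((nat_of_bool _)%:R%:E);
      apply/idP/idP; rewrite !inE.
  rewrite /sphere_measure /= /mscale /= /radial_pushforward /pushforward /mrestr; congr (_ * _)%E.
  have mS : measurable (@radial R m @^-1` A `&` @punctured_ball R m).
    apply: measurableI; last exact: measurable_punctured_ball.
    by rewrite -[X in measurable X]setTI; exact: measurable_radial.
  rewrite -(lebesgue_isometry_preimage LD LZ LN LK mS); congr (lebesgue m _).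
  have radL t : radial (phi t) = phi (radial t).
    apply: (can_inj (@row_of_tupleK R m)).
    by rewrite row_of_tuple_radial !tuple_of_rowK row_of_tuple_radial LN LZ.
  have pbL t : punctured_ball (phi t) = punctured_ball t.
    by rewrite /punctured_ball /= tuple_of_rowK LN.
  by apply/seteqP; split => t /=; rewrite -/(phi t) radL pbL.
have := @ge0_integral_density _ _ T T R _ (@sphere_measure R m) phi (fun=> 1%R) mphi
  (measurable_cst _) (fun=> ler01) H (fun t => h (row_of_tuple t)) mh (fun t => h0 _).
move=> <-; apply: eq_integral => t _; rewrite /phi tuple_of_rowK.
by [].
Qed.

Lemma sphere_measure_lty : (@sphere_measure R m setT < +oo)%E.
Proof.
rewrite /sphere_measure /= /mscale /= /radial_pushforward /pushforward /mrestr preimage_setT setTI.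
rewrite lte_mul_pinfty// ?lee_fin//.
apply: le_lt_trans (@lebesgue_uball_lty R m); apply: le_measure; rewrite ?inE.
- exact: measurable_punctured_ball.
- exact: measurable_uball.
- by move=> t /= /andP[].
Qed.

(** The surface measure is finite and carried by the image of the punctured ball under [radial],
    which lies in the closed unit ball. *)
Lemma sphere_integrable_bounded (f : Rm -> R) (M : R) :
  measurable_on_row (f : Rm -> mR) -> (forall x, enorm x <= 1 -> `|f x| <= M) ->
  (@sphere_measure R m).-integrable setT (fun t => (f (row_of_tuple t))%:E).
Proof.
move=> mf fM.
have mu := @measurable_uball R m.
apply/(@negligible_integrable _ _ _ (@sphere_measure R m) setT (~` @uball R m)) => //.
- exact: measurableC.
- exact/measurable_EFinP.
- rewrite /sphere_measure /= /mscale /= /radial_pushforward /pushforward /mrestr.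
  rewrite (_ : _ `&` _ = set0) ?measure0 ?mule0//.
  apply/seteqP; split => t //= [+ /andP[t0 t1]]; apply.
  rewrite /uball /= row_of_tuple_radial enormZ normfV gtr0_norm// mulVf//.
  by rewrite gt_eqF.
rewrite setTD setCK; apply: (@measurable_bounded_integrable _ _ _ _ (fun t => f (row_of_tuple t))) => //.
- apply: le_lt_trans sphere_measure_lty; apply: le_measure; rewrite ?inE//.
- exact: measurable_funTS.
exists M; split; first exact: num_real.
by move=> x Mx t /fM h; apply: (le_trans h); exact: ltW.
Qed.

End RowIntegrals.

(** * Closure properties of classes of real, complex and Clifford valued functions *)

Section FunctionSubalgebra.
Context {R : realType} {m : nat}.
Notation Rm := 'rV[R]_m.
Notation Cl := (cliff R[i] m).

(** Measurable functions in one or two variables and functions bounded on the ball are all of this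
    kind, so the passage to complex and Clifford coefficients is made once for all of them. *)
Definition subalgebra (S : Type) (P : (S -> R) -> Prop) :=
  [/\ forall k, P (fun=> k), forall f g, P f -> P g -> P (fun x => f x + g x) &
      forall f g, P f -> P g -> P (fun x => f x * g x)].

Definition cplx_in (S : Type) (P : (S -> R) -> Prop) (f : S -> R[i]) :=
  P (fun x => complex.Re (f x)) /\ P (fun x => complex.Im (f x)).

Definition cliff_in (S : Type) (P : (S -> R) -> Prop) (f : S -> Cl) :=
  forall A, cplx_in P (fun x => f x A).

Context (S : Type) (P : (S -> R) -> Prop) (PP : subalgebra P).

Lemma subalgebraN f : P f -> P (fun x => - f x).
Proof.
case: PP => Pc _ PM Pf; rewrite (_ : (fun x => _) = (fun x => -1 * f x)); first exact: PM.
by apply/funext => x; rewrite mulN1r.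
Qed.

Lemma subalgebra_sum (I : Type) (r : seq I) (Q : pred I) (F : I -> S -> R) :
  (forall i, P (F i)) -> P (fun x => \sum_(i <- r | Q i) F i x).
Proof.
case: PP => Pc PD _ PF; elim: r => [|i r IH].
  by under eq_fun do rewrite big_nil; exact: Pc.
under eq_fun do rewrite big_cons.
by case: (Q i) => //; exact: PD.
Qed.

Lemma subalgebraX f n : P f -> P (fun x => f x ^+ n).
Proof.
case: PP => Pc _ PM Pf; elim: n => [|n IH]; first exact: Pc.
by under eq_fun do rewrite exprS; exact: PM.
Qed.

Lemma cplx_in_cst z : cplx_in P (fun=> z).
Proof. by case: PP => Pc _ _; split; exact: Pc. Qed.

Lemma cplx_inD f g : cplx_in P f -> cplx_in P g -> cplx_in P (fun x => f x + g x).
Proof.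
case: PP => _ PD _ [f1 f2] [g1 g2]; split.
  by under eq_fun do rewrite raddfD; exact: PD.
by under eq_fun do rewrite raddfD; exact: PD.
Qed.

Lemma ReM (a b : R[i]) : complex.Re (a * b) = complex.Re a * complex.Re b - complex.Im a * complex.Im b.
Proof. by case: a b => [? ?] [? ?]. Qed.

Lemma ImM (a b : R[i]) : complex.Im (a * b) = complex.Re a * complex.Im b + complex.Im a * complex.Re b.
Proof. by case: a b => [? ?] [? ?]. Qed.

Lemma cplx_inM f g : cplx_in P f -> cplx_in P g -> cplx_in P (fun x => f x * g x).
Proof.
case: PP => _ PD PM [f1 f2] [g1 g2]; split.
  under eq_fun do rewrite ReM.
  by apply: (PD (fun x => _) (fun x => - _)); [exact: PM|apply: subalgebraN; exact: PM].
under eq_fun do rewrite ImM.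
by apply: PD; exact: PM.
Qed.

Lemma cplx_in_conj f : cplx_in P f -> cplx_in P (fun x => (f x)^*%C).
Proof.
move=> [f1 f2]; split.
  by rewrite (_ : (fun x => _) = (fun x => complex.Re (f x)))//; apply/funext => x; case: (f x).
rewrite (_ : (fun x => _) = (fun x => - complex.Im (f x))); first exact: subalgebraN.
by apply/funext => x; case: (f x).
Qed.

Lemma cplx_in_real f : P f -> cplx_in P (fun x => (f x)%:C%C).
Proof. by case: PP => Pc _ _ Pf; split => //=; exact: Pc. Qed.

Lemma cplx_in_sum (I : Type) (r : seq I) (Q : pred I) (F : I -> S -> R[i]) :
  (forall i, cplx_in P (F i)) -> cplx_in P (fun x => \sum_(i <- r | Q i) F i x).
Proof.
move=> PF; elim: r => [|i r IH].
  by under eq_fun do rewrite big_nil; exact: cplx_in_cst.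
under eq_fun do rewrite big_cons.
by case: (Q i) => //; exact: cplx_inD.
Qed.

Lemma cliff_in_cst z : cliff_in P (fun=> z).
Proof. by move=> A; exact: cplx_in_cst. Qed.

Lemma cliff_inD f g : cliff_in P f -> cliff_in P g -> cliff_in P (fun x => f x + g x).
Proof. by move=> Pf Pg A; under eq_fun do rewrite ffunE; exact: cplx_inD. Qed.

Lemma cliff_inM f g : cliff_in P f -> cliff_in P g -> cliff_in P (fun x => f x * g x).
Proof.
move=> Pf Pg A; rewrite (_ : (fun x => _) =
  (fun x => \sum_B (csign B (Defs.setSD B A) * f x B * g x (Defs.setSD B A)))); last first.
  by apply/funext => x; rewrite cliffME.
apply: cplx_in_sum => B; apply: cplx_inM => //; apply: cplx_inM => //; exact: cplx_in_cst.
Qed.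

Lemma cliff_inZ (f : S -> R[i]) g : cplx_in P f -> cliff_in P g -> cliff_in P (fun x => f x *: g x).
Proof. by move=> Pf Pg A; under eq_fun do rewrite ffunE; exact: cplx_inM. Qed.

Lemma cliff_in_conj f : cliff_in P f -> cliff_in P (fun x => cbar (f x)).
Proof.
move=> Pf A; rewrite (_ : (fun x => _) =
  (fun x => (-1) ^+ 'C(#|A|.+1, 2) * (f x A)^*%C)); last first.
  by apply/funext => x; rewrite cbarE ffunE.
by apply: cplx_inM; [exact: cplx_in_cst|exact: cplx_in_conj].
Qed.

Lemma cliff_in_rev f : cliff_in P f -> cliff_in P (fun x => crev (f x)).
Proof.
move=> Pf A; rewrite (_ : (fun x => _) =
  (fun x => (-1) ^+ 'C(#|A|, 2) * (f x A))); last first.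
  by apply/funext => x; rewrite crevE ffunE.
by apply: cplx_inM; [exact: cplx_in_cst|exact: Pf].
Qed.

Lemma cliff_in_sum (I : Type) (r : seq I) (Q : pred I) (F : I -> S -> Cl) :
  (forall i, cliff_in P (F i)) -> cliff_in P (fun x => \sum_(i <- r | Q i) F i x).
Proof.
move=> PF; elim: r => [|i r IH].
  by under eq_fun do rewrite big_nil; exact: cliff_in_cst.
under eq_fun do rewrite big_cons.
by case: (Q i) => //; exact: cliff_inD.
Qed.

Lemma cliff_in_vec (f : S -> Rm) : (forall i, P (fun x => f x 0 i)) ->
  cliff_in P (fun x => vec (f x)).
Proof.
move=> Pf; under eq_fun do rewrite vecE /cvec.
apply: cliff_in_sum => i; apply: cliff_inZ; last exact: cliff_in_cst.
exact: cplx_in_real.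
Qed.

Lemma in_vec_part (f : S -> Cl) : cliff_in P f -> forall i, P (fun x => vec_part (f x) 0 i).
Proof. by move=> Pf i; under eq_fun do rewrite mxE; have [] := Pf [set i]%SET. Qed.

(** A degree bound uniform in x turns the evaluation into a finite sum over an index set that does
    not depend on x. *)
Lemma in_eval_cplx n (p : S -> mpoly m R[i]) (f : S -> Rm) :
  (forall x, msize (p x) <= n)%N -> (forall al, cplx_in P (fun x => mcoeff al (p x))) ->
  (forall i, P (fun x => f x 0 i)) -> cplx_in P (fun x => eval_cplx (p x) (f x)).
Proof.
move=> pn Pp Pf; rewrite (_ : (fun x => _) = (fun x =>
   \sum_(al : bmultinom m n) mcoeff al (p x) * (\prod_i (f x 0 i) ^+ al i)%:C%C)); last first.
  apply/funext => x; rewrite /eval_cplx /meval ((mmapE _ (pn x))).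
  apply: eq_bigr => al _; congr (_ * _); rewrite /mmap1 rmorph_prod.
  by apply: eq_bigr => i _; rewrite rmorphXn.
apply: cplx_in_sum => al; apply: cplx_inM => //; apply: cplx_in_real.
case: PP => Pc _ PM; elim: (index_enum _) => [|i r IH].
  by under eq_fun do rewrite big_nil; exact: Pc.
by under eq_fun do rewrite big_cons; apply: PM => //; exact: subalgebraX.
Qed.

Lemma in_eval_cliff n (p : S -> mpoly m Cl) (f : S -> Rm) :
  (forall x, msize (p x) <= n)%N -> (forall al, cliff_in P (fun x => mcoeff al (p x))) ->
  (forall i, P (fun x => f x 0 i)) -> cliff_in P (fun x => eval_cliff (p x) (f x)).
Proof.
move=> pn Pp Pf; rewrite (_ : (fun x => _) = (fun x =>
   \sum_(al : bmultinom m n) (\prod_i (f x 0 i) ^+ al i)%:C%C *: mcoeff al (p x))); last first.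
  apply/funext => x; rewrite /eval_cliff /meval ((mmapE _ (pn x))).
  apply: eq_bigr => al _; rewrite /mmap1.
  rewrite (_ : \prod_i _ = (\prod_i ((f x 0 i)%:C%C) ^+ al i)%:A :> Cl).
    by rewrite -scalerAr mulr1 rmorph_prod; congr (_ *: _); apply: eq_bigr => i _; rewrite rmorphXn.
  rewrite (big_morph (fun z => z%:A : Cl) (id1 := 1) (op1 := *%R)).
  - by apply: eq_bigr => i _; elim: (al i : nat) => [|k IH]; rewrite ?expr0 ?scale1r// !exprS IH -scalerAl mul1r scalerA.
  - by move=> a b; rewrite -scalerAl mul1r scalerA.
  - by rewrite scale1r.
apply: cliff_in_sum => al; apply: cliff_inZ => //; apply: cplx_in_real.
case: PP => Pc _ PM; elim: (index_enum _) => [|i r IH].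
  by under eq_fun do rewrite big_nil; exact: Pc.
by under eq_fun do rewrite big_cons; apply: PM => //; exact: subalgebraX.
Qed.

End FunctionSubalgebra.

(** * Linearity, conjugation and substitution for complex and Clifford valued integrals *)

Section ComplexIntegrals.
Context {R : realType} {m : nat}.
Notation mR := (measurableTypeR R).
Notation Rm := 'rV[R]_m.
Notation T := (m.-tuple mR).
Notation Cl := (cliff R[i] m).

Definition measurable_real d (S : measurableType d) (f : S -> R) :=
  measurable_fun setT (f : S -> mR).

Definition measurable_on (f : Rm -> R) := measurable_on_row (f : Rm -> mR).

Definition measurable_on2 (f : Rm * Rm -> R) :=
  @measurable_real _ (T * T)%type (fun p => f (row_of_tuple p.1, row_of_tuple p.2)).

Definition integrable_on (mu : {measure set T -> \bar R}) (f : Rm -> R) :=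
  mu.-integrable setT (fun t => (f (row_of_tuple t))%:E).

(** A class closed under products, unlike integrable functions, that still guarantees integrability
    over the sphere. *)
Definition ball_bounded (f : Rm -> R) :=
  measurable_on f /\ exists M, forall x, enorm x <= 1 -> `|f x| <= M.

Lemma subalgebra_measurable_real d (S : measurableType d) : subalgebra (@measurable_real d S).
Proof.
split => [k|f g mf mg|f g mf mg]; first exact: measurable_cst.
  exact: measurable_funD.
exact: measurable_funM.
Qed.

Lemma subalgebra_measurable_on : subalgebra measurable_on.
Proof.
split => [k|f g mf mg|f g mf mg]; first exact: measurable_cst.
  exact: (measurable_funD mf mg).
exact: (measurable_funM mf mg).
Qed.

Lemma subalgebra_ball_bounded : subalgebra ball_bounded.
Proof.
have [mc mD mM] := subalgebra_measurable_on.
split => [k|f g [mf [M fM]] [mg [N gN]]|f g [mf [M fM]] [mg [N gN]]].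
- by split; [exact: mc|exists `|k|].
- split; first exact: mD.
  exists (M + N) => x x1; apply: le_trans (ler_normD _ _) _.
  by rewrite lerD ?fM ?gN.
- split; first exact: mM.
  exists (M * N) => x x1; rewrite normrM.
  by rewrite ler_pM ?fM ?gN.
Qed.

Lemma ball_bounded_coord i : ball_bounded (fun x => x 0 i).
Proof.
split; first exact: measurable_row_of_tuple.
by exists 1 => x; apply: le_trans; exact: abs_coord_le_enorm.
Qed.

Lemma ball_bounded_integrable f : ball_bounded f -> integrable_on (@sphere_measure R m) f.
Proof. by move=> [mf [M fM]]; apply: sphere_integrable_bounded mf fM. Qed.

Lemma integrable_on_measurable mu f : integrable_on mu f -> measurable_on f.
Proof. by move=> /measurable_int/measurable_EFinP. Qed.

Section Linearity.
Variable mu : {measure set T -> \bar R}.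

Lemma integrable_onD f g : integrable_on mu f -> integrable_on mu g ->
  integrable_on mu (fun x => f x + g x).
Proof.
move=> If Ig; have := integrableD measurableT If Ig.
by apply: eq_integrable => // t _; rewrite /= EFinD.
Qed.

Lemma integrable_onZ k f : integrable_on mu f -> integrable_on mu (fun x => k * f x).
Proof.
move=> If; have := integrableZl measurableT k If.
by apply: eq_integrable => // t _; rewrite /= EFinM.
Qed.

Lemma Rintegral_onD f g : integrable_on mu f -> integrable_on mu g ->
  (\int[mu]_t (f (row_of_tuple t) + g (row_of_tuple t)) =
   \int[mu]_t f (row_of_tuple t) + \int[mu]_t g (row_of_tuple t))%R.
Proof. by move=> If Ig; exact: RintegralD. Qed.

(** A real factor acts on the real and imaginary parts separately. A complex factor mixes them and
    requires additivity, hence the integrability in [cplx_integral_mull]. *)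
Lemma cplx_integral_scale (k : R) g : cplx_in measurable_on g ->
  cplx_integral mu (fun x => k%:C%C * g x) = k%:C%C * cplx_integral mu g.
Proof.
move=> [g1 g2]; rewrite /cplx_integral.
rewrite (_ : _ * _ = Complex (k * \int[mu]_t complex.Re (g (row_of_tuple t)))
    (k * \int[mu]_t complex.Im (g (row_of_tuple t)))); last first.
  by rewrite /GRing.mul /= !mul0r subr0 addr0.
rewrite -(Rintegral_mull mu k g1) -(Rintegral_mull mu k g2).
congr Complex; apply: eq_Rintegral => t _.
  by rewrite ReM /= mul0r subr0.
by rewrite ImM /= mul0r addr0.
Qed.

Lemma cplx_integralD f g : cplx_in (integrable_on mu) f -> cplx_in (integrable_on mu) g ->
  cplx_integral mu (fun x => f x + g x) = cplx_integral mu f + cplx_integral mu g.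
Proof.
move=> [f1 f2] [g1 g2]; rewrite /cplx_integral.
rewrite (_ : Complex _ _ + Complex _ _ = Complex
   (\int[mu]_t complex.Re (f (row_of_tuple t)) + \int[mu]_t complex.Re (g (row_of_tuple t)))
   (\int[mu]_t complex.Im (f (row_of_tuple t)) + \int[mu]_t complex.Im (g (row_of_tuple t)))) //.
rewrite -(Rintegral_onD f1 g1) -(Rintegral_onD f2 g2).
by congr Complex; apply: eq_Rintegral => t _; rewrite raddfD.
Qed.

Lemma cplx_integral_mull z g : cplx_in (integrable_on mu) g ->
  cplx_integral mu (fun x => z * g x) = z * cplx_integral mu g.
Proof.
move=> [g1 g2]; case: z => a b; rewrite /cplx_integral.
set I1 := \int[mu]_t complex.Re (g _); set I2 := \int[mu]_t complex.Im (g _).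
have m1 := integrable_on_measurable g1; have m2 := integrable_on_measurable g2.
rewrite (_ : _ * _ = Complex (a * I1 - b * I2) (a * I2 + b * I1)) //.
congr Complex.
  rewrite -mulNr -(Rintegral_mull mu a m1) -(Rintegral_mull mu (- b) m2).
  rewrite -(Rintegral_onD (integrable_onZ a g1) (integrable_onZ (- b) g2)).
  by apply: eq_Rintegral => t _; rewrite ReM /= mulNr.
rewrite -(Rintegral_mull mu a m2) -(Rintegral_mull mu b m1).
rewrite -(Rintegral_onD (integrable_onZ a g2) (integrable_onZ b g1)).
by apply: eq_Rintegral => t _; rewrite ImM /=.
Qed.

Lemma cplx_inZ_integrable z g : cplx_in (integrable_on mu) g ->
  cplx_in (integrable_on mu) (fun x => z * g x).
Proof.
move=> [g1 g2]; case: z => a b; split.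
  under eq_fun do rewrite ReM /= -mulNr.
  by apply: (@integrable_onD (fun x => a * _) (fun x => - b * _)); exact: integrable_onZ.
under eq_fun do rewrite ImM /=.
by apply: (@integrable_onD (fun x => a * _) (fun x => b * _)); exact: integrable_onZ.
Qed.

Lemma cplx_integral0 : cplx_integral mu (fun=> 0) = 0.
Proof. by rewrite /cplx_integral /= /Rintegral integral0. Qed.

Lemma cplx_integral_sum (I : Type) (r : seq I) (F : I -> Rm -> R[i]) :
  (forall i, cplx_in (integrable_on mu) (F i)) ->
  cplx_in (integrable_on mu) (fun x => \sum_(i <- r) F i x) /\
  cplx_integral mu (fun x => \sum_(i <- r) F i x) = \sum_(i <- r) cplx_integral mu (F i).
Proof.
move=> IF; elim: r => [|i r [IH1 IH2]].
  split; first by split; (under eq_fun do rewrite big_nil /=); exact: integrable0.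
  by rewrite big_nil; under eq_fun do rewrite big_nil; exact: cplx_integral0.
split.
  have [a1 a2] := IF i; case: IH1 => b1 b2.
  by split; (under eq_fun do rewrite big_cons raddfD /=); exact: integrable_onD.
rewrite big_cons -IH2 -cplx_integralD//; congr cplx_integral.
by apply/funext => x; rewrite big_cons.
Qed.

Lemma cliff_integral_mull z g : cliff_in (integrable_on mu) g ->
  cliff_integral mu (fun x => z * g x) = z * cliff_integral mu g.
Proof.
move=> Ig; apply/ffunP => C; rewrite ffunE cliffME.
pose F (A : {set 'I_m}) x := csign A (Defs.setSD A C) * z A * g x (Defs.setSD A C).
have [_ E] := @cplx_integral_sum _ (index_enum _) F (fun A => cplx_inZ_integrable _ (Ig _)).
transitivity (cplx_integral mu (fun x => \sum_A F A x)).
  by congr cplx_integral; apply/funext => x; rewrite cliffME.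
rewrite E; apply: eq_bigr => A _.
by rewrite /F cplx_integral_mull// ffunE.
Qed.

Lemma cplx_integral_conj g : cplx_in measurable_on g ->
  cplx_integral mu (fun x => (g x)^*%C) = (cplx_integral mu g)^*%C.
Proof.
move=> [g1 g2]; rewrite /cplx_integral /=; congr Complex.
  by apply: eq_Rintegral => t _; case: (g _).
rewrite -mulN1r -(Rintegral_mull mu (-1) g2).
by apply: eq_Rintegral => t _; case: (g _) => a b /=; rewrite mulN1r.
Qed.

Lemma cliff_integral_conj g : cliff_in measurable_on g ->
  cliff_integral mu (fun x => cbar (g x)) = cbar (cliff_integral mu g).
Proof.
move=> mg; apply/ffunP => A; rewrite cbarE !ffunE -cplx_integral_conj; last exact: mg.
have E n : (-1) ^+ n = ((-1) ^+ n : R)%:C%C :> R[i] by rewrite rmorphXn rmorphN1.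
rewrite E -cplx_integral_scale; last exact: cplx_in_conj subalgebra_measurable_on _ (mg A).
by congr cplx_integral; apply/funext => x; rewrite cbarE ffunE E.
Qed.

Lemma cliff_integral_scale (k : R) g : cliff_in measurable_on g ->
  cliff_integral mu (fun x => k%:C%C *: g x) = k%:C%C *: cliff_integral mu g.
Proof.
move=> mg; apply/ffunP => A; rewrite !ffunE; apply: etrans (cplx_integral_scale k (mg A)).
by congr cplx_integral; apply/funext => x; rewrite ffunE.
Qed.

Lemma cov_cplx_integral phi rho g : cov mu phi rho -> cplx_in measurable_on g ->
  cplx_integral mu (fun x => (rho x)%:C%C * g (phi x)) = cplx_integral mu g.
Proof.
move=> H [g1 g2]; rewrite /cplx_integral; congr Complex.
  rewrite -(cov_Rintegral H g1); apply: eq_Rintegral => t _.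
  by rewrite ReM /= mul0r subr0 mulrC.
rewrite -(cov_Rintegral H g2); apply: eq_Rintegral => t _.
by rewrite ImM /= mul0r addr0 mulrC.
Qed.

Lemma cov_cliff_integral phi rho g : cov mu phi rho -> cliff_in measurable_on g ->
  cliff_integral mu (fun x => (rho x)%:C%C *: g (phi x)) = cliff_integral mu g.
Proof.
move=> H mg; apply/ffunP => A; rewrite !ffunE; apply: etrans (cov_cplx_integral H (mg A)).
by congr cplx_integral; apply/funext => x; rewrite ffunE.
Qed.

Lemma cov1_cplx_integral phi g : cov mu phi (fun=> 1) -> cplx_in measurable_on g ->
  cplx_integral mu (fun x => g (phi x)) = cplx_integral mu g.
Proof.
move=> H mg; rewrite -(cov_cplx_integral H mg); congr cplx_integral.
by apply/funext => x; rewrite mul1r.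
Qed.

Lemma cov1_cliff_integral phi g : cov mu phi (fun=> 1) -> cliff_in measurable_on g ->
  cliff_integral mu (fun x => g (phi x)) = cliff_integral mu g.
Proof.
move=> H mg; rewrite -(cov_cliff_integral H mg); congr cliff_integral.
by apply/funext => x; rewrite scale1r.
Qed.

End Linearity.

Section InnerIntegral.

(** A copy of the surface measure to which finiteness is attached, so that the Tonelli measurability
    theorem for sigma-finite measures applies. *)
Definition sph : set T -> \bar R := @sphere_measure R m.

Lemma sph_fin : fin_num_fun sph.
Proof.
move=> U mU; rewrite ge0_fin_numE//; apply: le_lt_trans (@sphere_measure_lty R m).
by apply: le_measure; rewrite ?inE.
Qed.

HB.instance Definition _ := Measure.on sph.
HB.instance Definition _ := Measure_isFinite.Build _ _ _ sph sph_fin.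

(** Tonelli gives measurability of the integrals of the positive and negative parts; their
    difference and [fine] preserve it. *)
Lemma measurable_sphere_Rintegral (F : Rm -> Rm -> R) :
  measurable_on2 (fun p => F p.1 p.2) ->
  measurable_on (fun x => \int[@sphere_measure R m]_u F x (row_of_tuple u)).
Proof.
move=> mF.
rewrite /measurable_on /measurable_on_row /Rintegral.
apply: (@measurableT_comp _ _ _ _ _ _ (@fine R)); first exact: fine_measurable.
under eq_fun do rewrite integralE.
have mE : measurable_fun setT
    (fun p : T * T => (F (row_of_tuple p.1) (row_of_tuple p.2))%:E).
  exact/measurable_EFinP.
pose M := (sph : {sigma_finite_measure set T -> \bar R}).
apply: emeasurable_funB.
- have m1 := measurable_funepos mE.
  apply: eq_measurable_fun (@measurable_fun_fubini_tonelli_F _ _ T _ _ M _ m1 (fun p => funepos_ge0 _ p)).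
  by move=> x _; rewrite /fubini_F; apply: eq_integral => y _; rewrite !funeposE.
- have m1 := measurable_funeneg mE.
  apply: eq_measurable_fun (@measurable_fun_fubini_tonelli_F _ _ T _ _ M _ m1 (fun p => funeneg_ge0 _ p)).
  by move=> x _; rewrite /fubini_F; apply: eq_integral => y _; rewrite !funenegE.
Qed.

Lemma measurable_sphere_cplx_integral (F : Rm -> Rm -> R[i]) :
  cplx_in measurable_on2 (fun p => F p.1 p.2) ->
  cplx_in measurable_on (fun x => cplx_integral (@sphere_measure R m) (F x)).
Proof.
move=> [m1 m2]; split.
  exact: (@measurable_sphere_Rintegral (fun x u => complex.Re (F x u))).
exact: (@measurable_sphere_Rintegral (fun x u => complex.Im (F x u))).
Qed.

Lemma measurable_sphere_cliff_integral (F : Rm -> Rm -> Cl) :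
  cliff_in measurable_on2 (fun p => F p.1 p.2) ->
  cliff_in measurable_on (fun x => cliff_integral (@sphere_measure R m) (F x)).
Proof.
move=> mF A; under eq_fun do rewrite ffunE.
exact: (@measurable_sphere_cplx_integral (fun x u => F x u A)).
Qed.

End InnerIntegral.
End ComplexIntegrals.

(** * Linear substitutions in polynomials *)

Section LinearSubstitution.
Context {R : comNzRingType} {K : nzRingType} (iota : {rmorphism R -> K}) {m : nat}.
Hypothesis iotaC : forall r (z : K), GRing.comm z (iota r).
Notation pol := (mpoly m K).

Lemma mpoly_ring_ind (P : pol -> Prop) : (forall c, P (mpolyC m c)) ->
  (forall i, P (mpolyX K (mnm1 i))) -> (forall p q, P p -> P q -> P (p + q)) ->
  (forall p q, P p -> P q -> P (p * q)) -> forall p, P p.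
Proof.
move=> PC PX PD PM; elim/mpolyind => [|c al p _ _ Pp]; first by rewrite -(mpolyC0 m K); exact: PC.
apply: PD => //; rewrite -mul_mpolyC; apply: (PM) => //.
rewrite mpolyXE_id; elim/big_ind: _ => [||i _]; [by rewrite -mpolyC1; exact: PC|by move=> x y; exact: PM|].
 elim: (al i : nat) => [|k IH]; first by rewrite expr0 -mpolyC1; exact: PC.
by rewrite exprS; exact: PM.
Qed.

Lemma comm_mpolyC (c : K) (p : pol) : (forall z, GRing.comm z c) -> GRing.comm p (mpolyC m c).
Proof.
move=> cC; apply/mpolyP => al; rewrite mcoeffCM -[RHS]cC.
rewrite [p]mpolyE mulr_suml !raddf_sum /= mulr_suml; apply: eq_bigr => be _.
rewrite -scalerAl -commr_mpolyX mul_mpolyC scalerA !mcoeffZ -!mulrA; congr (_ * _).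
by rewrite cC.
Qed.

Definition eval_at (u : 'I_m -> R) (p : pol) : K := meval (fun i => iota (u i)) p.

(** Over a noncommutative ring, evaluation is multiplicative only at central points; the real points
    are central by [iotaC]. *)
Lemma eval_at_mul u p q : eval_at u (p * q) = eval_at u p * eval_at u q.
Proof.
have [|H _] := @commr_mmap_is_multiplicative _ K K (fun i => iota (u i)) idfun
  (fun i x => iotaC _ x) _; last exact: H.
move=> r al be; rewrite /mmap1; elim/big_ind: _ => [|x y|i _].
- exact: commr1.
- exact: commrM.
- exact/commrX/iotaC.
Qed.

Variable a : 'I_m -> 'I_m -> R.

Lemma subm_self (al : multinom m) : mnm_sub al al = mnm0.
Proof. by apply/mnmP => i; rewrite mnmBE subnn mnm0E. Qed.

Definition linear_form i : pol := \sum_j mpolyC m (iota (a i j)) * mpolyX K (mnm1 j).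

Definition linear_subst (p : pol) : pol := mmap (@mpolyC m K) linear_form p.

Lemma comm_linear_form i (p : pol) : GRing.comm p (linear_form i).
Proof.
rewrite /GRing.comm mulr_suml mulr_sumr; apply: eq_bigr => j _.
rewrite mulrA (comm_mpolyC p (iotaC (a i j))) -!mulrA; congr (_ * _).
exact: commr_mpolyX.
Qed.

Lemma linear_substD p q : linear_subst (p + q) = linear_subst p + linear_subst q.
Proof. exact: mmapD. Qed.

Lemma linear_substC c : linear_subst (mpolyC m c) = mpolyC m c.
Proof. exact: mmapC. Qed.

Lemma linear_substX i : linear_subst (mpolyX K (mnm1 i)) = linear_form i.
Proof. by rewrite /linear_subst mmapX mmap1U. Qed.

Lemma linear_substM p q : linear_subst (p * q) = linear_subst p * linear_subst q.
Proof.
have [|H _] := @commr_mmap_is_multiplicative _ K _ linear_form (@mpolyC m K) comm_linear_form _;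
  last exact: H.
move=> r al be; rewrite /mmap1; elim/big_ind: _ => [|x y|i _].
- exact: commr1.
- exact: commrM.
- exact/commrX/comm_linear_form.
Qed.

Lemma linear_subst_sum (I : Type) (r : seq I) (F : I -> pol) :
  linear_subst (\sum_(i <- r) F i) = \sum_(i <- r) linear_subst (F i).
Proof. exact: raddf_sum. Qed.

Lemma linear_subst0 : linear_subst 0 = 0.
Proof. exact: mmap0. Qed.

Lemma eval_at_linear_subst u p :
  eval_at u (linear_subst p) = eval_at (fun i => \sum_j a i j * u j) p.
Proof.
elim/mpoly_ring_ind: p => [c|i|p q IHp IHq|p q IHp IHq].
- by rewrite linear_substC /eval_at !mevalC.
- rewrite linear_substX {2}/eval_at mevalXU rmorph_sum /linear_form [LHS]raddf_sum.
  apply: eq_bigr => j _.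
  by apply: etrans (eval_at_mul _ _ _) _; rewrite /eval_at mevalC mevalXU rmorphM.
- by rewrite linear_substD; apply: etrans (mevalD _ _ _) _; rewrite -!/(eval_at _ _) IHp IHq;
    exact/esym/mevalD.
- by rewrite linear_substM !eval_at_mul IHp IHq.
Qed.

Lemma mderiv_linear_form i j : mderiv j (linear_form i) = mpolyC m (iota (a i j)).
Proof.
rewrite /linear_form raddf_sum /= (bigD1 j)//= big1 ?addr0.
  by rewrite mderiv_mulC mderivX mnm1E eqxx scale1r subm_self mpolyX0 mulr1.
by move=> k kj; rewrite mderiv_mulC mderivX mnm1E (negbTE kj) scale0r mulr0.
Qed.

(** The chain rule, by induction over the ring operations: the product case is the Leibniz rule,
    with the matrix entries moved past polynomials because they are central. *)
Lemma mderiv_linear_subst j p : mderiv j (linear_subst p) =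
  \sum_i mpolyC m (iota (a i j)) * linear_subst (mderiv i p).
Proof.
elim/mpoly_ring_ind: p => [c|i|p q IHp IHq|p q IHp IHq].
- by rewrite linear_substC mderivC big1 // => i _; rewrite mderivC linear_subst0 mulr0.
- rewrite linear_substX mderiv_linear_form (bigD1 i)//= big1 ?addr0.
    by rewrite mderivX mnm1E eqxx scale1r subm_self mpolyX0 -mpolyC1 linear_substC mulr1.
  by move=> k ki; rewrite mderivX mnm1E eq_sym (negbTE ki) scale0r linear_subst0 mulr0.
- rewrite linear_substD mderivD IHp IHq -big_split; apply: eq_bigr => i _.
  by rewrite mderivD linear_substD mulrDr.
- rewrite linear_substM mderivM IHp IHq mulr_suml mulr_sumr -big_split.
  apply: eq_bigr => i _; rewrite mderivM linear_substD !linear_substM mulrDr !mulrA.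
  congr (_ + _ * _).
  exact: comm_mpolyC (linear_subst p) (iotaC (a i j)).
Qed.

Lemma ishomog1_mpolyC (c : K) : mpolyC m c \is ishomog1 0 (@mdeg m).
Proof.
by rewrite -[mpolyC m c]mulr1 mul_mpolyC; apply: dhomogZ; exact: dhomog1.
Qed.

Lemma ishomog1_linear_subst k p : p \is ishomog1 k (@mdeg m) ->
  linear_subst p \is ishomog1 k (@mdeg m).
Proof.
move=> /dhomogP hp; rewrite /linear_subst /mmap big_seq; apply: rpred_sum => al /hp <-.
apply: (@dhomogM _ _ _ 0); first exact: ishomog1_mpolyC.
rewrite -/(mdeg al) mdegE /mmap1.
elim: (index_enum _) => [|i r IH]; first by rewrite !big_nil; exact: dhomog1.
rewrite !big_cons; apply: dhomogM => //.
have := @dhomogMn _ _ _ 1 (linear_form i) (al i); rewrite mul1n; apply.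
apply: rpred_sum => j _; rewrite -[1%N]add0n; apply: dhomogM; first exact: ishomog1_mpolyC.
by rewrite dhomogX; apply/eqP; exact: mdeg1.
Qed.

Lemma mcoeff_mulC (p : pol) c al : mcoeff al (p * mpolyC m c) = mcoeff al p * c.
Proof.
rewrite [p]mpolyE mulr_suml !raddf_sum /= mulr_suml; apply: eq_bigr => be _.
by rewrite -scalerAl -commr_mpolyX mul_mpolyC scalerA !mcoeffZ !mcoeffX -!mulrA commr_nat.
Qed.

(** The linear forms have central coefficients, so the coefficients of [p] can be moved to the
    right. [Q] is meant to be membership in a left ideal. *)
Lemma mcoeff_linear_subst (Q : K -> Prop) p : Q 0 -> (forall x y, Q x -> Q y -> Q (x + y)) ->
  (forall r z, Q z -> Q (r * z)) -> (forall al, Q (mcoeff al p)) ->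
  forall al, Q (mcoeff al (linear_subst p)).
Proof.
move=> Q0 QD QM Qp al; rewrite /linear_subst /mmap raddf_sum /=.
apply: (big_ind Q) => // be _; rewrite mcoeffCM.
suff -> : mcoeff be p * mcoeff al (mmap1 linear_form be) =
    mcoeff al (mmap1 linear_form be) * mcoeff be p by exact: QM.
rewrite -mcoeffCM -[RHS]mcoeff_mulC; have C : GRing.comm (mpolyC m (mcoeff be p)) (mmap1 linear_form be); last by rewrite C.
rewrite /mmap1; elim/big_ind: _ => [|x y|i _].
- exact: commr1.
- exact: commrM.
- exact/commrX/comm_linear_form.
Qed.

End LinearSubstitution.

(** * Harmonic and monogenic polynomials under linear isometries *)

Section IsometrySubstitution.
Context {R : realType} {m : nat}.
Notation Rm := 'rV[R]_m.
Notation Cl := (cliff R[i] m).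

Definition cliff_of_real : {rmorphism R -> Cl} := GRing.in_alg Cl \o real_complex R.

Lemma cliff_of_realC r (z : Cl) : GRing.comm z (cliff_of_real r).
Proof. by rewrite /GRing.comm /cliff_of_real /= -scalerAl -scalerAr mul1r mulr1. Qed.

Lemma complex_of_realC r (z : R[i]) : GRing.comm z (real_complex R r).
Proof. exact: mulrC. Qed.

Lemma eval_cplxE (p : mpoly m R[i]) (u : Rm) :
  eval_cplx p u = eval_at (real_complex R) (fun i => u 0 i) p.
Proof. by []. Qed.

Lemma eval_cliffE (p : mpoly m Cl) (u : Rm) :
  eval_cliff p u = eval_at cliff_of_real (fun i => u 0 i) p.
Proof. by []. Qed.

Lemma eval_cliffM p q (u : Rm) : eval_cliff (p * q) u = eval_cliff p u * eval_cliff q u :> Cl.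
Proof. by rewrite !eval_cliffE; apply: eval_at_mul; exact: cliff_of_realC. Qed.

Lemma eval_cliffC z (u : Rm) : eval_cliff (mpolyC m z) u = z :> Cl.
Proof. exact: mevalC. Qed.

Lemma mpolyC_sum (K : nzRingType) (I : Type) (r : seq I) (F : I -> K) :
  \sum_(i <- r) mpolyC m (F i) = mpolyC m (\sum_(i <- r) F i).
Proof.
elim: r => [|i r IH]; first by rewrite !big_nil mpolyC0.
by rewrite !big_cons IH mpolyCD.
Qed.

Lemma dotD (x y : Rm) : enorm (x + y) ^+ 2 = enorm x ^+ 2 + enorm y ^+ 2 + 2 * dot x y.
Proof.
rewrite !enorm_sqr /dot mulr_sumr -!big_split; apply: eq_bigr => i _ /=.
by rewrite !mxE; ring.
Qed.

Variables T L : Rm -> Rm.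
Hypotheses (TD : forall x y, T (x + y) = T x + T y) (TZ : forall k x, T (k *: x) = k *: T x).
Hypotheses (TN : forall x, enorm (T x) = enorm x) (TL : cancel L T).

Lemma dot_isometry x y : dot (T x) (T y) = dot x y.
Proof.
apply: (@mulfI _ 2); first by rewrite pnatr_eq0.
by have := dotD (T x) (T y); rewrite -TD !TN dotD => /addrI.
Qed.

Lemma dot_delta i (x : Rm) : dot (delta_mx 0 i) x = x 0 i.
Proof.
rewrite /dot (bigD1 i)//= big1 ?addr0 ?mxE ?eqxx ?mul1r//.
by move=> j ji; rewrite mxE eqxx (negbTE ji) mul0r.
Qed.

(** The matrix is read off [T], yet the substitution composes with the inverse [L]: the sum over j
    of a i j * u_j is <T e_i, u> = <e_i, L u>. *)
Let a i j : R := T (delta_mx 0 i) 0 j.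

Let aL (u : Rm) i : \sum_j a i j * u 0 j = L u 0 i.
Proof. by rewrite -[LHS]/(dot (T _) u) -{1}(TL u) dot_isometry dot_delta. Qed.

Let aa i k : \sum_j a i j * a k j = (i == k)%:R.
Proof. by rewrite -[LHS]/(dot (T _) (T _)) dot_isometry dot_delta mxE eqxx eq_sym. Qed.

Definition cplx_subst := linear_subst (real_complex R) a.
Definition cliff_subst := linear_subst cliff_of_real a.

Lemma eval_cplx_subst p u : eval_cplx (cplx_subst p) u = eval_cplx p (L u).
Proof.
rewrite !eval_cplxE eval_at_linear_subst; last exact: complex_of_realC.
by have -> : (fun i => \sum_j a i j * u 0 j) = (fun i => L u 0 i) by apply/funext.
Qed.

Lemma eval_cliff_subst p u : eval_cliff (cliff_subst p) u = eval_cliff p (L u).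
Proof.
rewrite !eval_cliffE eval_at_linear_subst; last exact: cliff_of_realC.
by have -> : (fun i => \sum_j a i j * u 0 j) = (fun i => L u 0 i) by apply/funext.
Qed.

(** By the chain rule, the Laplacian of the substituted polynomial pairs second derivatives with the
    rows of [a], which are orthonormal. *)
Lemma harmonic_poly_subst k p : harmonic_poly k p -> harmonic_poly k (cplx_subst p).
Proof.
have C := complex_of_realC.
move=> [hp dp]; split; first exact: ishomog1_linear_subst.
transitivity (cplx_subst (\sum_i mderiv i (mderiv i p))); last by rewrite dp /cplx_subst linear_subst0.
rewrite /cplx_subst linear_subst_sum.
have E i l : \sum_j mpolyC m (real_complex R (a i j * a l j)) = mpolyC m (i == l)%:R.
  rewrite mpolyC_sum; congr (mpolyC m _); rewrite -(rmorph_nat (real_complex R)) -(aa i l).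
  exact/esym/rmorph_sum.
transitivity (\sum_i \sum_k (\sum_j mpolyC m (real_complex R (a i j * a k j))) *
    linear_subst (real_complex R) a (mderiv k (mderiv i p))).
  under eq_bigr => j _.
    rewrite mderiv_linear_subst// raddf_sum /=.
    under eq_bigr => i _ do rewrite mderiv_mulC mderiv_linear_subst// mulr_sumr.
    over.
  rewrite exchange_big; apply: eq_bigr => i _; rewrite exchange_big; apply: eq_bigr => l _ /=.
  by rewrite mulr_suml; apply: eq_bigr => j _; rewrite rmorphM mpolyCM mulrA.
apply: eq_bigr => i _; rewrite (bigD1 i)//= [X in _ + X]big1 ?addr0 => [|l li].
  by rewrite E eqxx mpolyC1 mul1r.
by rewrite E eq_sym (negbTE li) mpolyC0 mul0r.
Qed.

Lemma vec_isometry_delta i : vec (T (delta_mx 0 i)) = \sum_j cliff_of_real (a i j) * ce j.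
Proof.
by rewrite vecE /cvec; apply: eq_bigr => j _; rewrite /cliff_of_real /= -scalerAl mul1r.
Qed.

(** With f the polynomial, the Dirac operator applied to q f(L u) gives the sum over i of T(e_i) q
    (d_i f)(L u). The intertwining relation rewrites this as s q times the value of D f at L u,
    which is 0. *)
Lemma monogenic_poly_subst (S : {vspace Cl}) k p (q : Cl) (s : Cl) : left_ideal S ->
  (forall x, vec (T x) * q = s * q * vec x) ->
  monogenic_poly S k p -> monogenic_poly S k (mpolyC m q * cliff_subst p).
Proof.
have C := cliff_of_realC.
move=> idS Hq [hp cp dp]; split.
- apply: (@dhomogM _ _ _ 0); first exact: ishomog1_mpolyC.
  exact: ishomog1_linear_subst.
- move=> al; rewrite mcoeffCM; apply: (idS).
  apply: (@mcoeff_linear_subst R Cl cliff_of_real m C a (fun z => z \in S)) => //.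
  + exact: mem0v.
  + exact: memvD.
- transitivity (mpolyC m (s * q) * cliff_subst (\sum_i mpolyC m (ce i) * mderiv i p)); last first.
    by rewrite dp /cliff_subst linear_subst0 mulr0.
  rewrite /cliff_subst linear_subst_sum [RHS]mulr_sumr.
  transitivity (\sum_i (\sum_j mpolyC m (cliff_of_real (a i j) * ce j * q)) *
     linear_subst cliff_of_real a (mderiv i p)).
    transitivity (\sum_j \sum_i mpolyC m (ce j) * (mpolyC m q * (mpolyC m (cliff_of_real (a i j)) *
        linear_subst cliff_of_real a (mderiv i p)))).
      apply: eq_bigr => j _; rewrite mderiv_mulC mderiv_linear_subst//.
      by rewrite [mpolyC m q * _]mulr_sumr mulr_sumr.
    rewrite exchange_big; apply: eq_bigr => i _; rewrite mulr_suml; apply: eq_bigr => j _ /=.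
    rewrite !mulrA -!mpolyCM; congr (mpolyC m _ * _).
    by rewrite (C (a i j)) !mulrA.
  apply: eq_bigr => i _.
  rewrite [in RHS](linear_substM C) [in RHS]linear_substC [RHS]mulrA; congr (_ * _).
  rewrite -[RHS]mpolyCM mpolyC_sum; congr (mpolyC m _).
  rewrite -mulr_suml -vec_isometry_delta Hq; congr (_ * _).
  rewrite vecE /cvec (bigD1 i)//= big1 ?addr0 => [|j ji].
    by rewrite mxE !eqxx scale1r.
  by rewrite mxE eqxx (negbTE ji) scale0r.
Qed.

End IsometrySubstitution.

(** * Invariance of the reproducing kernels *)

Section Kernels.
Context {R : realType} {m : nat}.
Notation Rm := 'rV[R]_m.
Notation Cl := (cliff R[i] m).
Notation sigma := (@sphere_measure R m).

Lemma eval_cplx_measurable (p : mpoly m R[i]) : cplx_in measurable_on (eval_cplx p).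
Proof.
apply: (in_eval_cplx subalgebra_measurable_on (n := mmeasure mdeg p) (p := fun=> p)) => //.
- by move=> al; apply: cplx_in_cst subalgebra_measurable_on _.
- by move=> i; have [] := @ball_bounded_coord R m i.
Qed.

Lemma eval_cliff_bounded (p : mpoly m Cl) : cliff_in ball_bounded (eval_cliff p).
Proof.
apply: (in_eval_cliff subalgebra_ball_bounded (n := mmeasure mdeg p) (p := fun=> p)) => //.
- by move=> al; apply: cliff_in_cst subalgebra_ball_bounded _.
- by move=> i; exact: ball_bounded_coord.
Qed.

Lemma cliff_bounded_measurable (f : Rm -> Cl) : cliff_in ball_bounded f -> cliff_in measurable_on f.
Proof. by move=> bf A; have [[m1 _] [m2 _]] := bf A. Qed.

Lemma cliff_bounded_integrable (f : Rm -> Cl) : cliff_in ball_bounded f ->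
  cliff_in (integrable_on sigma) f.
Proof. by move=> bf A; have [b1 b2] := bf A; split; exact: ball_bounded_integrable. Qed.

Lemma eval_cliff_mulC (p : mpoly m Cl) z u :
  eval_cliff (p * mpolyC m z) u = eval_cliff p u * z.
Proof. by rewrite eval_cliffM eval_cliffC. Qed.

Lemma eval_cliff_Cmul (p : mpoly m Cl) z u :
  eval_cliff (mpolyC m z * p) u = z * eval_cliff p u.
Proof. by rewrite eval_cliffM eval_cliffC. Qed.

Lemma cconj_swap (X Y s t : Cl) :
  cbar t * (cconj X * (Y * s)) = cbar (cbar s * (cconj Y * (X * t))).
Proof. by rewrite -!cbarE !cconjM !cconjK !mulrA. Qed.

Lemma harmonic_kernel_uniq k (Z1 Z2 : Rm -> mpoly m R[i]) v w :
  harmonic_kernel k Z1 -> harmonic_kernel k Z2 -> eval_cplx (Z1 v) w = eval_cplx (Z2 v) w.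
Proof.
(* Reproducing Z by Z' gives Z(w, v) = conj Z'(v, w). *)
have H (Z Z' : Rm -> mpoly m R[i]) v' w' : harmonic_kernel k Z -> harmonic_kernel k Z' ->
    eval_cplx (Z v') w' = (eval_cplx (Z' w') v')^*%C.
  move=> [HZ rZ] [HZ' rZ']; rewrite (rZ' _ w' (HZ v')) (rZ _ v' (HZ' w')) -cplx_integral_conj.
    congr cplx_integral; apply/funext => u.
    by rewrite (rmorphM (@conjc R)) /= conjcK mulrC.
  apply: (cplx_inM subalgebra_measurable_on); last exact: eval_cplx_measurable.
  by apply: (cplx_in_conj subalgebra_measurable_on); exact: eval_cplx_measurable.
by move=> H1 H2; rewrite (H Z1 Z2)// -(H Z2 Z2).
Qed.

(** Taken with t = h1 - h2, which lies in S, the hypothesis makes the scalar part |t|^2 of conj(t) t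
    vanish. *)
Lemma left_ideal_separated (S : {vspace Cl}) (h1 h2 : Cl) : left_ideal S -> h1 \in S -> h2 \in S ->
  (forall t, t \in S -> cbar t * h1 = cbar t * h2) -> h1 = h2.
Proof.
move=> idS S1 S2 E; apply/eqP; rewrite -subr_eq0; apply/eqP.
have := cconj_mul_scalar (h1 - h2); rewrite mulrBr (E _ (memvB S1 S2)) subrr ffunE => /esym/eqP.
rewrite (_ : 0 = 0%:C%C)// (inj_eq (@complexI R)) expf_eq0 /= => /eqP.
exact: cnorm_eq0.
Qed.

Lemma monogenic_kernel_uniq (S : {vspace Cl}) k (Z1 Z2 : Rm -> mpoly m Cl) v w s :
  left_ideal S -> monogenic_kernel S k Z1 -> monogenic_kernel S k Z2 -> s \in S ->
  eval_cliff (Z1 v) w * s = eval_cliff (Z2 v) w * s.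
Proof.
move=> idS.
(* Again Z(w, v) = conj Z'(v, w), but only when tested between spinors. *)
have H (Z Z' : Rm -> mpoly m Cl) v' w' s' t : monogenic_kernel S k Z -> monogenic_kernel S k Z' ->
    s' \in S -> t \in S ->
    cbar t * (eval_cliff (Z v') w' * s') = cbar (cbar s' * (eval_cliff (Z' w') v' * t)).
  move=> [HZ rZ] [HZ' rZ'] sS tS.
  have E1 := rZ' _ w' (HZ v' _ sS); have E2 := rZ _ v' (HZ' w' _ tS).
  have {}E1 := etrans (esym (eval_cliff_mulC _ _ _)) E1.
  have {}E2 := etrans (esym (eval_cliff_mulC _ _ _)) E2.
  have B Y : cliff_in ball_bounded (fun u => cbar (eval_cliff (Y : mpoly m Cl) u)).
    by apply: (cliff_in_conj subalgebra_ball_bounded); exact: eval_cliff_bounded.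
  have B2 Y Y' : cliff_in ball_bounded
      (fun u => cconj (eval_cliff (Y : mpoly m Cl) u) * eval_cliff (Y' : mpoly m Cl) u).
    under eq_fun do rewrite -cbarE.
    by apply: (cliff_inM subalgebra_ball_bounded); [exact: B|exact: eval_cliff_bounded].
  have I Y Y' := cliff_bounded_integrable (B2 Y Y').
  apply: etrans (congr1 ( *%R (cbar t)) E1) _.
  apply: etrans (esym (cliff_integral_mull _ (I _ _))) _.
  apply: etrans _ (congr1 (fun z => cbar (cbar s' * z)) (esym E2)).
  apply: etrans _ (congr1 cbar (cliff_integral_mull _ (I _ _))).
  apply: etrans _ (cliff_integral_conj _ _); last first.
    apply: cliff_bounded_measurable; apply: (cliff_inM subalgebra_ball_bounded); last exact: B2.
    exact: cliff_in_cst subalgebra_ball_bounded _.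
  congr cliff_integral; apply/funext => u.
  apply: etrans (congr1 (fun z => cbar t * (_ * z)) (eval_cliff_mulC _ _ _)) _.
  apply: etrans _ (congr1 (fun z => cbar (cbar s' * (_ * z))) (esym (eval_cliff_mulC _ _ _))).
  exact: cconj_swap.
move=> H1 H2 sS.
apply: (left_ideal_separated idS (idS _ _ sS) (idS _ _ sS)) => t tS.
exact: etrans (H Z1 Z2 v w s t H1 H2 sS tS) (esym (H Z2 Z2 v w s t H2 H2 sS tS)).
Qed.

Variables T L : Rm -> Rm.
Hypotheses (TD : forall x y, T (x + y) = T x + T y) (TZ : forall k x, T (k *: x) = k *: T x).
Hypotheses (LD : forall x y, L (x + y) = L x + L y) (LZ : forall k x, L (k *: x) = k *: L x).
Hypotheses (TN : forall x, enorm (T x) = enorm x) (LN : forall x, enorm (L x) = enorm x).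
Hypotheses (TL : cancel L T) (LT : cancel T L).

(** The reproducing formula for f(L .) at the point T v, with u replaced by T u under the invariant
    surface measure. *)
Lemma harmonic_kernel_isometry k (Z : Rm -> mpoly m R[i]) : harmonic_kernel k Z ->
  harmonic_kernel k (fun v => cplx_subst L (Z (T v))).
Proof.
move=> [HZ rZ]; split; first by move=> v; exact: harmonic_poly_subst.
move=> f v Hf.
have Hg := harmonic_poly_subst TD TN Hf.
have ET u : eval_cplx (cplx_subst T f) (T u) = eval_cplx f u.
  exact: etrans (eval_cplx_subst TD TN TL f (T u)) (congr1 (eval_cplx f) (LT u)).
have EL u := eval_cplx_subst LD LN LT (Z (T v)) u.
have C : cov sigma T (fun=> 1) by exact: cov_sphere_isometry TD TZ TN TL.
apply: etrans (esym (ET v)) _; apply: etrans (rZ _ (T v) Hg) _.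
apply: etrans (esym (cov1_cplx_integral C _)) _.
  apply: (cplx_inM subalgebra_measurable_on); last exact: eval_cplx_measurable.
  by apply: (cplx_in_conj subalgebra_measurable_on); exact: eval_cplx_measurable.
congr cplx_integral; apply/funext => u.
exact: (congr2 (fun x y => x^*%C * y) (esym (EL u)) (ET u)).
Qed.

Lemma eval_harmonic_kernel_isometry k (Z : Rm -> mpoly m R[i]) v w : harmonic_kernel k Z ->
  eval_cplx (Z (T v)) (T w) = eval_cplx (Z v) w.
Proof.
move=> HZ; apply: etrans _ (harmonic_kernel_uniq v w (harmonic_kernel_isometry HZ) HZ).
exact: esym (eval_cplx_subst LD LN LT _ _).
Qed.

Lemma eval_cliff_spin (Y : mpoly m Cl) p w :
  eval_cliff (mpolyC m p^-1 * cliff_subst L Y * mpolyC m p) w = p^-1 * eval_cliff Y (T w) * p.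
Proof.
exact: etrans (eval_cliff_mulC _ p w) (congr1 ( *%R^~ p)
  (etrans (eval_cliff_Cmul (cliff_subst L Y) p^-1 w)
     (congr1 ( *%R p^-1) (eval_cliff_subst LD LN LT Y w)))).
Qed.

Lemma eval_cliff_spin_subst (f : mpoly m Cl) p u :
  eval_cliff (mpolyC m p * cliff_subst T f) (T u) = p * eval_cliff f u.
Proof. by rewrite eval_cliff_Cmul (eval_cliff_subst TD TN TL) LT. Qed.

(* The new kernel p^-1 Z(T u, T v) p is dual to the spin action
   f |-> p f(T^-1 .), which preserves monogenic functions. *)
Lemma monogenic_kernel_isometry (S : {vspace Cl}) k (Z : Rm -> mpoly m Cl) (p : Cl) (e r : R) :
  left_ideal S -> p \is a GRing.unit -> cbar p = r%:C%C *: p^-1 -> r != 0 -> e ^+ 2 = 1 ->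
  (forall x, vec (T x) * p = e%:C%C%:A * p * vec x) ->
  monogenic_kernel S k Z ->
  monogenic_kernel S k (fun v => mpolyC m p^-1 * cliff_subst L (Z (T v)) * mpolyC m p).
Proof.
move=> idS up cp r0 ee Hp [HZ rZ].
(* The same relation for the inverse isometry and p^-1, again with sign e since e^2 = 1. It makes
   the transformed kernel monogenic. *)
have Hp' x : vec (L x) * p^-1 = e%:C%C%:A * p^-1 * vec x.
  have := Hp (L x); rewrite TL => E.
  transitivity (e%:C%C%:A * p^-1 * (vec x * p) * p^-1); last by rewrite -!mulrA (mulrV up) mulr1.
  rewrite E mulr_algl -!mulrA mulr_algl -!scalerAl -!scalerAr scalerA -rmorphM -expr2 ee scale1r.
  by rewrite (mulKr up).
split.
  move=> v s sS; have := HZ (T v) (p * s) (idS _ _ sS).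
  move=> /(monogenic_poly_subst idS Hp').
  rewrite /cliff_subst (linear_substM (@cliff_of_realC R m)) linear_substC mpolyCM.
  by rewrite !mulrA.
have cpV : cbar p^-1 = r^-1%:C%C *: p.
  have H : cbar p * cbar p^-1 = 1 by rewrite -cconjM (mulVr up) cconj1.
  have : p * (cbar p * cbar p^-1) = p by rewrite H mulr1.
  rewrite cp -scalerAl -scalerAr mulrA (mulrV up) mul1r => E.
  by apply: etrans _ (congr1 ( *:%R (r^-1)%:C%C) E); rewrite scalerA -rmorphM (mulVf r0) scale1r.
(* As p is a real multiple of a unitary element, conjugation by p commutes with the Hermitian
   conjugation. *)
have cconj_conj X Y : cconj X * (p * Y) = p * (cconj (p^-1 * X * p) * Y).
  rewrite -!cbarE !cconjM.
  have -> : cbar p * (cbar X * cbar p^-1) = p^-1 * (cbar X * p).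
    by rewrite cp cpV -!scalerAr -scalerAl scalerA -rmorphM (mulVf r0) scale1r.
  by rewrite !mulrA (mulrV up) mul1r.
move=> f v Hf.
have Hg := monogenic_poly_subst idS Hp Hf.
have ET := eval_cliff_spin_subst f p.
have EL u := eval_cliff_spin (Z (T v)) p u.
have C : cov sigma T (fun=> 1) by exact: cov_sphere_isometry TD TZ TN TL.
have B (Y Y' : mpoly m Cl) : cliff_in ball_bounded (fun u => cconj (eval_cliff Y u) * eval_cliff Y' u).
  under eq_fun do rewrite -cbarE.
  by apply: (cliff_inM subalgebra_ball_bounded); last exact: eval_cliff_bounded;
    apply: (cliff_in_conj subalgebra_ball_bounded); exact: eval_cliff_bounded.
apply: (mulrI up).
apply: etrans (esym (ET v)) _; apply: etrans (rZ _ (T v) Hg) _.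
apply: etrans (esym (cov1_cliff_integral C (cliff_bounded_measurable (B _ _)))) _.
apply: etrans _ (cliff_integral_mull _ (cliff_bounded_integrable (B _ _))).
congr cliff_integral; apply/funext => u.
apply: etrans (congr1 ( *%R _) (ET u)) _.
apply: etrans _ (congr1 (fun z => p * (cconj z * _)) (esym (EL u))).
exact: cconj_conj.
Qed.

Lemma eval_monogenic_kernel_isometry (S : {vspace Cl}) k (Z : Rm -> mpoly m Cl) (p : Cl) (e r : R) v w s :
  left_ideal S -> p \is a GRing.unit -> cbar p = r%:C%C *: p^-1 -> r != 0 -> e ^+ 2 = 1 ->
  (forall x, vec (T x) * p = e%:C%C%:A * p * vec x) ->
  monogenic_kernel S k Z -> s \in S ->
  eval_cliff (Z (T v)) (T w) * p * s = p * (eval_cliff (Z v) w * s).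
Proof.
move=> idS up cp r0 ee Hp HZ sS.
have HZ' := monogenic_kernel_isometry idS up cp r0 ee Hp HZ.
have E := monogenic_kernel_uniq v w idS HZ HZ' sS.
apply: etrans _ (congr1 ( *%R p) (esym E)).
have EL := eval_cliff_spin (Z (T v)) p w.
have conj_cancel X : X * p * s = p * (p^-1 * X * p * s) by rewrite !mulrA (mulrV up) mul1r.
apply: etrans _ (congr1 (fun z => p * (z * s)) (esym EL)).
exact: conj_cancel.
Qed.

End Kernels.

(** * The intertwining relation *)

Section Weights.
Context {R : realType} (j m : nat) (n p q : R).
Hypothesis p0 : p != 0.

(** Here n = |x - y|, p = |c x + d| and q = |c y + d|. The point is p^(m - 2j) = p^(2m) p^(-m - 2j):
    the weight J_-t falls short by p^(2m). *)
Lemma weight_even : (n / (p * q)) ^ ((2 * j)%:Z - m%:Z) =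
  p ^+ (2 * m) * ((q ^ ((2 * j)%:Z - m%:Z))^-1 * n ^ ((2 * j)%:Z - m%:Z) *
    p ^ (- m%:Z - (2 * j)%:Z)).
Proof.
rewrite expfzMl exprz_inv expfzMl invr_expz.
have -> : p ^ (- ((2 * j)%:Z - m%:Z)) = p ^+ (2 * m) * p ^ (- m%:Z - (2 * j)%:Z).
  by rewrite exprnP -expfzDr//; congr (p ^ _); rewrite PoszM; ring.
move: (n ^ _) (q ^ _) (p ^ _) (p ^+ _) => a b c d; ring.
Qed.

(** The additional p^-2 comes from replacing (c x + d)^-1 by its reversal over |c x + d|^2, up to
    sign. The exponents agree because (m - 2j + 2) - 2 = 2m - (m + 2j). *)
Lemma weight_odd : ((n / (p * q)) ^ (m%:Z - (2 * j)%:Z + 2))^-1 * p ^- 2 =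
  p ^+ (2 * m) * (q ^ (m%:Z - (2 * j)%:Z + 2) *
    (n ^ (m%:Z - (2 * j)%:Z + 2))^-1 * p ^- (m + 2 * j)).
Proof.
rewrite expfzMl exprz_inv expfzMl invfM -!invr_expz invfM !invrK.
have E : p ^ (m%:Z - (2 * j)%:Z + 2) * p ^- 2 = p ^+ (2 * m) * p ^- (m + 2 * j).
  rewrite !exprnN exprnP -!expfzDr//; congr (p ^ _); rewrite PoszD !PoszM; ring.
transitivity ((n ^ (m%:Z - (2 * j)%:Z + 2))^-1 * q ^ (m%:Z - (2 * j)%:Z + 2) *
    (p ^ (m%:Z - (2 * j)%:Z + 2) * p ^- 2)).
  by move: (_^-1) (q ^ _) (p ^ _) (p ^- _) => a b c d; ring.
by rewrite E; move: (_^-1) (q ^ _) (p ^+ _) (p ^- _) => a b c d; ring.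
Qed.

End Weights.

Lemma weights_cplx {R : realType} (P Q N P' : R) (K : R[i]) :
  (P * (Q^-1 * N * P'))%:C%C * K = P%:C%C * (Q%:C%C^-1 * (N%:C%C * K) * P'%:C%C).
Proof. by rewrite -fmorphV !rmorphM /=; ring. Qed.

(** Here A stands for q~, P for p, P' for p~, and Zp, Zw for the rotated and the original kernel.
    Applied to the spinor P^-1 s, the kernel relation gives Zp s = P Zw P^-1 s. The first P cancels
    the P^-1 of the vector factor, and the last P^-1 becomes the weight P' with the sign sg. *)
Lemma weights_cliff {R : realType} {m : nat} (al be ga de M p e sg : R) (A X P P' Zp Zw s : cliff R[i] m) :
  A \is a GRing.unit -> P \is a GRing.unit -> be != 0 -> p != 0 -> sg ^+ 2 = 1 ->
  P * P' = (sg * p ^+ 2)%:C%C%:A -> al * p ^- 2 = M * (be * ga * de) ->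
  Zp * P * (P^-1 * s) = P * (Zw * (P^-1 * s)) ->
  al%:C%C *: (e%:C%C *: (A^-1 * X * P^-1)) * Zp * s =
  (M * (e * sg))%:C%C *: ((be^-1%:C%C *: A)^-1 * (ga%:C%C *: X * Zw) * (de%:C%C *: P') * s).
Proof.
move=> uA uP be0 p0 ss PP W E.
have PV : P^-1 = (sg * p ^- 2)%:C%C *: P'.
  apply: (mulrI uP); rewrite (mulrV uP) -scalerAr PP scalerA -rmorphM.
  have -> : sg * p ^- 2 * (sg * p ^+ 2) = 1.
    by rewrite mulrACA -expr2 ss mul1r mulVf// expf_neq0.
  by rewrite scale1r.
have ZpE : Zp * s = P * (Zw * (P^-1 * s)).
  by rewrite -E -!mulrA (mulVKr uP).
rewrite -mulrA ZpE -!scalerAl -!mulrA (mulKr uP) PV.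
have -> : (be^-1%:C%C *: A)^-1 = be%:C%C *: A^-1.
  have ub : be^-1%:C%C \is a GRing.unit by rewrite unitfE fmorphV invr_eq0 fmorph_eq0.
  apply: etrans (invrZ ub uA) _; congr (_ *: _).
  by rewrite -fmorphV invrK.
rewrite !(=^~ scalerAl, =^~ scalerAr) !scalerA -!rmorphM !mulrA.
congr (_%:C%C *: _).
transitivity (al * p ^- 2 * (e * sg)); first by ring.
rewrite W (_ : (e * M) *: sg = e * M * sg)//; ring.
Qed.

Section KernelIdentities.
Context {R : realType} {m : nat}.
Notation Rm := 'rV[R]_m.
Notation Cl := (cliff R[i] m).

Lemma harmonic_kernel_twist k (Z : Rm -> mpoly m R[i]) (p : Cl) v w :
  vec_product p -> p \is a GRing.unit -> harmonic_kernel k Z ->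
  eval_cplx (Z (tw p v)) (tw p w) = eval_cplx (Z v) w.
Proof.
move=> vp up; have vr := vec_product_rev vp; have ur := unit_rev up.
exact: (eval_harmonic_kernel_isometry (L := tw (crev p)) (fun x y => twistD x y vp)
  (fun t x => twistZ t x vp) (fun x y => twistD x y vr)
  (fun x => enorm_twist x vp up) (fun x => enorm_twist x vr ur)
  (fun x => twistKV x vp up) (fun x => twistK x vp up)).
Qed.

(** The isometry tw p satisfies (tw p x) p = e p x because p~ p = e |p|^2, and the conjugate of p is
    |p|^2 p^-1. *)
Lemma monogenic_kernel_twist (S : {vspace Cl}) k (Z : Rm -> mpoly m Cl) (p : Cl) v w s :
  left_ideal S -> vec_product p -> p \is a GRing.unit -> monogenic_kernel S k Z -> s \in S ->
  eval_cliff (Z (tw p v)) (tw p w) * p * s = p * (eval_cliff (Z v) w * s).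
Proof.
move=> idS vp up HZ sS; have vr := vec_product_rev vp; have ur := unit_rev up.
have [e ee [E1 _]] := rev_mul_self vp.
have p0 := cabs_neq0 vp up.
have p20 : cabs p ^+ 2 != 0 by rewrite expf_neq0.
apply: (eval_monogenic_kernel_isometry (L := tw (crev p)) (fun x y => twistD x y vp)
  (fun t x => twistZ t x vp) (fun x y => twistD x y vr)
  (fun x => enorm_twist x vp up) (fun x => enorm_twist x vr ur)
  (fun x => twistKV x vp up) (fun x => twistK x vp up) (e := e) (r := cabs p ^+ 2) v w
  idS up _ p20 ee _ HZ sS).
- by rewrite (vec_product_inv vp up) scalerA -rmorphM (mulfV p20) scale1r.
- move=> x; rewrite (cvec_twist _ vp) -scalerAl -[_ * crev p * p]mulrA E1 real_scalar_mulr.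
  rewrite mulr_algl -scalerAl scalerA -rmorphM mulrCA (mulVf p20) mulr1.
  by [].
Qed.

Context (c d : Cl) (phi : Rm -> Rm) (e : R) (ee : e ^+ 2 = 1).
Hypothesis H : mobius_affine c d phi e \/ mobius_inversive c d phi e.
Variables (j k : nat) (x y : Rm).
Hypotheses (ux : den c d x \is a GRing.unit) (uy : den c d y \is a GRing.unit).

Let vx := den_vec_product H x.
Let vy := den_vec_product H y.
Let x0 := cabs_neq0 vx ux.
Let y0 := cabs_neq0 vy uy.

Lemma E_even_mobius (Z : Rm -> mpoly m R[i]) u v : harmonic_kernel k Z ->
  E_even j Z (phi x - phi y) (twist (den c d y) u) (twist (den c d x) v) =
  (cabs (den c d x) ^+ (2 * m))%:C%C *
    ((J_even j (den c d y))^-1 * E_even j Z (x - y) u v * Jneg_even j (den c d x)).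
Proof.
move=> HZ; rewrite -!twE /E_even (reflect_mobius ee H u ux uy).
rewrite (enorm_mobius_sub ee H ux uy).
have -> := harmonic_kernel_twist v (reflect_dir (x - y) u) vx ux HZ.
rewrite (weight_even j m _ _ x0) /J_even /Jneg_even -!cabsE.
exact: weights_cplx.
Qed.

Variables (sg : R) (sg1 : sg ^+ 2 = 1).
Hypothesis Hsg : forall z, den c d z * crev (den c d z) = (sg * cabs (den c d z) ^+ 2)%:C%C%:A.

(** The kernel invariance is used at the spinor p^-1 s, which lies in the left ideal [S] together
    with s. *)
Lemma E_odd_mobius (S : {vspace Cl}) (Z : Rm -> mpoly m Cl) u v s :
  left_ideal S -> monogenic_kernel S k Z -> s \in S ->
  E_odd j Z (phi x - phi y) (twist (den c d y) u) (twist (den c d x) v) * s =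
  (cabs (den c d x) ^+ (2 * m) * (e * sg))%:C%C *:
    ((J_odd j (den c d y))^-1 * E_odd j Z (x - y) u v * Jneg_odd j (den c d x) * s).
Proof.
move=> idS HZ sS.
have pS : (den c d x)^-1 * s \in S by exact: idS.
rewrite -!twE /E_odd (reflect_mobius ee H u ux uy) (enorm_mobius_sub ee H ux uy).
have := monogenic_kernel_twist v (reflect_dir (x - y) u) idS vx ux HZ pS.
rewrite /J_odd /Jneg_odd -!cabsE -!crevE -!vecE.
rewrite (mobius_sub H ux uy).
have W := weight_odd j m (enorm (x - y)) (cabs (den c d y)) x0.
have q0 : cabs (den c d y) ^ (m%:Z - (2 * j)%:Z + 2) != 0 by rewrite expfz_neq0.
exact: (weights_cliff e _ (unit_rev uy) ux q0 x0 sg1 (Hsg x) W).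
Qed.

End KernelIdentities.

(** * Measurability of continuous functions and of all integrands *)

Section ContinuousMeasurable.
Context {R : realType} {m : nat}.
Notation mR := (measurableTypeR R).
Notation Rm := 'rV[R]_m.
Notation T := (m.-tuple mR).

(** An open set is the union of the countably many boxes with rational centre and radius 1 / (n + 1)
    that it contains. *)
Lemma measurable_open_row (O : set Rm) : open O -> measurable (@row_of_tuple R m @^-1` O).
Proof.
move=> oO.
pose box (z : {ffun 'I_m -> rat} * nat) : set Rm :=
  [set x | forall i, `|x 0 i - ratr (z.1 i)| < z.2.+1%:R^-1].
have mbox z : measurable (@row_of_tuple R m @^-1` box z).
  rewrite (_ : _ @^-1` _ = \bigcap_(i in [set: 'I_m])
      ((fun t : T => tnth t i) @^-1` `]ratr (z.1 i) - z.2.+1%:R^-1, ratr (z.1 i) + z.2.+1%:R^-1[)); last first.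
    apply/seteqP; split => t /= H i => [_|]; have := H i; rewrite mxE /= in_itv /=.
      by rewrite ltr_distl.
    by move=> /(_ I); rewrite ltr_distl.
  apply: fin_bigcap_measurable => // i _.
  by rewrite -[X in measurable X]setTI; apply: measurable_tnth.
have -> : O = \bigcup_(z in [set z | box z `<=` O]) box z.
  apply/seteqP; split => [x Ox|x [z zO zx]]; last exact: zO.
  have /nbhs_ballP[eps /= eps0 xO] : nbhs x O by exact: open_nbhs_nbhs.
  (* The point and any other point of the box are each within the radius of the rational centre, so
     a radius below eps / 2 keeps the box in the ball. *)
  have [n ne] : exists n : nat, n.+1%:R^-1 < eps / 2.
    have e20 : 0 < eps / 2 by rewrite divr_gt0.
    exists (Num.bound (eps / 2)^-1); rewrite invf_plt ?posrE//.
    apply: lt_le_trans (archi_boundP _) _; first by rewrite invr_ge0 ltW.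
    by rewrite ler_nat.
  have r0 : 0 < n.+1%:R^-1 :> R by rewrite invr_gt0.
  have /choice[q Hq] : forall i, exists q : rat, `|x 0 i - ratr q| < n.+1%:R^-1.
    move=> i; have /rat_in_itvoo[q] : x 0 i - n.+1%:R^-1 < x 0 i + n.+1%:R^-1.
      by rewrite ltrD2l gt0_cp.
    by rewrite in_itv /= => qi; exists q; rewrite distrC ltr_distl.
  exists ([ffun i => q i], n); last by move=> i /=; rewrite ffunE.
  move=> z Hz; apply: xO; split => // a i; rewrite /ball /= (ord1 a).
  have -> : x 0 i - z 0 i = (x 0 i - ratr (q i)) - (z 0 i - ratr (q i)) by ring.
  apply: le_lt_trans (ler_normB _ _) _; rewrite [eps]splitr.
  apply: ltrD; apply: lt_trans ne; first exact: Hq.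
  by have := Hz i; rewrite ffunE.
rewrite preimage_bigcup bigcup_mkcond.
apply: countable_bigcupT_measurable; first exact: countableP.
by move=> z; case: ifP.
Qed.

Lemma continuous_measurable_on (g : Rm -> R) : continuous g -> measurable_on g.
Proof.
move=> cg mD; apply: (measurability _ (RGenOInfty.measurableE R)) => //.
move=> /= _ [_ [x ->] <-]; apply: measurableI => //.
apply: (@measurable_open_row (g @^-1` `]x, +oo[)).
by apply: open_comp => // y _; exact: cg.
Qed.

End ContinuousMeasurable.

Section MeasurableConstructions.
Context {R : realType} {m : nat} (dS : measure_display) (S : measurableType dS).
Notation Rm := 'rV[R]_m.
Notation Cl := (cliff R[i] m).
Notation mreal := (@measurable_real R dS S).

Let Pm := @subalgebra_measurable_real R dS S.

Lemma measurable_real_expz (f : S -> R) (z : int) : mreal f -> (forall s, 0 <= f s) ->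
  mreal (fun s => f s ^ z).
Proof.
move=> mf f0; rewrite (_ : (fun s => _) = (fun x : R => x `^ z%:~R) \o f).
  exact: measurableT_comp (measurable_powR _) mf.
by apply/funext => s /=; rewrite powR_intmul.
Qed.

Lemma measurable_real_enorm (f : S -> Rm) : measurable_row f -> mreal (fun s => enorm (f s)).
Proof. exact: measurable_on_row_comp (@measurable_on_row_enorm R m). Qed.

Lemma measurable_real_cabs (g : S -> Cl) : cliff_in mreal g -> mreal (fun s => cabs (g s)).
Proof.
move=> mg; under eq_fun do rewrite cabsE /cnorm.
apply: (@measurableT_comp _ _ _ _ _ _ (@Num.sqrt R)).
  by apply: continuous_measurable_fun; exact: sqrt_continuous.
apply: (subalgebra_sum Pm) => A; have [_ PD _] := Pm; have [g1 g2] := mg A.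
by apply: PD; exact: (subalgebraX Pm).
Qed.

Lemma cliff_in_den c d (f : S -> Rm) : measurable_row f ->
  cliff_in mreal (fun s => den c d (f s) : Cl).
Proof.
move=> mf; under eq_fun do rewrite denE.
apply: (cliff_inD Pm); last exact: (cliff_in_cst Pm).
by apply: (cliff_inM Pm); [exact: (cliff_in_cst Pm)|exact: (cliff_in_vec Pm)].
Qed.

(** For a product of vectors the inverse is |g|^-2 times the conjugate. The formula stays right at g
    = 0, where both sides are 0 by convention. *)
Lemma cliff_in_inv (g : S -> Cl) : (forall s, vec_product (g s)) -> cliff_in mreal g ->
  cliff_in mreal (fun s => (g s)^-1).
Proof.
move=> vg mg; rewrite (_ : (fun s => _) = (fun s => (cabs (g s) ^ (- 2%:Z))%:C%C *: cbar (g s))).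
  apply: (cliff_inZ Pm); last exact: (cliff_in_conj Pm).
  apply: (cplx_in_real Pm); apply: measurable_real_expz; first exact: measurable_real_cabs.
  by move=> s; exact: cnorm_ge0.
apply/funext => s; have [g0|ug] := cabs_eq0_vec_product (vg s).
  rewrite g0 invr0 (_ : cbar 0 = 0) ?scaler0//.
  by have := cconjZ 0 (0 : Cl); rewrite conjc0 !scale0r.
exact: vec_product_inv (vg s) ug.
Qed.

Lemma measurable_row_reflect_dir (f g : S -> Rm) : measurable_row f -> measurable_row g ->
  measurable_row (fun s => reflect_dir (f s) (g s)).
Proof.
move=> mf mg; rewrite /reflect_dir; apply: (in_vec_part (P := mreal)).
apply: (cliff_inZ Pm).
  apply: (cplx_in_real Pm); apply: (@measurable_real_expz _ (- 2%:Z)).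
    exact: measurable_real_enorm.
  by move=> s; exact: sqrtr_ge0.
under eq_fun do rewrite -!vecE.
apply: (cliff_inM Pm); last exact: (cliff_in_vec Pm).
by apply: (cliff_inM Pm); exact: (cliff_in_vec Pm).
Qed.

Lemma measurable_row_twist p (g : S -> Rm) : measurable_row g ->
  measurable_row (fun s => twist p (g s)).
Proof.
move=> mg; rewrite /twist; apply: (in_vec_part (P := mreal)).
apply: (cliff_inZ Pm); first exact: (cplx_in_cst Pm).
under eq_fun do rewrite -!vecE.
apply: (cliff_inM Pm); last exact: (cliff_in_cst Pm).
by apply: (cliff_inM Pm); [exact: (cliff_in_cst Pm)|exact: (cliff_in_vec Pm)].
Qed.

Lemma measurable_row_mobius a b c d (f : S -> Rm) : (forall x, vec_product (den c d x)) ->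
  measurable_row f -> measurable_row (fun s => mobius a b c d (f s)).
Proof.
move=> vd mf; rewrite /mobius; apply: (in_vec_part (P := mreal)).
apply: (cliff_inM Pm); last by apply: cliff_in_inv => //; exact: cliff_in_den.
exact: cliff_in_den.
Qed.

Lemma cplx_in_eval_const (p : mpoly m R[i]) (g : S -> Rm) : measurable_row g ->
  cplx_in mreal (fun s => eval_cplx p (g s)).
Proof.
apply: (in_eval_cplx Pm (n := mmeasure mdeg p) (p := fun=> p)) => // al.
exact: (cplx_in_cst Pm).
Qed.

Lemma cliff_in_eval_const (p : mpoly m Cl) (g : S -> Rm) : measurable_row g ->
  cliff_in mreal (fun s => eval_cliff p (g s)).
Proof.
apply: (in_eval_cliff Pm (n := mmeasure mdeg p) (p := fun=> p)) => // al.
exact: (cliff_in_cst Pm).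
Qed.

Lemma cplx_in_E_even j (Z : Rm -> mpoly m R[i]) (f g : S -> Rm) v :
  measurable_row f -> measurable_row g -> cplx_in mreal (fun s => E_even j Z (f s) (g s) v).
Proof.
move=> mf mg; apply: (cplx_inM Pm); last by apply: cplx_in_eval_const; exact: measurable_row_reflect_dir.
apply: (cplx_in_real Pm); apply: measurable_real_expz; first exact: measurable_real_enorm.
by move=> s; exact: sqrtr_ge0.
Qed.

Lemma cliff_in_E_odd j (Z : Rm -> mpoly m Cl) (f g : S -> Rm) v :
  measurable_row f -> measurable_row g -> cliff_in mreal (fun s => E_odd j Z (f s) (g s) v).
Proof.
move=> mf mg; apply: (cliff_inM Pm); last by apply: cliff_in_eval_const; exact: measurable_row_reflect_dir.
under eq_fun do rewrite -vecE invr_expz.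
apply: (cliff_inZ Pm); last exact: (cliff_in_vec Pm).
apply: (cplx_in_real Pm); apply: measurable_real_expz; first exact: measurable_real_enorm.
by move=> s; exact: sqrtr_ge0.
Qed.

Lemma cplx_in_Jneg_even j c d (f : S -> Rm) : measurable_row f ->
  cplx_in mreal (fun s => Jneg_even j (den c d (f s))).
Proof.
move=> mf; under eq_fun do rewrite /Jneg_even -cabsE.
apply: (cplx_in_real Pm); apply: measurable_real_expz; last by move=> s; exact: cnorm_ge0.
by apply: measurable_real_cabs; exact: cliff_in_den.
Qed.

Lemma cliff_in_Jneg_odd j c d (f : S -> Rm) : measurable_row f ->
  cliff_in mreal (fun s => Jneg_odd j (den c d (f s))).
Proof.
move=> mf; under eq_fun do rewrite /Jneg_odd -cabsE -crevE exprnN.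
apply: (cliff_inZ Pm); last by apply: (cliff_in_rev Pm); exact: cliff_in_den.
apply: (cplx_in_real Pm); apply: (@measurable_real_expz _ (- (m + 2 * j)%:Z)).
  by apply: measurable_real_cabs; exact: cliff_in_den.
by move=> s; exact: cnorm_ge0.
Qed.

Lemma msize_homog (K : nzRingType) k (p : mpoly m K) : p \is ishomog1 k (@mdeg m) ->
  (mmeasure mdeg p <= k.+1)%N.
Proof.
move=> /dhomogP hp; rewrite mmeasureE big_seq; apply/bigmax_leqP_seq => al ial _.
by rewrite (hp _ ial).
Qed.

Lemma cplx_in_eval_field k (F : Rm -> mpoly m R[i]) (f g : S -> Rm) :
  Ccinf_harmonic k F -> measurable_row f -> measurable_row g ->
  cplx_in mreal (fun s => eval_cplx (F (f s)) (g s)).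
Proof.
move=> [hF sF _] mf mg; apply: (in_eval_cplx Pm (n := k.+1)) => //.
  by move=> s; apply: msize_homog; have [] := hF (f s).
move=> al; have [/(_ 0%N) c1 /(_ 0%N) c2] := sF al.
split.
  exact: (@measurable_on_row_comp R m _ _ _ (measurableTypeR R) f _ (continuous_measurable_on c1) mf).
exact: (@measurable_on_row_comp R m _ _ _ (measurableTypeR R) f _ (continuous_measurable_on c2) mf).
Qed.

Lemma cliff_in_eval_field (V : {vspace Cl}) k (F : Rm -> mpoly m Cl) (f g : S -> Rm) :
  Ccinf_monogenic V k F -> measurable_row f -> measurable_row g ->
  cliff_in mreal (fun s => eval_cliff (F (f s)) (g s)).
Proof.
move=> [hF sF _] mf mg; apply: (in_eval_cliff Pm (n := k.+1)) => //.
  by move=> s; apply: msize_homog; have [] := hF (f s).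
move=> al A; have [/(_ 0%N) c1 /(_ 0%N) c2] := sF al A.
split.
  exact: (@measurable_on_row_comp R m _ _ _ (measurableTypeR R) f _ (continuous_measurable_on c1) mf).
exact: (@measurable_on_row_comp R m _ _ _ (measurableTypeR R) f _ (continuous_measurable_on c2) mf).
Qed.

End MeasurableConstructions.

Section ExceptionalPoints.
Context {R : realType} {m : nat}.
Notation mR := (measurableTypeR R).
Notation Rm := 'rV[R]_m.
Notation T := (m.-tuple mR).
Hypothesis m_gt0 : (0 < m)%N.

(** Points are measurable, and null in positive dimension. The exceptional point in question is the
    value of the Moebius map at infinity. *)
Lemma Rintegral_off_point (F G : Rm -> R) (a : Rm) : measurable_on G ->
  (forall x, x != a -> F x = G x) -> measurable_on F /\
  \int[lebesgue m]_t F (row_of_tuple t) = \int[lebesgue m]_t G (row_of_tuple t).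
Proof.
move=> mG FG; pose ta : T := tuple_of_row a.
have ne t : t != ta -> row_of_tuple t != a.
  by rewrite /ta; apply: contra => /eqP <-; rewrite row_of_tupleK.
have mF : measurable_on F.
  rewrite /measurable_on /measurable_on_row (_ : (fun t => _) =
    fun t : T => if t == ta then F a else G (row_of_tuple t)); last first.
    apply/funext => t; case: eqP => [->|/eqP/ne/FG//]; by rewrite /ta tuple_of_rowK.
  apply: measurable_fun_ifT => //; apply: (measurable_fun_bool true).
  rewrite setTI (_ : _ @^-1` _ = [set ta]); first exact: measurable_point.
  by apply/seteqP; split => t /= /eqP.
split=> //; rewrite /Rintegral; congr fine.
apply: ae_eq_integral => //; [exact/measurable_EFinP|exact/measurable_EFinP|].
exists [set ta]; split; [exact: measurable_point|exact: lebesgue_set1|].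
move=> t /= H; apply: contrapT => /eqP tta; apply: H => _.
by congr EFin; apply: FG; exact: ne.
Qed.

Lemma cplx_integral_off_point (F G : Rm -> R[i]) (a : Rm) : cplx_in measurable_on G ->
  (forall x, x != a -> F x = G x) ->
  cplx_integral (lebesgue m) F = cplx_integral (lebesgue m) G.
Proof.
move=> [m1 m2] FG; rewrite /cplx_integral; congr Complex.
  by have [_] := @Rintegral_off_point (fun x => complex.Re (F x)) _ a m1 (fun x xa => congr1 _ (FG x xa)).
by have [_] := @Rintegral_off_point (fun x => complex.Im (F x)) _ a m2 (fun x xa => congr1 _ (FG x xa)).
Qed.

End ExceptionalPoints.

Section MobiusChangeOfVariables.
Context {R : realType} {m : nat}.
Notation Rm := 'rV[R]_m.
Notation Cl := (cliff R[i] m).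
Hypothesis m_gt0 : (0 < m)%N.
Context (c d : Cl) (phi : Rm -> Rm) (e : R) (ee : e ^+ 2 = 1).
Hypothesis H : mobius_affine c d phi e \/ mobius_inversive c d phi e.

(* The Jacobian of phi at x is |c x + d|^(-2m). *)
Lemma mobius_cov : exists (psi : Rm -> Rm) (rho : Rm -> R) (a : Rm),
  cov (@lebesgue R m) psi rho /\ forall x', x' != a ->
    [/\ den c d (psi x') \is a GRing.unit, phi (psi x') = x' &
        rho x' = cabs (den c d (psi x')) ^+ (2 * m)].
Proof.
have e0 : e != 0 by rewrite -sqrf_eq0 ee oner_eq0.
have e1 : `|e| = 1.
  by apply/eqP; rewrite -(@eqrXn2 _ 2)// expr1n real_normK ?num_real// ee.
have iso p : vec_product p -> p \is a GRing.unit -> cov (@lebesgue R m) (tw (crev p)) (fun=> 1).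
  move=> vp up; have vr := vec_product_rev vp; have ur := unit_rev up.
  exact: (cov_isometry (fun x y => twistD x y vr) (fun k x => twistZ k x vr)
    (fun x => enorm_twist x vr ur) (fun x => twistK x vp up)).
case: H => [[q [vq uq denq [b phiE]]]|[vc uc [a [b [denE phiE]]]]].
- have q0 := cabs_neq0 vq uq.
  pose s : R := e * cabs q ^- 2.
  have s0 : s != 0 by rewrite mulf_neq0// invr_eq0 expf_neq0.
  have sV0 : s^-1 != 0 by rewrite invr_eq0.
  have C1 := cov_affine (- b) (oner_neq0 R).
  have C := cov_comp C1 (cov_comp (iso q vq uq) (cov_affine (m := m) 0 sV0)).
  (* A similarity has no exceptional value, so the point is arbitrary. *)
  eexists; eexists; exists 0; split; first exact: C.
  move=> x' _ /=; rewrite denq; split => //.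
    rewrite phiE scale1r subrK addr0 (twistKV _ vq uq) -/s.
    by rewrite scalerA mulfV// scale1r.
  rewrite normr1 expr1n !mul1r /s normfV normrM e1 mul1r normfV normrX.
  by rewrite invrK ger0_norm ?cnorm_ge0// exprM.
- have c0 := cabs_neq0 vc uc.
  pose s : R := e * cabs c ^- 2.
  have s0 : s != 0 by rewrite mulf_neq0// invr_eq0 expf_neq0.
  have sV0 : s^-1 != 0 by rewrite invr_eq0.
  have C1 := cov_affine (- b) (oner_neq0 R).
  (* The normal form solved for x: subtract [a] and divide by [s], rotate back with c~, invert, and
     translate by -b. The densities multiply to |s|^-m |z|^(-2m), which is |c x + d|^(2m). *)
  have C := cov_comp C1 (cov_comp (@cov_sphere_inv R m m_gt0)
    (cov_comp (iso c vc uc) (cov_affine (- (s^-1 *: a)) sV0))).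
  eexists; eexists; exists a; split; first exact: C.
  move=> x' xa /=.
  set z := tw (crev c) (s^-1 *: x' - s^-1 *: a).
  have vr := vec_product_rev vc; have ur := unit_rev uc.
  have z0 : enorm z != 0.
    rewrite /z (enorm_twist _ vr ur) -scalerBr enorm_eq0 scaler_eq0 negb_or sV0 /=.
    by rewrite subr_eq0.
  have nz : enorm (sphere_inv z) = (enorm z)^-1.
    rewrite /sphere_inv enormZ ger0_norm ?invr_ge0 ?exprn_ge0 ?sqrtr_ge0//.
    by rewrite expr2 invfM mulfVK.
  have i0 : sphere_inv z != 0 by rewrite -enorm_eq0 nz invr_eq0.
  have dE : den c d (1 *: sphere_inv z - b) = c * vec (sphere_inv z).
    by rewrite denE scale1r subrK.
  have cE : cabs (c * vec (sphere_inv z)) = cabs c * (enorm z)^-1.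
    by rewrite (cnormM _ vc) cnorm_cvec nz.
  rewrite dE cE; split.
  + rewrite vec_product_unitE; last by apply: vec_productM => //; exact: vec_product_cvec.
    by rewrite cE mulf_neq0// invr_eq0.
  + have bE : 1 *: sphere_inv z - b + b = sphere_inv z by rewrite scale1r subrK.
    rewrite phiE bE// nz.
    have -> : (enorm z)^-1 ^- 2 *: sphere_inv z = z.
      by rewrite /sphere_inv scalerA exprVn invrK mulfV ?scale1r// expf_neq0.
    rewrite /z (twistKV _ vc uc) -/s -scalerBr scalerA mulfV// scale1r.
    by rewrite addrC subrK.
  + rewrite normr1 expr1n !mul1r /inv_jacobian exprMn exprVn mulrC; congr (_ * _).
    rewrite /s normfV normrM e1 mul1r normfV normrX invrK.
    by rewrite ger0_norm ?cnorm_ge0// exprM.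
Qed.

(** The substitution is made along the inverse map [psi], with density |c x + d|^(2m). [GL] involves
    [mobius_inv], which is defined by choice; its measurability comes from agreeing off one point
    with the density times [GR] composed with [psi]. *)
Lemma mobius_cplx_integral (GL GR : Rm -> R[i]) : cplx_in measurable_on GR ->
  (forall x, den c d x \is a GRing.unit ->
    GL (phi x) = (cabs (den c d x) ^+ (2 * m))%:C%C * GR x) ->
  cplx_integral (lebesgue m) GL = cplx_integral (lebesgue m) GR.
Proof.
move=> mG E; have [psi [rho [a [C Hpsi]]]] := mobius_cov.
rewrite -(cov_cplx_integral C mG).
have [mpsi mrho _ _] := C.
apply: (cplx_integral_off_point m_gt0 (a := a)).
  apply: (cplx_inM subalgebra_measurable_on).
    exact: (cplx_in_real subalgebra_measurable_on).
  case: mG => m1 m2; split.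
    exact: (@measurable_on_row_comp R m _ _ _ (measurableTypeR R) _ (fun x => complex.Re (GR x)) m1 mpsi).
  exact: (@measurable_on_row_comp R m _ _ _ (measurableTypeR R) _ (fun x => complex.Im (GR x)) m2 mpsi).
move=> x' xa; have [ux phiE ->] := Hpsi x' xa.
by rewrite -{1}phiE; exact: E.
Qed.

(** By [enorm_mobius_sub], distances of images vanish only with the distances of the points. *)
Lemma mobius_inj x x' : den c d x \is a GRing.unit -> den c d x' \is a GRing.unit ->
  phi x = phi x' -> x = x'.
Proof.
move=> ux ux' E; have := enorm_mobius_sub ee H ux ux'; rewrite E subrr.
have -> : enorm (0 : Rm) = 0 by exact: enorm0.
move=> /esym/eqP; rewrite mulf_eq0 invr_eq0 mulf_eq0.
rewrite (negbTE (cabs_neq0 (den_vec_product H x) ux)).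
rewrite (negbTE (cabs_neq0 (den_vec_product H x') ux')) !orbF enorm_eq0 subr_eq0.
by move/eqP.
Qed.

End MobiusChangeOfVariables.

(** * The integrals over the sphere on the two sides *)

Section InnerIntegrals.
Context {R : realType} {m : nat}.
Notation mR := (measurableTypeR R).
Notation Rm := 'rV[R]_m.
Notation T := (m.-tuple mR).
Notation Cl := (cliff R[i] m).
Notation sigma := (@sphere_measure R m).

Lemma eval_cliff_in (S : {vspace Cl}) (p : mpoly m Cl) u : left_ideal S ->
  (forall al, mcoeff al p \in S) -> eval_cliff p u \in S.
Proof.
move=> idS pS; rewrite /eval_cliff mevalE; apply: memv_suml => al _.
have -> : \prod_i ((u 0 i)%:C%C%:A : Cl) ^+ al i = cliff_of_real (\prod_i u 0 i ^+ al i).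
  by rewrite rmorph_prod; apply: eq_bigr => i _; rewrite rmorphXn.
by rewrite (cliff_of_realC _ (mcoeff al p)); exact: idS.
Qed.

Lemma cov_sphere_twist (q : Cl) : vec_product q -> q \is a GRing.unit ->
  cov sigma (twist q) (fun=> 1).
Proof.
move=> vq uq; rewrite (_ : twist q = tw q); last by apply/funext => u; rewrite twE.
exact: (cov_sphere_isometry (fun x y => twistD x y vq) (fun k x => twistZ k x vq)
  (fun x => enorm_twist x vq uq) (fun x => twistKV x vq uq)).
Qed.

Lemma measurable_on_E_even j (Z : Rm -> mpoly m R[i]) w z :
  cplx_in measurable_on (fun u => E_even j Z w u z).
Proof.
have mw : measurable_row (fun t : T => w) by exact: measurable_row_cst.
by have [m1 m2] := cplx_in_E_even j Z z mw (@measurable_row_of_tuple R m); split; [exact: m1|exact: m2].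
Qed.

Lemma measurable_on_E_odd j (Z : Rm -> mpoly m Cl) w z :
  cliff_in measurable_on (fun u => E_odd j Z w u z).
Proof.
have mw : measurable_row (fun t : T => w) by exact: measurable_row_cst.
move=> A; have [m1 m2] := cliff_in_E_odd j Z z mw (@measurable_row_of_tuple R m) A.
by split; [exact: m1|exact: m2].
Qed.

Lemma measurable_on_eval_cplx_twist (p : mpoly m R[i]) (q : Cl) :
  cplx_in measurable_on (fun u => eval_cplx p (twist q u)).
Proof.
by have [m1 m2] := cplx_in_eval_const p (measurable_row_twist q (@measurable_row_of_tuple R m));
  split; [exact: m1|exact: m2].
Qed.

Lemma measurable_on_eval_cliff_twist (p : mpoly m Cl) (q : Cl) :
  cliff_in measurable_on (fun u => eval_cliff p (twist q u)).
Proof.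
move=> A.
by have [m1 m2] := cliff_in_eval_const p (measurable_row_twist q (@measurable_row_of_tuple R m)) A;
  split; [exact: m1|exact: m2].
Qed.

Context (a b c d : Cl) (e : R) (ee : e ^+ 2 = 1).
Notation phi := (mobius a b c d).
Notation den := (den c d).
Hypothesis H : mobius_affine c d phi e \/ mobius_inversive c d phi e.
Variables (j k : nat) (v y : Rm).
Hypothesis uy : den y \is a GRing.unit.

Let vy := den_vec_product H y.

Lemma mobius_invK x : den x \is a GRing.unit -> mobius_inv a b c d (phi x) = x.
Proof.
move=> ux; rewrite /mobius_inv; case: xgetP => [z -> [uz E]|/(_ x)[]]; last by split.
exact: (mobius_inj ee H uz ux E).
Qed.

Let mrow1 : measurable_row (fun p : T * T => row_of_tuple p.1).
Proof. exact: measurable_row_comp (@measurable_row_of_tuple R m) measurable_fst. Qed.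

Let mrow2 : measurable_row (fun p : T * T => row_of_tuple p.2).
Proof. exact: measurable_row_comp (@measurable_row_of_tuple R m) measurable_snd. Qed.

Let mphi d0 (S : measurableType d0) (f : S -> Rm) : measurable_row f ->
  measurable_row (fun s => phi (f s)).
Proof. exact: measurable_row_mobius (den_vec_product H). Qed.

Section Even.
Variables (Z f : Rm -> mpoly m R[i]).
Hypotheses (HZ : harmonic_kernel k Z) (Hf : Ccinf_harmonic k f).

Definition inner_even x : R[i] := cplx_integral sigma (fun u =>
  ((J_even j (den y))^-1 * E_even j Z (x - y) u v * Jneg_even j (den x)) *
    eval_cplx (f (phi x)) (twist (den y) u)).

Lemma measurable_inner_even : cplx_in measurable_on inner_even.
Proof.
apply: (@measurable_sphere_cplx_integral R m (fun x u =>
  ((J_even j (den y))^-1 * E_even j Z (x - y) u v * Jneg_even j (den x)) *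
    eval_cplx (f (phi x)) (twist (den y) u))).
have P := @subalgebra_measurable_real R _ (T * T)%type.
have msub : measurable_row (fun p : T * T => row_of_tuple p.1 - y).
  by apply: measurable_rowD => //; exact: measurable_row_cst.
have G : cplx_in (@measurable_real R _ (T * T)%type) (fun p =>
  ((J_even j (den y))^-1 * E_even j Z (row_of_tuple p.1 - y) (row_of_tuple p.2) v *
     Jneg_even j (den (row_of_tuple p.1))) *
    eval_cplx (f (phi (row_of_tuple p.1))) (twist (den y) (row_of_tuple p.2))).
  apply: (cplx_inM P).
    apply: (cplx_inM P); last exact: cplx_in_Jneg_even mrow1.
    by apply: (cplx_inM P); [exact: (cplx_in_cst P)|exact: cplx_in_E_even msub mrow2].
  exact: (cplx_in_eval_field Hf (mphi mrow1) (measurable_row_twist _ mrow2)).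
exact: G.
Qed.

(** The rotation u' = twist q u preserves the surface measure, and [mobius_inv] returns x at phi x,
    so v' is the twist of v by c x + d. The integrands then differ by a real factor independent of
    u. *)
Lemma inner_even_mobius x : den x \is a GRing.unit ->
  cplx_integral sigma (fun u' => E_even j Z (phi x - phi y) u'
     (twist (den (mobius_inv a b c d (phi x))) v) * eval_cplx (f (phi x)) u') =
  (cabs (den x) ^+ (2 * m))%:C%C * inner_even x.
Proof.
move=> ux; rewrite (mobius_invK ux).
have P := @subalgebra_measurable_on R m.
have M1 : cplx_in measurable_on (fun u' => E_even j Z (phi x - phi y) u'
     (twist (den x) v) * eval_cplx (f (phi x)) u').
  apply: (cplx_inM P); last exact: eval_cplx_measurable.
  exact: measurable_on_E_even.
rewrite -(cov1_cplx_integral (cov_sphere_twist vy uy) M1).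
rewrite /inner_even -cplx_integral_scale; last first.
  apply: (cplx_inM P).
    apply: (cplx_inM P); last exact: (cplx_in_cst P).
    apply: (cplx_inM P); first exact: (cplx_in_cst P).
    exact: measurable_on_E_even.
  exact: measurable_on_eval_cplx_twist.
congr cplx_integral; apply/funext => u.
apply: etrans (congr1 ( *%R^~ _) (E_even_mobius ee H j ux uy u v HZ)) _.
exact: esym (mulrA _ _ _).
Qed.

End Even.

Section Odd.
Variables (S : {vspace Cl}) (Z f : Rm -> mpoly m Cl).
Hypotheses (idS : left_ideal S) (HZ : monogenic_kernel S k Z) (Hf : Ccinf_monogenic S k f).
Variables (sg : R) (sg1 : sg ^+ 2 = 1).
Hypothesis Hsg : forall z, den z * crev (den z) = (sg * cabs (den z) ^+ 2)%:C%C%:A.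

Definition inner_odd x : Cl := cliff_integral sigma (fun u =>
  ((J_odd j (den y))^-1 * E_odd j Z (x - y) u v * Jneg_odd j (den x)) *
    eval_cliff (f (phi x)) (twist (den y) u)).

Lemma measurable_inner_odd : cliff_in measurable_on inner_odd.
Proof.
apply: (@measurable_sphere_cliff_integral R m (fun x u =>
  ((J_odd j (den y))^-1 * E_odd j Z (x - y) u v * Jneg_odd j (den x)) *
    eval_cliff (f (phi x)) (twist (den y) u))).
have P := @subalgebra_measurable_real R _ (T * T)%type.
have msub : measurable_row (fun p : T * T => row_of_tuple p.1 - y).
  by apply: measurable_rowD => //; exact: measurable_row_cst.
have G : cliff_in (@measurable_real R _ (T * T)%type) (fun p =>
  ((J_odd j (den y))^-1 * E_odd j Z (row_of_tuple p.1 - y) (row_of_tuple p.2) v *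
     Jneg_odd j (den (row_of_tuple p.1))) *
    eval_cliff (f (phi (row_of_tuple p.1))) (twist (den y) (row_of_tuple p.2))).
  apply: (cliff_inM P).
    apply: (cliff_inM P); last exact: cliff_in_Jneg_odd mrow1.
    by apply: (cliff_inM P); [exact: (cliff_in_cst P)|exact: cliff_in_E_odd msub mrow2].
  exact: (cliff_in_eval_field Hf (mphi mrow1) (measurable_row_twist _ mrow2)).
exact: G.
Qed.

(** As in the even case, with the values of f, which lie in [S], as the spinors to which the odd
    kernel identity is applied. *)
Lemma inner_odd_mobius x : den x \is a GRing.unit ->
  cliff_integral sigma (fun u' => E_odd j Z (phi x - phi y) u'
     (twist (den (mobius_inv a b c d (phi x))) v) * eval_cliff (f (phi x)) u') =
  (cabs (den x) ^+ (2 * m) * (e * sg))%:C%C *: inner_odd x.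
Proof.
move=> ux; rewrite (mobius_invK ux).
have P := @subalgebra_measurable_on R m.
have M1 : cliff_in measurable_on (fun u' => E_odd j Z (phi x - phi y) u'
     (twist (den x) v) * eval_cliff (f (phi x)) u').
  apply: (cliff_inM P); last by apply: cliff_bounded_measurable; exact: eval_cliff_bounded.
  exact: measurable_on_E_odd.
apply: etrans (esym (cov1_cliff_integral (cov_sphere_twist vy uy) M1)) _.
apply: etrans _ (cliff_integral_scale _ _ _); last first.
  apply: (cliff_inM P).
    apply: (cliff_inM P); last exact: (cliff_in_cst P).
    apply: (cliff_inM P); first exact: (cliff_in_cst P).
    exact: measurable_on_E_odd.
  exact: measurable_on_eval_cliff_twist.
congr cliff_integral; apply/funext => u.
apply: (E_odd_mobius ee H j ux uy sg1 Hsg u v idS HZ).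
have [hF _ _] := Hf; have [_ cF _] := hF (phi x).
exact: eval_cliff_in idS cF.
Qed.

End Odd.
End InnerIntegrals.

Lemma mob_signE (R : realType) (m : nat) (a b c d : cliff R[i] m) (e s : R) y :
  den c d y \is a GRing.unit -> vec_product (den c d y) ->
  a * crev d - b * crev c = e%:C%C%:A ->
  den c d y * crev (den c d y) = (s * cabs (den c d y) ^+ 2)%:C%C%:A ->
  mob_sign a b c d y = (e * s)%:C%C%:A.
Proof.
move=> uy vy det Hs; have q0 := cabs_neq0 vy uy.
rewrite /mob_sign -!crevE -cabsE det Hs mulr_algl !scalerA -!rmorphM; congr (_%:C%C *: _).
by field.
Qed.

Theorem proposition8 (R : realType) (m : nat) (m_gt0 : (0 < m)%N)
    (a b c d : cliff R[i] m) (Habcd : vahlen a b c d)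
    (k j : nat) (j_gt0 : (0 < j)%N)
    (v y : 'rV[R]_m) (Hy : den c d y \is a GRing.unit) :
  (forall (Z : 'rV[R]_m -> mpoly m R[i]) (f : 'rV[R]_m -> mpoly m R[i]),
    harmonic_kernel k Z -> Ccinf_harmonic k f ->
    cplx_conv
      (fun x' u' => E_even j Z (x' - mobius a b c d y) u'
                      (twist (den c d (mobius_inv a b c d x')) v))
      (fun x' u' => eval_cplx (f x') u')
    = cplx_conv
      (fun x u => (J_even j (den c d y))^-1 * E_even j Z (x - y) u v *
                  Jneg_even j (den c d x))
      (fun x u => eval_cplx (f (mobius a b c d x)) (twist (den c d y) u)))
  /\
  (forall (S : {vspace cliff R[i] m})
      (Z : 'rV[R]_m -> mpoly m (cliff R[i] m))
      (f : 'rV[R]_m -> mpoly m (cliff R[i] m)),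
    spinor_space S -> monogenic_kernel S k Z -> Ccinf_monogenic S k f ->
    cliff_conv
      (fun x' u' => E_odd j Z (x' - mobius a b c d y) u'
                      (twist (den c d (mobius_inv a b c d x')) v))
      (fun x' u' => eval_cliff (f x') u')
    = mob_sign a b c d y *
      cliff_conv
      (fun x u => (J_odd j (den c d y))^-1 * E_odd j Z (x - y) u v *
                  Jneg_odd j (den c d x))
      (fun x u => eval_cliff (f (mobius a b c d x)) (twist (den c d y) u))).
Proof.
have [e ee det] := vahlen_det Habcd.
have H := mobius_normal_form Habcd ee det.
split.
  move=> Z f HZ Hf; have mG := measurable_inner_even H j v y Z Hf.
  apply: (mobius_cplx_integral m_gt0 ee H mG) => x ux.
  exact: (inner_even_mobius ee H j v Hy f HZ ux).
move=> S Z f [_ idS _] HZ Hf; have [s ss Hs] := den_sign H.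
have mG := measurable_inner_odd H j v y Z Hf.
rewrite (mob_signE Hy (den_vec_product H y) det (Hs y)) mulr_algl.
apply/ffunP => A; rewrite [LHS]ffunE [RHS]ffunE [X in _ *: X]ffunE.
(* The sign is a real constant, so it enters the outer integral of each coefficient without any
   integrability. *)
apply: etrans _ (cplx_integral_scale (lebesgue m) (e * s) (mG A)).
apply: (mobius_cplx_integral m_gt0 ee H) => [|x ux].
  apply: (cplx_inM subalgebra_measurable_on); last exact: (mG A).
  exact: (cplx_in_cst subalgebra_measurable_on).
apply: etrans (congr1 (fun z : cliff R[i] m => z A)
  (inner_odd_mobius ee H j v Hy idS HZ Hf ss Hs ux)) _.
by rewrite ffunE rmorphM; exact: esym (mulrA _ _ _).
Qed.
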